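(* Let $a\in C^1([0,1])$ be a nonnegative function with $a(0)=0$ and $a(x)>0$ for all $x\in(0,1]$, and let $\{f^\varepsilon\}_{\varepsilon\in(0,\varepsilon_0]}$ be a family with $f^\varepsilon\in L^2(R^\varepsilon)$. Suppose that $u^\varepsilon\in H^1(R^\varepsilon)$ and $u^0\in H^1_a(0,1)$ (depending on $\varepsilon$ through $f^\varepsilon$) are solutions, respectively, of $$\int_{R^\varepsilon}A^\varepsilon\big(x,\tfrac y\varepsilon\big)\nabla u^\varepsilon\cdot\nabla\varphi+u^\varepsilon\varphi\,dxdy=\int_{R^\varepsilon}f^\varepsilon\varphi\,dxdy\quad\forall\varphi\in H^1(R^\varepsilon),$$ $$\int_0^1\tilde A(x)u^0_x\varphi_x+|B_1|a^nu^0\varphi\,dx=|B_1|\int_0^1a^n\,(M_\varepsilon f^\varepsilon)\,\varphi\,dx\quad\forall\varphi\in H^1_a(0,1),$$ where $\tilde A(x)=|B_1|a^n(x)A_{01}(x)$. Then there exists a constant $C>0$, independent of $\varepsilon$ and $f^\varepsilon$, such that $$\|u^\varepsilon-E_\varepsilon u^0\|_{H^1(R^\varepsilon)}\le C\,\varepsilon\,\|f^\varepsilon\|_{L^2(R^\varepsilon)}.$$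
   Context: $n\in\mathbb N$; $B_1\subset\mathbb R^n$ is the unit ball centered at $0$, $|B_1|$ its measure. $R^\varepsilon=\{(x,y)\in\mathbb R^{1+n}:x\in(0,1),\,y\in\varepsilon a(x)B_1\}$, $\Omega=R^1$, $\varepsilon\in(0,\varepsilon_0]$, $\varepsilon_0<1$. Coefficients. $A^\varepsilon(x,y)=\sum_{k\ge0}\varepsilon^kA_k(x,y)$ are symmetric uniformly positive definite $(1+n)\times(1+n)$ matrices. $A_0=\mathrm{diag}(A_{01}(x),A_{03}(x,y))$ (block diagonal) is smooth and symmetric with $A_0\xi\cdot\xi\ge\alpha_0|\xi|^2$ for some $\alpha_0>0$, $A_{01}$ a strictly positive smooth scalar function of $x$. For $k\ge1$, $A_k=\begin{bmatrix}A_{k1}(x)&A_{k2}^T(x,y)\\ A_{k2}(x,y)&A_{k3}(x,y)\end{bmatrix}$. There is $C_0$ with $\|A_k\|_{L^\infty(\Omega)}\le C_0$ for all $k$, and $\varepsilon_0$ is small enough that $\alpha_0-\frac{\varepsilon_0C_0}{1-\varepsilon_0}>0$, so that $A^\varepsilon\xi\cdot\xi\ge\big(\alpha_0-\frac{\varepsilon_0C_0}{1-\varepsilon_0}\big)|\xi|^2$ on $\Omega$. Spaces. $L^2_a(0,1)$: measurable $u$ with $\int_0^1a^n|u|^2dx<\infty$; $H^1_a(0,1)=\{u\in L^2_a(0,1):u_x\in L^2_a(0,1)\}$. $H^1(R^\varepsilon)$ has its usual norm. Operators. $E_\varepsilon:L^2_a(0,1)\to L^2(R^\varepsilon)$, $E_\varepsilon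 u(x,y)=u(x)$; $M_\varepsilon:L^2(R^\varepsilon)\to L^2_a(0,1)$, $M_\varepsilon u(x)=\frac1{\varepsilon^na^n(x)|B_1|}\int_{\varepsilon a(x)B_1}u(x,y)\,dy$. *)

(* Defs.v *)
From HB Require Import structures.
From mathcomp Require Import all_boot all_order all_algebra.
From mathcomp Require Import all_classical all_reals all_analysis.

Set Implicit Arguments.
Unset Strict Implicit.
Unset Printing Implicit Defensive.

Import Order.TTheory GRing.Theory Num.Theory.
Import numFieldTopology.Exports numFieldNormedType.Exports.

Local Open Scope classical_set_scope.
Local Open Scope ring_scope.

(** * Lebesgue measure on R^n, with R^n rendered as ['rV[R]_n]

   The library provides a topology on row vectors but no sigma-algebra; we take
   the one generated by the coordinates. *)

Definition measure_rV_display : measure_display.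
Proof. exact: (measure_tuple_display default_measure_display). Qed.

Section measurable_rV.
Context (R : realType) (n : nat).

Let coord_rV (i : 'I_n) (y : 'rV[R]_n) : measurableTypeR R := y ord0 i.

Let rV_set0 : g_sigma_preimage coord_rV set0.
Proof. exact: sigma_algebra0. Qed.

Let rV_setC A : g_sigma_preimage coord_rV A -> g_sigma_preimage coord_rV (~` A).
Proof. exact: sigma_algebraC. Qed.

Let rV_bigcup (F : (set 'rV[R]_n)^nat) :
  (forall i, g_sigma_preimage coord_rV (F i)) ->
  g_sigma_preimage coord_rV (\bigcup_i (F i)).
Proof. exact: sigma_algebra_bigcup. Qed.

HB.instance Definition _ := @isMeasurable.Build measure_rV_display
  'rV[R]_n (g_sigma_preimage coord_rV) rV_set0 rV_setC rV_bigcup.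

End measurable_rV.

Section lebesgue_rV.
Context (R : realType).

Lemma measurable_coord_rV n (i : 'I_n) :
  measurable_fun [set: 'rV[R]_n] (fun y => y ord0 i : measurableTypeR R).
Proof.
move=> _ Y mY; rewrite setTI; apply: sub_sigma_algebra => /=.
rewrite -bigcup_seq/=; exists i => /=; first by rewrite mem_index_enum.
by exists Y => //; rewrite setTI.
Qed.

Lemma measurable_fun_rV d (T : measurableType d) n (f : T -> 'rV[R]_n) :
  (forall i, measurable_fun setT (fun t => f t ord0 i : measurableTypeR R)) ->
  measurable_fun setT f.
Proof.
move=> mf.
apply: (@measurability _ _ _ _ _ _ (\big[setU/set0]_(i < n)
  preimage_set_system setT
    (fun y : 'rV[R]_n => y ord0 i : measurableTypeR R) measurable)) => //.
move=> _ [B + <-]; rewrite -bigcup_seq/= => -[i _ [Y mY <-]].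
by rewrite !setTI -[X in measurable X]setTI; exact: mf.
Qed.

Definition rV_cons n (p : measurableTypeR R * 'rV[R]_n) : 'rV[R]_n.+1 :=
  \row_i (if unlift ord0 i is Some j then p.2 ord0 j else p.1).

Definition rV_uncons n (y : 'rV[R]_n.+1) : measurableTypeR R * 'rV[R]_n :=
  (y ord0 ord0, \row_j y ord0 (lift ord0 j)).

Lemma rV_consK n : cancel (@rV_cons n) (@rV_uncons n).
Proof.
move=> [x y]; rewrite /rV_uncons !mxE unlift_none/=; congr pair.
by apply/rowP => j; rewrite !mxE liftK.
Qed.

Lemma measurable_rV_cons n : measurable_fun setT (@rV_cons n).
Proof.
apply: measurable_fun_rV => i; case: (unliftP ord0 i) => [j|] ->{i}.
  under eq_fun do rewrite !mxE liftK.
  exact: (measurableT_comp (measurable_coord_rV j) measurable_snd).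
under eq_fun do rewrite !mxE unlift_none.
exact: measurable_fst.
Qed.

Lemma measurable_rV_uncons n : measurable_fun setT (@rV_uncons n).
Proof.
apply: measurable_fun_pair => /=; first exact: measurable_coord_rV.
apply: measurable_fun_rV => j.
under eq_fun do rewrite !mxE.
exact: measurable_coord_rV.
Qed.

HB.instance Definition _ n :=
  isMeasurableFun.Build _ _ _ _ (@rV_cons n) (@measurable_rV_cons n).

(** The product-measure library does not export a sigma-finiteness instance
   for [\x] that is usable here, hence the direct proof below. *)
Section step.
Context (n : nat) (m : {sigma_finite_measure set 'rV[R]_n -> \bar R}).

Definition lebesgue_rVS : set 'rV[R]_n.+1 -> \bar R :=
  pushforward (@lebesgue_measure R \x m)%E (@rV_cons n).

Let lebesgue_rVS0 : lebesgue_rVS set0 = 0%E.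
Proof. exact: measure0. Qed.

Let lebesgue_rVS_ge0 A : (0 <= lebesgue_rVS A)%E.
Proof. exact: measure_ge0. Qed.

Let lebesgue_rVS_sigma_additive : semi_sigma_additive lebesgue_rVS.
Proof. exact: measure_semi_sigma_additive. Qed.

HB.instance Definition _ := isMeasure.Build _ _ _ lebesgue_rVS
  lebesgue_rVS0 lebesgue_rVS_ge0 lebesgue_rVS_sigma_additive.

Let lebesgue_rVS_sigma_finite : sigma_finite setT lebesgue_rVS.
Proof.
have /sigma_finiteP[F [FT Fnd Foo]] := sigma_finiteT (@lebesgue_measure R).
have /sigma_finiteP[G [GT Gnd Goo]] := sigma_finiteT m.
exists (fun k => @rV_uncons n @^-1` (F k `*` G k)).
  rewrite -preimage_bigcup -[LHS](preimage_setT (@rV_uncons n)); congr (_ @^-1` _).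
  rewrite -setXTT FT GT predeqE => -[x y]; split.
    move=> [/= [i _ Fix] [j _ Gjy]]; exists (maxn i j) => //; split.
    - by move: x Fix; exact/subsetPset/Fnd/leq_maxl.
    - by move: y Gjy; exact/subsetPset/Gnd/leq_maxr.
  by move=> [i _ []/= ? ?]; split; exists i.
move=> k; have [mF Fk] := Foo k; have [mG Gk] := Goo k; split.
  rewrite -[X in measurable X]setTI; apply: measurable_rV_uncons => //.
  exact: measurableX.
rewrite /lebesgue_rVS /pushforward -comp_preimage.
rewrite (_ : _ \o _ = id) ?preimage_id; last exact/funext/rV_consK.
by rewrite product_measure1E// lte_mul_pinfty// ge0_fin_numE.
Qed.

HB.instance Definition _ := Measure_isSigmaFinite.Build _ _ _ lebesgue_rVS
  lebesgue_rVS_sigma_finite.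

End step.

Fixpoint lebesgue_rV n : {sigma_finite_measure set 'rV[R]_n -> \bar R} :=
  if n is n'.+1 then lebesgue_rVS (lebesgue_rV n') else \d_(0 : 'rV[R]_0).

End lebesgue_rV.

Definition lebesgue_xy (R : realType) n :
    {measure set (measurableTypeR R * 'rV[R]_n)%type -> \bar R} :=
  (@lebesgue_measure R \x lebesgue_rV R n)%E.

(** * Smooth functions and test functions *)

Section smooth.
Context (R : realType) (V : normedModType R).

Definition iter_derive (W : normedModType R) (vs : seq V) (f : V -> W) : V -> W :=
  foldr (fun v g => 'D_v g) f vs.

(** For [U] open this is C^infty on [U]. *)
Definition smooth_on (W : normedModType R) (U : set V) (f : V -> W) : Prop :=
  forall (vs : seq V) (x : V), U x ->
    {for x, continuous (iter_derive vs f)} /\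
    forall v, derivable (iter_derive vs f) x v.

Definition test_function (U : set V) (phi : V -> R) : Prop :=
  let supp := closure [set x | phi x != 0] in
  [/\ smooth_on setT phi, compact supp & supp `<=` U].

End smooth.

(** C^1([0,1]); [a'] is one-sided at the endpoints. *)
Definition C1_01 (R : realType) (a : R -> R) : Prop :=
  exists2 a' : R -> R, {within `[0, 1], continuous a'} &
    forall x, 0 <= x <= 1 ->
      (a y - a x) / (y - x) @[y --> within `[0, 1] x^'] --> a' x.

(** * Euclidean structure (the library norm of a matrix is the max norm) *)

Section euclidean.
Context (R : realType).

Definition enorm p q (M : 'M[R]_(p, q)) : R :=
  Num.sqrt (\sum_i \sum_j M i j ^+ 2).

Definition edot p (xi eta : 'cV[R]_p) : R := (xi^T *m eta) ord0 ord0.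

Definition opnorm p (M : 'M[R]_p) : R :=
  sup [set enorm (M *m xi) | xi in [set xi : 'cV[R]_p | enorm xi <= 1]].

Definition eball n (r : R) : set 'rV[R]_n := [set y | enorm y < r].

Definition vol_ball n : R := fine (lebesgue_rV R n (@eball n 1)).

End euclidean.

(** * Function spaces

   Functions are total; only their values on the domain [D] matter.  Weak
   derivatives being unique only almost everywhere, [H^1] is rendered as a
   relation between a function and a representative of its weak gradient. *)

Section spaces_xy.
Context (R : realType) (n : nat).
Local Notation mu := (@lebesgue_xy R n).
Local Notation Rxy := (R * 'rV[R]_n)%type.
Implicit Types (D : set Rxy) (u v f : Rxy -> R).

Definition L2 D u : Prop := u \_ D \in Lfun mu 2%:E.

Definition L2norm D u : \bar R := 'N[mu]_2%:E[EFin \o (u \_ D)].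

Definition dir (i : 'I_(1 + n)) : Rxy :=
  match fintype.split i with inl _ => (1, 0) | inr j => (0, delta_mx ord0 j) end.

Definition weak_derivative D (e : Rxy) u v : Prop :=
  forall phi : Rxy -> R, test_function D phi ->
    \int[mu]_(z in D) (u z * 'D_e phi z) = - \int[mu]_(z in D) (v z * phi z).

(** [u] is in H^1(D), with weak gradient [gu] *)
Definition H1 D u (gu : Rxy -> 'cV[R]_(1 + n)) : Prop :=
  L2 D u /\ forall i, L2 D (fun z => gu z i ord0) /\
                      weak_derivative D (dir i) u (fun z => gu z i ord0).

Definition H1norm D u (gu : Rxy -> 'cV[R]_(1 + n)) : \bar R :=
  ((\int[mu]_(z in D) (u z ^+ 2 + enorm (gu z) ^+ 2)%:E) `^ 2^-1)%E.

Definition Linfty_norm D u : \bar R := 'N[mu]_+oo[EFin \o (u \_ D)].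

End spaces_xy.

Section weighted_spaces.
Context (R : realType) (n : nat) (a : R -> R).
Local Notation mu := (@lebesgue_measure R).
Local Notation I01 := (`]0%R, 1%R[%classic : set R).

Definition L2a (u : R -> R) : Prop :=
  measurable_fun I01 u /\
  (\int[mu]_(x in I01) (a x ^+ n * u x ^+ 2)%:E < +oo)%E.

Definition weak_derivative01 (u v : R -> R) : Prop :=
  forall phi : R -> R, test_function I01 phi ->
    \int[mu]_(x in I01) (u x * 'D_1 phi x) =
    - \int[mu]_(x in I01) (v x * phi x).

(** [u] is in H^1_a(0,1), with weak derivative [du] *)
Definition H1a (u du : R -> R) : Prop :=
  [/\ L2a u, L2a du & weak_derivative01 u du].

End weighted_spaces.

(** * The thin domain and its coefficients *)

Section problem.
Context (R : realType) (n : nat) (a : R -> R).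
Local Notation Rxy := (R * 'rV[R]_n)%type.

(** For [a x > 0], [e * a x * B_1] is the open ball of radius [e * a x]. *)
Definition thin (e : R) : set Rxy :=
  [set z | 0 < z.1 < 1 /\ eball (e * a z.1) z.2].

Local Notation Omega := (thin 1).
Local Notation I01 := (`]0%R, 1%R[%classic : set R).

Definition E_ext (u : R -> R) : Rxy -> R := fun z => u z.1.

Definition M_avg (e : R) (u : Rxy -> R) : R -> R := fun x =>
  (e ^+ n * a x ^+ n * vol_ball R n)^-1 *
  \int[lebesgue_rV R n]_(y in eball (e * a x)) u (x, y).

Variables (A1 : nat -> R -> R) (A2 : nat -> Rxy -> 'cV[R]_n)
  (A3 : nat -> Rxy -> 'M[R]_n).

Definition A_coef (k : nat) (z : Rxy) : 'M[R]_(1 + n) :=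
  block_mx (A1 k z.1)%:M (A2 k z)^T (A2 k z) (A3 k z).

(** The bounds on [A_coef k] make the series converge for almost every [z]. *)
Definition A_eps (e : R) (z : Rxy) : 'M[R]_(1 + n) :=
  limn (series (fun k => e ^+ k *: A_coef k z)).

(** The L^infty bound uses the operator norm, as the coercivity estimate with
   [alpha0 - e0 * C0 / (1 - e0)] requires; conditions that involve [A_coef k],
   [k >= 1], only hold almost everywhere. *)
Record admissible (e0 alpha0 C0 : R) : Prop := Admissible {
  adm_A01_smooth : smooth_on I01 (A1 0);
  adm_A01_gt0 : forall x : R, 0 < x < 1 -> 0 < A1 0 x;
  adm_A0_diag : forall z, Omega z -> A2 0 z = 0;
  adm_A0_smooth : smooth_on Omega (A_coef 0);
  adm_A0_sym : forall z, Omega z -> (A_coef 0 z)^T = A_coef 0 z;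
  adm_alpha0_gt0 : 0 < alpha0;
  adm_A0_coercive : forall z, Omega z -> forall xi : 'cV_(1 + n),
    alpha0 * enorm xi ^+ 2 <= edot (A_coef 0 z *m xi) xi;
  adm_meas : forall k i j, measurable_fun Omega (fun z => A_coef k z i j);
  adm_bound : forall k,
    (Linfty_norm Omega (fun z => opnorm (A_coef k z)) <= C0%:E)%E;
  adm_small : 0 < alpha0 - e0 * C0 / (1 - e0);
  adm_Aeps_sym : forall e, 0 < e <= e0 ->
    {ae @lebesgue_xy R n,
      forall z, Omega z -> (A_eps e z)^T = A_eps e z};
  adm_Aeps_posdef : forall e, 0 < e <= e0 -> exists2 c : R, 0 < c &
    {ae @lebesgue_xy R n, forall z, Omega z -> forall xi : 'cV_(1 + n),
      c * enorm xi ^+ 2 <= edot (A_eps e z *m xi) xi} }.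

Definition solves_thin (e : R) (f u : Rxy -> R) (gu : Rxy -> 'cV[R]_(1 + n)) :
    Prop :=
  H1 (thin e) u gu /\
  forall phi gphi, H1 (thin e) phi gphi ->
    \int[@lebesgue_xy R n]_(z in thin e)
      (edot (A_eps e (z.1, e^-1 *: z.2) *m gu z) (gphi z) + u z * phi z) =
    \int[@lebesgue_xy R n]_(z in thin e) (f z * phi z).

Definition A_tilde (x : R) : R := vol_ball R n * a x ^+ n * A1 0 x.

Definition solves_limit (e : R) (f : Rxy -> R) (u0 du0 : R -> R) : Prop :=
  H1a n a u0 du0 /\
  forall phi dphi, H1a n a phi dphi ->
    \int[@lebesgue_measure R]_(x in I01)
      (A_tilde x * du0 x * dphi x + vol_ball R n * a x ^+ n * u0 x * phi x) =
    vol_ball R n *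
    \int[@lebesgue_measure R]_(x in I01) (a x ^+ n * M_avg e f x * phi x).

End problem.

(* Main.v *)
(** Put [w := u - E u0]. Testing the thin equation with [w] and the limit equation
    with the average [M w] gives an energy identity whose right-hand side is small:
    [w - E (M w)] is O(e) by the Poincare inequality on the slices, [A_eps - A_0]
    is O(e), and [(M w)'] is the average of [D_x w + (a'/a) y . D_y w], where
    [|y| < e a]. Young's inequality closes the estimate.

    That [M w] is in H^1_a, although the slices vary with [x]: for a test
    function [th] on (0,1) put [b := 1/(e a)], [lam := a'/a], [q := |y|^2 b^2].
    The field with [x]-component [k(q) b^n th] and [y]-component
    [y lam k(q) b^n th] has divergence [k(q) b^n th']; one tests the weak gradient
    with it and lets the cutoff [k(q)] tend to a constant.

    Poincare: by convexity of the slices and the du Bois-Reymond lemma,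
    [w (x, y + v) - w (x, y)] is almost everywhere the integral of [v . D_y w]
    along the segment; its square is integrated over [|v| < 2 e a], against the
    inverse volume of the slice. *)

From HB Require Import structures.
Require Import Defs.
From mathcomp Require Import all_boot all_order all_algebra.
From mathcomp Require Import all_classical all_reals all_analysis.
From mathcomp Require Import measurable_realfun ess_sup_inf.
From mathcomp Require Import ring lra.
Import Order.TTheory GRing.Theory Num.Theory.
Import numFieldTopology.Exports numFieldNormedType.Exports.
Set Implicit Arguments.
Unset Strict Implicit.
Unset Printing Implicit Defensive.
Local Open Scope classical_set_scope.
Local Open Scope ring_scope.

(** * Change of variables *)

(** Since [a] vanishes at 0, the domain may have a cusp there, and extension operators or density of
    functions smooth up to the boundary cannot be taken for granted. Weak derivatives are therefore
    tested only with functions compactly supported inside the domain. Up to the factor e^n |B_1|,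
    M_eps is the adjoint of E_eps. Hence the limit equation tested with M w becomes an identity on
    the thin domain, which can be subtracted from the thin equation. The field (1, lam y) is tangent
    to the lateral boundary: q is constant along it, and b^n (1, lam y) is divergence free because
    D_x b^n = - n lam b^n. So neither k' nor lam survives in the divergence of the cutoff field, and
    the cutoff may become steep without harm. The factor a'/a is singular at 0, but |y| < e a turns
    (a'/a) y into a quantity bounded by e sup |a'|; together with A_eps - A_0 and the slice diameter
    this is the origin of the rate e. *)

Lemma scaled_pushforward_ex d (T : measurableType d) (R : realType)
    (mu : {measure set T -> \bar R}) (phi : T -> T) (c : R) :
  (0 <= c)%R -> measurable_fun setT phi ->
  exists m : {measure set T -> \bar R}, forall A, m A = (mu (phi @^-1` A) * c%:E)%E.
Proof.
move=> c0 mphi.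
pose m := measure_function_pushforward__canonical__measure_function_Measure mu mphi.
by exists (mscale (NngNum c0) m) => A; rewrite /mscale/= /pushforward muleC.
Qed.

Section preserving.
Local Open Scope ereal_scope.
Context d (T : measurableType d) (R : realType).
Variables (mu : {measure set T -> \bar R}) (phi : T -> T) (c : R).
Hypothesis c0 : (0 < c)%R.
Hypothesis mphi : measurable_fun setT phi.
Hypothesis phiE : forall A, measurable A -> mu (phi @^-1` A) * c%:E = mu A.

Lemma ge0_integral_comp_preserving (f : T -> \bar R) :
  measurable_fun setT f -> (forall x, 0 <= f x) ->
  (\int[mu]_x f (phi x)) * c%:E = \int[mu]_x f x.
Proof.
move=> mf f0.
have := @ge0_integral_pushforward _ _ _ _ _ _ mphi mu setT f measurableT mf (fun x _ => f0 x).
rewrite preimage_setT => <-.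
rewrite muleC -[c%:E]/((NngNum (ltW c0))%:num%:E) -ge0_integral_mscale//.
by apply: eq_measure_integral => A mA _; rewrite -phiE// /mscale/= /pushforward muleC.
Qed.

(** Positive and negative parts are transformed separately. Their integrals may be infinite, hence
    the four cases in which [c > 0] is distributed over the difference. *)
Lemma integral_comp_preserving (f : T -> \bar R) :
  measurable_fun setT f ->
  (\int[mu]_x f (phi x)) * c%:E = \int[mu]_x f x.
Proof.
move=> mf; rewrite integralE [RHS]integralE.
rewrite -(ge0_integral_comp_preserving (measurable_funepos mf))//.
rewrite -(ge0_integral_comp_preserving (measurable_funeneg mf))//.
have fpcomp : (fun x => f (phi x))^\+ = (fun x => f^\+ (phi x)) by exact: funepos_comp.
have fncomp : (fun x => f (phi x))^\- = (fun x => f^\- (phi x)) by exact: funeneg_comp.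
rewrite fpcomp fncomp.
have : 0 <= \int[mu]_x f^\+ (phi x) by apply: integral_ge0.
have : 0 <= \int[mu]_x f^\- (phi x) by apply: integral_ge0.
move: (integral _ _ _) (integral _ _ _) => [x| |] [y| |]//= _ _.
- by rewrite -EFinD -!EFinM -EFinD mulrBl.
- by rewrite addeNy gt0_mulNye ?lte_fin// gt0_mulye ?lte_fin.
- by rewrite addye// gt0_mulye ?lte_fin.
- by rewrite gt0_mulNye ?lte_fin// gt0_mulye ?lte_fin.
Qed.

End preserving.

Section lebesgue_affine.
Context (R : realType).
Implicit Types (r s : R).

(** The left side is a measure in [A], so uniqueness of Lebesgue measure reduces the claim to
    half-open intervals. *)
Lemma lebesgue_measure_affine r s (A : set (measurableTypeR R)) : 0 < r -> measurable A ->
  (lebesgue_measure ((fun x : measurableTypeR R => (r * x + s)%R : measurableTypeR R) @^-1` A) * r%:E)%E =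
  lebesgue_measure A.
Proof.
move=> r0 mA.
have mf : measurable_fun setT (fun x : measurableTypeR R => r * x + s : measurableTypeR R).
  by apply: measurable_funD => //; apply: measurable_funM.
have [m mE] := scaled_pushforward_ex (@lebesgue_measure R) (ltW r0) mf.
rewrite -mE; apply/esym/lebesgue_measure_unique => // _ [[a b]] _ <-/=.
rewrite mE.
rewrite (_ : _ @^-1` _ = `](a - s)/r, (b - s)/r]%classic); last first.
  apply/seteqP; split => x; rewrite /= !in_itv/= ltr_pdivrMr// ler_pdivlMr//; lra.
rewrite [`](_ / r)%R, _]%classic]lock !lebesgue_measure_itv/= -lock lebesgue_measure_itv/= !lte_fin ltr_pM2r ?invr_gt0// ltrD2r.
have [ab|ab] := ltrP a b; last by rewrite mul0e.
rewrite -!EFinB -EFinM; congr EFin; field.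
by rewrite gt_eqF.
Qed.

Lemma measurable_rV_affine n r (v : 'rV[R]_n) :
  measurable_fun setT (fun y : 'rV[R]_n => r *: y + v).
Proof.
apply: measurable_fun_rV => i; under eq_fun do rewrite !mxE.
apply: measurable_funD => //; apply: measurable_funM => //.
exact: measurable_coord_rV.
Qed.

(** Induction on the dimension: the first coordinate contributes one factor [r], the sections in the
    remaining coordinates contribute the others. *)
Lemma lebesgue_rV_affine n r (v : 'rV[R]_n) (A : set 'rV[R]_n) : 0 < r -> measurable A ->
  (lebesgue_rV R n ((fun y => (r *: y + v)%R) @^-1` A) * (r ^+ n)%:E)%E =
  lebesgue_rV R n A.
Proof.
move=> r0; elim: n => [|n IH] in v A *.
  move=> mA; rewrite expr0 mule1; congr (lebesgue_rV R 0 _).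
  rewrite (_ : (fun _ => _) = id) ?preimage_id//.
  by apply/funext => y; apply/rowP => -[].
move=> mA /=; rewrite /lebesgue_rVS /pushforward /=.
set B := @rV_cons R n @^-1` A.
have mB : measurable B by rewrite -[X in measurable X]setTI; exact: measurable_rV_cons.
rewrite (_ : _ @^-1` (_ @^-1` A) = [set p | B (r * p.1 + v ord0 ord0, r *: p.2 + (\row_j v ord0 (lift ord0 j)))]); last first.
  apply/funext => -[x y]; rewrite /B /preimage/=; congr A.
  by apply/rowP => j; rewrite /rV_cons !mxE/=; case: unliftP => [k ->|->]; rewrite ?mxE.
rewrite /product_measure1.
set v' := \row_j _; set s := v ord0 ord0.
rewrite -[RHS](@integral_comp_preserving _ _ _ _ (fun x : measurableTypeR R => r * x + s : measurableTypeR R) r) //; last first.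
- exact: (measurable_fun_xsection _ mB).
- by move=> C mC; rewrite lebesgue_measure_affine.
- by apply: measurable_funD => //; apply: measurable_funM.
rewrite exprS EFinM muleCA muleC; congr (_ * _)%E.
rewrite -ge0_integralZr//; last 2 first.
- apply: measurable_fun_xsection.
  have mT : measurable_fun setT (fun p : measurableTypeR R * 'rV[R]_n =>
      ((r * p.1 + s)%R : measurableTypeR R, r *: p.2 + v')).
    apply: measurable_fun_pair.
      by apply: measurable_funD => //; apply: measurable_funM.
    exact: (measurableT_comp (measurable_rV_affine r v') measurable_snd).
  by rewrite -[X in measurable X]setTI; exact: mT.
- by rewrite lee_fin exprn_ge0 // ltW.
apply: eq_integral => x _ /=.
rewrite -(IH v' (xsection B (r * x + s))).
  by congr (_ * _)%E.
exact: measurable_xsection.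
Qed.

End lebesgue_affine.

(** * Euclidean balls *)

Section topology_measure.
Context (R : realType).

(** The sigma-algebra is generated by coordinates, so openness has to be linked to it: an open set
    is the union of the countably many rational boxes that it contains. *)
Lemma open_measurable_xy n (U : set (R * 'rV[R]_n)) : open U ->
  measurable (U : set (measurableTypeR R * 'rV[R]_n)).
Proof.
move=> oU.
pose I := (rat * 'rV[rat]_n * nat)%type.
pose B (i : I) : set (measurableTypeR R * 'rV[R]_n) :=
  [set z : measurableTypeR R * 'rV[R]_n | `|z.1 - ratr i.1.1| < i.2.+1%:R^-1] `&`
  \big[setI/setT]_(j < n) [set z : measurableTypeR R * 'rV[R]_n | `|z.2 ord0 j - ratr (i.1.2 ord0 j)| < i.2.+1%:R^-1].
have mB i : measurable (B i).
  apply: measurableI.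
    rewrite -[X in measurable X]setTI; apply: measurable_fun_ltr => //.
    by apply: measurableT_comp => //; apply: measurable_funB.
  apply: bigsetI_measurable => j _.
  rewrite -[X in measurable X]setTI; apply: measurable_fun_ltr => //.
  apply: measurableT_comp => //; apply: measurable_funB => //.
  exact: (measurableT_comp (measurable_coord_rV j) measurable_snd).
pose F (k : nat) : set (measurableTypeR R * 'rV[R]_n) :=
  if unpickle k is Some i then (if `[< B i `<=` U >] then B i else set0) else set0.
rewrite (_ : U = \bigcup_k F k); last first.
  apply/seteqP; split => [z Uz|z [k _]]; last first.
    rewrite /F; case: unpickle => // i; case: asboolP => // BU; exact: BU.
  have /nbhs_ballP[e /= e0 eU] : nbhs z U by exact: open_nbhs_nbhs.
  have [k ke] : exists k : nat, k.+1%:R^-1 < e / 2 :> R.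
    exists (Num.truncn (e / 2)^-1); rewrite invf_plt ?posrE// ?divr_gt0//.
    by rewrite truncnS_gt.
  have k0 : 0 < k.+1%:R^-1 :> R by rewrite invr_gt0.
  have hq (x : R) : exists q : rat, `|x - ratr q| < k.+1%:R^-1.
    have xk : x - k.+1%:R^-1 < x + k.+1%:R^-1 by rewrite ltrD2l gtrN.
    have [q] := rat_in_itvoo xk.
    by rewrite in_itv/= => /andP[q1 q2]; exists q; rewrite distrC ltr_distl q1 q2.
  have [q1 hq1] := hq z.1.
  have [q2 hq2] := choice (fun j => hq (z.2 ord0 j)).
  pose i : I := (q1, \row_j q2 j, k).
  have BU : B i `<=` U.
    move=> w [/= w1 w2]; apply: eU; split => /=.
      by rewrite /ball/= (le_lt_trans (ler_distD (ratr q1) _ _))// [ltRHS]splitr ltrD// distrC ?(lt_trans w1)// (lt_trans _ ke)// distrC.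
    rewrite /ball/=; split => // a b; rewrite (ord1 a) /ball/=.
    rewrite -bigcap_seq in w2; have := w2 b; rewrite /= mem_index_enum => /(_ isT); rewrite mxE => w2'.
    by rewrite (le_lt_trans (ler_distD (ratr (q2 b)) _ _))// [ltRHS]splitr ltrD// distrC ?(lt_trans w2')// (lt_trans _ ke)// distrC.
  have FE : F (pickle i) = B i by rewrite /F (pickleK i) asboolT.
  exists (pickle i); [exact: Logic.I|rewrite FE]; split; first exact: hq1.
  by rewrite -bigcap_seq => j _ /=; rewrite mxE.
apply: bigcup_measurable => k _; rewrite /F; case: unpickle => // i.
by case: asboolP.
Qed.

(** An open set of rows is a section of an open cylinder in the product. *)
Lemma open_measurable_rV n (U : set 'rV[R]_n) : open U -> measurable U.
Proof.
move=> oU; have oU' : open ((@snd R 'rV[R]_n) @^-1` U).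
  by apply: open_comp => // z _; exact: cvg_snd.
have := measurable_xsection (0 : measurableTypeR R) (open_measurable_xy oU').
by congr measurable; apply/seteqP; split => y; rewrite /xsection/= inE.
Qed.

Lemma open_continuous_measurable_xy n (U : set (R * 'rV[R]_n)) (f : R * 'rV[R]_n -> R) :
  open U -> {in U, continuous f} ->
  measurable_fun (U : set (measurableTypeR R * 'rV[R]_n)) (f : _ -> measurableTypeR R).
Proof.
move=> oU cf.
apply: (measurability _ (RGenOpens.measurableE R)) => _ [_ [a [b ->]] <-].
apply: open_measurable_xy; rewrite openE => z [Uz fz].
have nf : nbhs z (f @^-1` `]a, b[%classic).
  apply: (cf z); first by rewrite inE.
  by apply: open_nbhs_nbhs; split => //; exact: interval_open.
apply: filterI => //; exact: open_nbhs_nbhs.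
Qed.

Lemma continuous_measurable_xy n (f : R * 'rV[R]_n -> R) : continuous f ->
  measurable_fun (setT : set (measurableTypeR R * 'rV[R]_n)) (f : _ -> measurableTypeR R).
Proof. by move=> cf; apply: open_continuous_measurable_xy => //; exact: openT. Qed.

(** Cubes have a measure that can be computed directly; Euclidean balls are compared with them from
    inside and from outside. *)
Definition cube_rV n (r : R) : set 'rV[R]_n := [set y | forall j, `|y ord0 j| < r].

Lemma measurable_cube_rV n (r : R) : measurable (@cube_rV n r).
Proof.
rewrite (_ : @cube_rV n r = \big[setI/setT]_(j < n) [set y : 'rV[R]_n | `|y ord0 j| < r]).
  apply: bigsetI_measurable => j _; rewrite -[X in measurable X]setTI.
  apply: measurable_fun_ltr => //; apply: measurableT_comp => //.
  exact: measurable_coord_rV.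
apply/seteqP; split => y /=; rewrite -bigcap_seq/=; first by move=> h j _ /=; exact: h.
by move=> h j; apply: h; rewrite /= mem_index_enum.
Qed.

Lemma lebesgue_rV_cube n (r : R) : 0 < r ->
  lebesgue_rV R n (@cube_rV n r) = ((2 * r) ^+ n)%:E.
Proof.
move=> r0; elim: n => [|n IH].
  rewrite expr0/= diracE mem_set// => -[]//.
have mC m := @measurable_cube_rV m r.
rewrite /= /lebesgue_rVS /pushforward/=.
rewrite (_ : _ @^-1` _ = `]-r, r[%classic `*` @cube_rV n r).
  rewrite product_measure1E//; last exact: mC.
  rewrite IH.
  have h : lebesgue_measure (`](- r)%R, r[%classic : set (measurableTypeR R)) = (2 * r)%:E.
    by rewrite lebesgue_measure_itv/= lte_fin gtrN// -EFinD opprK -mulr2n mulr_natl.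
  rewrite [X in (X * _)%E]h.
  by rewrite exprS EFinM.
apply/seteqP; split => -[x y]; rewrite /= /rV_cons in_itv/= -ltr_norml.
  move=> h; split; first by have := h ord0; rewrite mxE unlift_none.
  by move=> j; have := h (lift ord0 j); rewrite mxE liftK.
by move=> [hx hy] j; rewrite mxE; case: unliftP.
Qed.

End topology_measure.

Section enorm.
Context (R : realType).
Implicit Types p q n : nat.

(** The common source of the Cauchy-Schwarz inequalities for sums and for integrals; the degenerate
    case [a = 0] has to be included. *)
Lemma discriminant_le (a b c : R) : 0 <= a -> 0 <= c ->
  (forall t, 0 <= a * t ^+ 2 + 2 * b * t + c) -> b ^+ 2 <= a * c.
Proof.
move=> a0 c0 h; have [a_eq0|an0] := eqVneq a 0.
  rewrite a_eq0 mul0r; have [->|b0] := eqVneq b 0; first by rewrite expr0n.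
  (* For [a = 0] and nonzero [b], this argument gives the polynomial the value -1. *)
  have := h (- (c + 1) / (2 * b)); rewrite a_eq0 mul0r add0r.
  have -> : 2 * b * (- (c + 1) / (2 * b)) = - (c + 1) by field.
  lra.
have a_gt0 : 0 < a by rewrite lt_def an0.
have := h (- b / a).
have -> : a * (- b / a) ^+ 2 + 2 * b * (- b / a) + c = (a * c - b ^+ 2) / a by field.
by rewrite pmulr_lge0 ?invr_gt0// subr_ge0.
Qed.

Lemma sum_CauchySchwarz (I : finType) (x y : I -> R) :
  (\sum_i x i * y i) ^+ 2 <= (\sum_i x i ^+ 2) * (\sum_i y i ^+ 2).
Proof.
apply: discriminant_le; [by apply: sumr_ge0 => i _; exact: sqr_ge0..|].
move=> t.
rewrite (_ : _ + _ = \sum_i (x i * t + y i) ^+ 2); first by apply: sumr_ge0 => i _; exact: sqr_ge0.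
rewrite !mulr_suml mulr_sumr mulr_suml -!big_split/=; apply: eq_bigr => i _.
ring.
Qed.

Lemma enorm_ge0 p q (M : 'M[R]_(p, q)) : 0 <= enorm M.
Proof. exact: sqrtr_ge0. Qed.

Lemma enorm_sqr p q (M : 'M[R]_(p, q)) : enorm M ^+ 2 = \sum_i \sum_j M i j ^+ 2.
Proof.
by rewrite sqr_sqrtr//; apply: sumr_ge0 => i _; apply: sumr_ge0 => j _; exact: sqr_ge0.
Qed.

Lemma enorm_sqr_row n (y : 'rV[R]_n) : enorm y ^+ 2 = \sum_j y ord0 j ^+ 2.
Proof. by rewrite enorm_sqr big_ord1. Qed.

Lemma enorm_sqr_col n (y : 'cV[R]_n) : enorm y ^+ 2 = \sum_j y j ord0 ^+ 2.
Proof. by rewrite enorm_sqr; apply: eq_bigr => j _; rewrite big_ord1. Qed.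

Lemma edotE n (x y : 'cV[R]_n) : edot x y = \sum_i x i ord0 * y i ord0.
Proof. by rewrite /edot mxE; apply: eq_bigr => i _; rewrite mxE. Qed.

Lemma edotxx n (x : 'cV[R]_n) : edot x x = enorm x ^+ 2.
Proof. by rewrite edotE enorm_sqr_col; apply: eq_bigr => i _; rewrite expr2. Qed.

Lemma edotDl n (x y z : 'cV[R]_n) : edot (x + y) z = edot x z + edot y z.
Proof. by rewrite !edotE -big_split/=; apply: eq_bigr => i _; rewrite mxE mulrDl. Qed.

Lemma edotZl n r (x z : 'cV[R]_n) : edot (r *: x) z = r * edot x z.
Proof. by rewrite !edotE mulr_sumr; apply: eq_bigr => i _; rewrite !mxE mulrA. Qed.

Lemma edot_CauchySchwarz n (x y : 'cV[R]_n) : `|edot x y| <= enorm x * enorm y.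
Proof.
rewrite -ler_sqr ?nnegrE ?mulr_ge0 ?enorm_ge0// real_normK ?num_real// exprMn.
by rewrite edotE !enorm_sqr_col sum_CauchySchwarz.
Qed.

Lemma ler_enorm p q (M : 'M[R]_(p, q)) i j : `|M i j| <= enorm M.
Proof.
rewrite -[leRHS]ger0_norm ?enorm_ge0// -ler_sqr ?nnegrE// !real_normK ?num_real// enorm_sqr.
rewrite (bigD1 i)//= (bigD1 j)//= -addrA lerDl addr_ge0// ?sumr_ge0// => *; rewrite ?sqr_ge0//.
by rewrite sumr_ge0// => *; rewrite sqr_ge0.
Qed.

Lemma enormZ p q r (M : 'M[R]_(p, q)) : enorm (r *: M) = `|r| * enorm M.
Proof.
rewrite /enorm -sqrtr_sqr -sqrtrM ?sqr_ge0// mulr_sumr; congr Num.sqrt.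
by apply: eq_bigr => i _; rewrite mulr_sumr; apply: eq_bigr => j _; rewrite mxE exprMn.
Qed.

Lemma enorm0 p q : enorm (0 : 'M[R]_(p, q)) = 0.
Proof. by rewrite -(scale0r (0 : 'M[R]_(p,q))) enormZ normr0 mul0r. Qed.

Lemma ler_enormD p q (M N : 'M[R]_(p, q)) : enorm (M + N) <= enorm M + enorm N.
Proof.
rewrite -ler_sqr ?nnegrE ?addr_ge0 ?enorm_ge0// sqrrD !enorm_sqr.
have -> : \sum_i \sum_j (M + N)%R i j ^+ 2 =
  \sum_i \sum_j M i j ^+ 2 + (\sum_i \sum_j M i j * N i j) *+ 2 + \sum_i \sum_j N i j ^+ 2.
  rewrite -sumrMnl -!big_split/=; apply: eq_bigr => i _.
  rewrite -sumrMnl -!big_split/=; apply: eq_bigr => j _.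
  by rewrite mxE sqrrD.
rewrite lerD2r lerD2l lerMn2r/=.
apply: le_trans (ler_norm _) _.
rewrite -ler_sqr ?nnegrE ?mulr_ge0 ?enorm_ge0// real_normK ?num_real// exprMn !enorm_sqr.
rewrite !pair_big/=; exact: sum_CauchySchwarz.
Qed.

Lemma enorm_convex p q (M N : 'M[R]_(p, q)) (t r : R) : 0 <= t <= 1 ->
  enorm M < r -> enorm (M + N) < r -> enorm (M + t *: N) < r.
Proof.
move=> /andP[t0 t1] Mr MNr.
have -> : M + t *: N = (1 - t) *: M + t *: (M + N).
  by rewrite scalerBl scale1r scalerDr addrA subrK.
apply: le_lt_trans (ler_enormD _ _) _; rewrite !enormZ !ger0_norm ?subr_ge0//.
(* Strictness comes from the endpoint [M] if t = 0 and from the endpoint [M + N] otherwise. *)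
have [->|tn0] := eqVneq t 0; first by rewrite subr0 mul1r mul0r addr0.
have t_gt0 : 0 < t by rewrite lt_def tn0.
have -> : r = (1 - t) * r + t * r by ring.
by apply: ler_ltD; rewrite ?ltr_pM2l// ler_wpM2l ?subr_ge0// ltW.
Qed.

Lemma enorm_continuous p q : continuous (@enorm R p q).
Proof.
move=> M; apply: (@continuous_comp _ _ _ (fun M : 'M[R]_(p,q) => \sum_i \sum_j M i j ^+ 2) Num.sqrt); last exact: sqrt_continuous.
have ad : continuous (fun x : R * R => x.1 + x.2) by move=> x; exact: add_continuous.
move: M; apply: (continuous_big ad) => i _; apply: (continuous_big ad) => j _ M.
under eq_fun do rewrite expr2.
by apply: (@cvgM _ _ (nbhs M)); exact: coord_continuous.
Qed.

Lemma eball_open n (r : R) : open (@eball R n r).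
Proof.
rewrite /eball (_ : mkset _ = @enorm R 1 n @^-1` [set x | x < r])//.
by apply: open_comp => [x _|]; [exact: enorm_continuous|exact: open_lt].
Qed.

Lemma measurable_eball n (r : R) : measurable (@eball R n r).
Proof. by apply: open_measurable_rV; exact: eball_open. Qed.

Lemma eball_scale n (r s : R) : 0 < r ->
  (fun y : 'rV[R]_n => r *: y + 0) @^-1` eball (r * s) = eball s.
Proof.
move=> r0; apply/seteqP; split => y; rewrite /eball/= addr0 enormZ gtr0_norm// ltr_pM2l//.
Qed.

Lemma lebesgue_eball_gt0 n (r : R) : 0 < r -> (0 < lebesgue_rV R n (@eball R n r))%E.
Proof.
(* A cube of half side r/(n+1) fits strictly into the ball, since n < (n+1)^2 also for n = 0. *)
move=> r0; have c0 : 0 < r / n.+1%:R by rewrite divr_gt0.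
apply: (@lt_le_trans _ _ (lebesgue_rV R n (cube_rV (r / n.+1%:R)))).
  by rewrite lebesgue_rV_cube// lte_fin exprn_gt0// mulr_gt0.
apply: le_measure; rewrite ?inE.
- exact: measurable_cube_rV.
- exact: measurable_eball.
- move=> y /= h; rewrite /eball/= -ltr_sqr ?nnegrE ?enorm_ge0 ?ltW// enorm_sqr_row.
  apply: (@le_lt_trans _ _ (\sum_(j < n) (r / n.+1%:R) ^+ 2)).
    apply: ler_sum => j _; rewrite -real_normK ?num_real// ler_sqr ?nnegrE//; apply: ltW => //; exact: h.
  rewrite sumr_const card_ord -[X in X < _]mulr_natl exprMn mulrCA gtr_pMr ?exprn_gt0// exprVn.
  rewrite ltr_pdivrMr ?exprn_gt0// mul1r expr2 -natrM ltr_nat mulSn; exact: leq_trans (ltnSn n) (leq_addr _ _).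
Qed.

Lemma lebesgue_eball_fin n (r : R) : (lebesgue_rV R n (@eball R n r) < +oo)%E.
Proof.
have [r0|r0] := ltrP 0 r; last first.
  rewrite (_ : eball r = set0) ?measure0// -subset0 => y; rewrite /eball/= ltNge.
  by rewrite (le_trans r0) ?enorm_ge0.
apply: (@le_lt_trans _ _ (lebesgue_rV R n (cube_rV r))).
  apply: le_measure; rewrite ?inE.
  - exact: measurable_eball.
  - exact: measurable_cube_rV.
  - by move=> y /= h j; apply: le_lt_trans (ler_enorm _ _ _) h.
by rewrite lebesgue_rV_cube// ltry.
Qed.

Lemma vol_ballE n : (vol_ball R n)%:E = lebesgue_rV R n (@eball R n 1).
Proof.
rewrite /vol_ball fineK// ge0_fin_numE; first exact: lebesgue_eball_fin.
exact: measure_ge0.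
Qed.

Lemma vol_ball_gt0 n : 0 < vol_ball R n.
Proof. by rewrite -lte_fin vol_ballE lebesgue_eball_gt0. Qed.

Lemma lebesgue_eball n (r : R) : 0 < r ->
  lebesgue_rV R n (@eball R n r) = (r ^+ n * vol_ball R n)%:E.
Proof.
move=> r0; rewrite -(lebesgue_rV_affine 0 r0)//; last exact: measurable_eball.
by rewrite -[X in eball X](mulr1 r) eball_scale// EFinM vol_ballE muleC.
Qed.

End enorm.

(** * Smooth functions and bumps *)

Section smooth_facts.
Context (R : realType) (V : normedModType R).
Implicit Types (f g : V -> R) (v : V).

(* Coinduction principle for smoothness. *)
Definition smooth_class (C : set (V -> R)) := forall f, C f ->
  continuous f /\ forall v, (forall x, derivable f x v) /\ C ('D_v f).

Lemma smooth_class_smooth C f : smooth_class C -> C f -> smooth_on setT f.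
Proof.
move=> hC Cf vs x _.
have {}Cf : C (iter_derive vs f).
  elim: vs => //= v vs IH; exact: ((hC _ IH).2 v).2.
by have [cf df] := hC _ Cf; split => [|v]; [exact: cf|exact: (df v).1].
Qed.

Lemma smooth_derive f v : smooth_on setT f -> smooth_on setT ('D_v f).
Proof.
move=> sf vs x _; have := sf (rcons vs v) x I.
by rewrite /iter_derive foldr_rcons.
Qed.

Lemma smooth_continuous f : smooth_on setT f -> continuous f.
Proof. by move=> sf x; exact: (sf [::] x I).1. Qed.

Lemma smooth_derivable f x v : smooth_on setT f -> derivable f x v.
Proof. by move=> sf; exact: (sf [::] x I).2. Qed.

(** Directional derivatives are reduced to derivatives along lines, where the one-variable chain
    rule and mean value theorem apply. *)
Lemma derive_line f z v (h : R) : derivable f (z + h *: v) v ->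
  is_derive h 1 (fun t : R => f (z + t *: v)) ('D_v f (z + h *: v)).
Proof.
move=> df.
have E : (fun k : R => k^-1 *: (f (z + (k *: 1 + h) *: v) - f (z + h *: v))) =
         (fun k : R => k^-1 *: (f (k *: v + (z + h *: v)) - f (z + h *: v))).
  apply/funext => k; congr (_ *: (f _ - _)).
  by rewrite scalerDl addrCA /GRing.scale/= mulr1.
apply: DeriveDef.
  by rewrite /derivable/= E.
by rewrite /derive/= E.
Qed.

Lemma derive_line_ex f z v (h : R) :
  derivable (fun t : R => f (z + t *: v)) h 1 -> derivable f (z + h *: v) v.
Proof.
have E : (fun k : R => k^-1 *: (f (z + (k *: 1 + h) *: v) - f (z + h *: v))) =
         (fun k : R => k^-1 *: (f (k *: v + (z + h *: v)) - f (z + h *: v))).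
  apply/funext => k; congr (_ *: (f _ - _)).
  by rewrite scalerDl addrCA /GRing.scale/= mulr1.
by rewrite /derivable/= E.
Qed.

End smooth_facts.

Section derive_lambda.
Context (R : realType) (V : normedModType R).
Implicit Types (f g : V -> R) (x v : V).

Lemma is_derive_line f x v (a : R) :
  is_derive (0 : R) (1 : R) (fun t : R => f (x + t *: v)) a <-> is_derive x v f a.
Proof.
have x0 : x + 0 *: v = x by rewrite scale0r addr0.
split=> [[d e]|[d e]].
  have d' := derive_line_ex d; rewrite x0 in d'; apply: DeriveDef => //.
  have [_] := @derive_line _ _ f x v 0 ltac:(by rewrite x0).
  by rewrite e x0 => ->.
have h := @derive_line _ _ f x v 0 ltac:(by rewrite x0).
by rewrite x0 e in h.
Qed.

Lemma is_derive_add f g x v (a b : R) : is_derive x v f a -> is_derive x v g b ->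
  is_derive x v (fun z => f z + g z) (a + b).
Proof. exact: is_deriveD. Qed.

Lemma is_derive_mul f g x v (a b : R) : is_derive x v f a -> is_derive x v g b ->
  is_derive x v (fun z => f z * g z) (a * g x + f x * b).
Proof.
by move=> df dg; apply: is_derive_eq (is_deriveM df dg) _; rewrite /GRing.scale/=; ring.
Qed.

Lemma is_derive_comp1 (g : R -> R) f x v (a b : R) :
  is_derive (f x) 1 g b -> is_derive x v f a -> is_derive x v (fun z => g (f z)) (b * a).
Proof.
move=> dg /is_derive_line df; apply/is_derive_line.
apply: (@is_derive1_comp _ g (fun t : R => f (x + t *: v)) 0 b a) => //.
by rewrite scale0r addr0.
Qed.

Lemma is_derive_exp f k x v (a : R) : is_derive x v f a ->
  is_derive x v (fun z => f z ^+ k) (k%:R * f x ^+ k.-1 * a).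
Proof.
move=> df; elim: k => [|k IH].
  by under eq_fun do rewrite expr0; rewrite !mul0r; exact: is_derive_cst.
under eq_fun do rewrite exprS.
apply: is_derive_eq (is_derive_mul df IH) _.
by case: k {IH} => [|k]; rewrite /= ?exprS; ring.
Qed.

Lemma is_derive_inv f x v (a : R) : f x != 0 -> is_derive x v f a ->
  is_derive x v (fun z => (f z)^-1) (- (f x)^-1 ^+ 2 * a).
Proof.
move=> f0 [df <-]; apply: DeriveDef; first exact: derivableV.
by rewrite deriveV// exprVn.
Qed.

End derive_lambda.

Section exp_bump.
Context (R : realType).

(** The functions t^-k exp(-1/t), extended by 0 to t <= 0. The exponent [k] makes the family closed
    under differentiation up to linear combinations. *)
Definition flat (k : nat) (t : R) : R := if 0 < t then t^-1 ^+ k * expR (- t^-1) else 0.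

(** A single term s^k / k! of the exponential series is at most e^s. *)
Lemma exprn_expRN_le (k : nat) (s : R) : 0 <= s -> s ^+ k * expR (- s) <= k`!%:R.
Proof.
move=> s0; rewrite expRN ler_pdivrMr ?expR_gt0//.
case: k => [|k]; first by rewrite expr0 mul1r; have := expR_ge1Dx s; lra.
have := @expR_ge1Dxn R s k s0; rewrite -(@ler_pM2l _ (k.+1`!%:R)) ?ltr0n ?fact_gt0//.
apply: le_trans; rewrite mulrDr mulrCA mulfV ?mulr1 ?lerDr ?ler0n// pnatr_eq0.
Qed.

Lemma flat_ge0 k t : 0 <= flat k t.
Proof.
by rewrite /flat; case: ifPn => // t0; rewrite mulr_ge0 ?expR_ge0// exprn_ge0 ?invr_ge0 ?ltW.
Qed.

(** Apply the factorial bound to s = 1/t with exponent k + 2. A quadratic bound at 0 is what makes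
    [flat k] differentiable there with derivative 0. *)
Lemma flat_le k t : `|flat k t| <= k.+2`!%:R * `|t| ^+ 2.
Proof.
rewrite ger0_norm ?flat_ge0// /flat; case: ifPn => [t0|_]; last by rewrite mulr_ge0// exprn_ge0.
rewrite gtr0_norm//.
have := @exprn_expRN_le k.+2 t^-1 ltac:(by rewrite invr_ge0 ltW).
rewrite -addn2 exprD => h; rewrite -ler_pdivrMr ?exprn_gt0//.
apply: le_trans h; rewrite -exprVn; lra.
Qed.

Lemma is_derive_flat k (t : R) :
  is_derive t 1 (flat k) (flat k.+2 t - k%:R * flat k.+1 t).
Proof.
have [t0|t0|<-] := ltgtP 0 t.
- have n0 : t != 0 by rewrite gt_eqF.
  have near_t : \forall s \near t, 0 < s by apply: lt_nbhsr.
  apply: (@near_eq_is_derive _ _ _ (fun s : R => s^-1 ^+ k * expR (- s^-1) : R)).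
  + by near=> s; rewrite /flat ifT//; near: s.
  + have dV : is_derive t (1 : R) (fun s : R => s^-1) (- t^-1 ^+ 2 * 1).
      by apply: is_derive_inv => //; exact: is_derive_id.
    have dN : is_derive t (1 : R) (fun s : R => - s^-1) (t^-1 ^+ 2).
      by apply: is_derive_eq (is_deriveN dV) _; rewrite mulr1 opprK.
    have dE := @is_derive_comp1 _ _ expR (fun s : R => - s^-1) t 1 _ _ (is_derive_expR _) dN.
    apply: is_derive_eq (is_derive_mul (is_derive_exp k dV) dE) _.
    rewrite /flat t0 mulr1; move: (expR _) => E; move: (t^-1) => s.
    by case: k => [|k]; rewrite ?exprS; ring.
- have near_t : \forall s \near t, s < 0 by apply: lt_nbhsl.
  apply: (@near_eq_is_derive _ _ _ (cst (0 : R))).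
  + by near=> s; rewrite /flat ifF//; apply/negbTE; rewrite -leNgt ltW//; near: s.
  + by rewrite /flat ltNge ltW//= mulr0 subr0; exact: is_derive_cst.
- have -> : flat k.+2 0 - k%:R * flat k.+1 0 = 0 by rewrite /flat ltxx mulr0 subr0.
  have h : h^-1 *: (flat k (h *: 1 + 0) - flat k 0) @[h --> 0^'] --> (0 : R).
    apply/cvgr0Pnorm_le => e e0.
    near=> h; rewrite {2}/flat ltxx subr0 addr0 /GRing.scale/= mulr1 normrM.
    have h0 : h != 0 by near: h; exact: nbhs_dnbhs_neq.
    apply: le_trans (ler_wpM2l _ (flat_le _ _)) _ => //.
    rewrite normfV expr2 mulrCA (mulrA `|h|^-1) mulVf ?normr_eq0// mul1r.
    rewrite mulrC -ler_pdivlMr ?ltr0n ?fact_gt0//.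
    near: h; apply: dnbhs0_le; by rewrite divr_gt0// ltr0n fact_gt0.
  by apply: DeriveDef; [apply/cvg_ex; exists 0|apply/cvg_lim].
Unshelve. all: by end_near. Qed.

Lemma continuous_flat k : continuous (flat k).
Proof.
move=> t; apply: differentiable_continuous; apply/derivable1_diffP.
by have [] := is_derive_flat k t.
Qed.

End exp_bump.

Section bump.
Context (R : realType) (n : nat).
Local Notation V := (R * 'rV[R]_n)%type.

(** Each clause differentiates into the class again, so membership yields smoothness by coinduction,
    without computing iterated derivatives. *)
Inductive bump_class : (V -> R) -> Prop :=
| bump_cst c : bump_class (fun=> c)
| bump_fst : bump_class (fun z => z.1)
| bump_coord j : bump_class (fun z => z.2 ord0 j)
| bump_flat k f : bump_class f -> bump_class (fun z => flat k (f z))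
| bump_add f g : bump_class f -> bump_class g -> bump_class (fun z => f z + g z)
| bump_mul f g : bump_class f -> bump_class g -> bump_class (fun z => f z * g z).

Lemma bump_sum (s : seq 'I_n) (f : 'I_n -> V -> R) : (forall j, bump_class (f j)) ->
  bump_class (fun z => \sum_(j <- s) f j z).
Proof.
move=> hf; elim: s => [|j s IH].
  by under eq_fun do rewrite big_nil; exact: bump_cst.
by under eq_fun do rewrite big_cons; exact: bump_add.
Qed.

Lemma bump_class_derive f : bump_class f -> continuous f /\
  forall v, exists2 g, bump_class g & forall z, is_derive z v f (g z).
Proof.
elim=> {f} [c| |j|k f bf [cf df]|f g bf [cf df] bg [cg dg]|f g bf [cf df] bg [cg dg]].
- split=> [z|v]; first exact: cvg_cst.
  by exists (fun=> 0) => [|z]; [exact: bump_cst|exact: is_derive_cst].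
- split=> [z|v]; first exact: cvg_fst.
  exists (fun=> v.1) => [|z]; first exact: bump_cst.
  apply/is_derive_line.
  have : is_derive (0 : R) (1 : R) (fun t : R => z.1 + t * v.1) (0 + (1 * v.1 + 0 * 0)).
    exact: (is_derive_add (is_derive_cst z.1 _ _) (is_derive_mul (is_derive_id _ _) (is_derive_cst v.1 _ _))).
  by rewrite mul1r mul0r addr0 add0r.
- split=> [z|v].
    apply: (@continuous_comp _ _ _ snd (fun y : 'rV[R]_n => y ord0 j)); first exact: cvg_snd.
    exact: coord_continuous.
  exists (fun=> v.2 ord0 j) => [|z]; first exact: bump_cst.
  apply/is_derive_line.
  have : is_derive (0 : R) (1 : R) (fun t : R => z.2 ord0 j + t * v.2 ord0 j) (0 + (1 * v.2 ord0 j + 0 * 0)).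
    exact: (is_derive_add (is_derive_cst (z.2 ord0 j) _ _) (is_derive_mul (is_derive_id _ _) (is_derive_cst (v.2 ord0 j) _ _))).
  rewrite mul1r mul0r addr0 add0r; congr is_derive.
  by apply/funext => t; rewrite !mxE.
- split=> [z|v].
    by apply: (@continuous_comp _ _ _ f (flat k)); [exact: cf|exact: continuous_flat].
  have [g bg dg] := df v.
  exists (fun z => (flat k.+2 (f z) + - k%:R * flat k.+1 (f z)) * g z) => [|z].
    apply: bump_mul => //; apply: bump_add; first exact: bump_flat.
    by apply: bump_mul; [exact: bump_cst|exact: bump_flat].
  rewrite mulNr; exact: (is_derive_comp1 (is_derive_flat k (f z)) (dg z)).
- split=> [z|v]; first by apply: continuousD; [exact: cf|exact: cg].
  have [f' bf' df'] := df v; have [g' bg' dg'] := dg v.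
  exists (fun z => f' z + g' z) => [|z]; first exact: bump_add.
  exact: is_derive_add.
- split=> [z|v]; first by apply: continuousM; [exact: cf|exact: cg].
  have [f' bf' df'] := df v; have [g' bg' dg'] := dg v.
  exists (fun z => f' z * g z + f z * g' z) => [|z]; last exact: is_derive_mul.
  by apply: bump_add; exact: bump_mul.
Qed.

Lemma bump_class_smooth f : bump_class f -> smooth_on setT f.
Proof.
apply: smooth_class_smooth => {}f /bump_class_derive[cf df]; split => // v.
have [g bg dg] := df v; split => [x|]; first by have [] := dg x.
by rewrite (_ : 'D_v f = g)//; apply/funext => z; have [_] := dg z.
Qed.

Lemma xy_norm_le (z : V) r : 0 <= r -> `|z.1| <= r -> (forall j, `|z.2 ord0 j| <= r) -> `|z| <= r.
Proof.
move=> r0 h1 h2; rewrite prod_normE ge_max h1/= [leLHS]mx_normrE; apply/bigmax_leP; split => //.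
by move=> [i j] _; rewrite (ord1 i).
Qed.

Lemma xy_norm_lt (z : V) r : 0 < r -> `|z.1| < r -> (forall j, `|z.2 ord0 j| < r) -> `|z| < r.
Proof.
move=> r0 h1 h2; rewrite prod_normE gt_max h1/= [ltLHS]mx_normrE; apply/bigmax_ltP; split => //.
by move=> [i j] _; rewrite (ord1 i).
Qed.

Lemma xy_norm1 (z : V) : `|z.1| <= `|z|.
Proof. by rewrite prod_normE le_max lexx. Qed.

Lemma xy_norm2 (z : V) j : `|z.2 ord0 j| <= `|z|.
Proof.
rewrite prod_normE le_max; apply/orP; right; rewrite [leRHS]mx_normrE.
by apply: (le_bigmax _ (fun ij => `|z.2 ij.1 ij.2|) (ord0, j)).
Qed.

(** The bump is [flat 0] of r^2 minus the squared Euclidean norm; the Euclidean ball lies in the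
    ball of the max norm. *)
Lemma bump_ex (r : R) : 0 < r -> exists rho : V -> R,
  [/\ smooth_on setT rho, forall z, 0 <= rho z, 0 < rho 0 &
      forall z, rho z != 0 -> `|z| < r].
Proof.
move=> r0.
pose q (z : V) := r ^+ 2 + - 1 * (z.1 * z.1 + \sum_(j < n) z.2 ord0 j * z.2 ord0 j).
exists (fun z => flat 0 (q z)); split.
- apply: bump_class_smooth; apply: bump_flat; apply: bump_add; first exact: bump_cst.
  apply: bump_mul; first exact: bump_cst.
  apply: bump_add; first by apply: bump_mul; exact: bump_fst.
  by apply: bump_sum => j; apply: bump_mul; exact: bump_coord.
- by move=> z; exact: flat_ge0.
- have -> : q 0 = r ^+ 2.
    rewrite /q/= mulr0 add0r big1 ?mulr0 ?addr0// => j _; by rewrite mxE mulr0.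
  by rewrite /flat exprn_gt0// expr0 mul1r expR_gt0.
- move=> z; rewrite /flat; case: ifPn => [|_]; last by rewrite eqxx.
  rewrite /q mulN1r subr_gt0 => h _.
  have s0 (P : pred 'I_n) : 0 <= \sum_(j < n | P j) z.2 ord0 j * z.2 ord0 j.
    by apply: sumr_ge0 => j _; rewrite -expr2 sqr_ge0.
  apply: xy_norm_lt => //.
    rewrite -ltr_sqr ?nnegrE ?(ltW r0)// real_normK ?num_real// expr2.
    by apply: le_lt_trans h; rewrite lerDl.
  move=> j; rewrite -ltr_sqr ?nnegrE ?(ltW r0)// real_normK ?num_real// expr2.
  apply: le_lt_trans h; rewrite (bigD1 j)//= addrCA lerDl.
  by rewrite addr_ge0// -expr2 sqr_ge0.
Qed.

End bump.

(** * Mollification *)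

Section Rintegral_extra.
Context d (T : measurableType d) (R : realType) (mu : {measure set T -> \bar R}).

Lemma Rdominated_cvg (D : set T) (f_ : nat -> T -> R) (f g : T -> R) :
  measurable D -> (forall n, measurable_fun D (f_ n)) ->
  (forall x, D x -> f_ n x @[n --> \oo] --> f x) ->
  mu.-integrable D (EFin \o g) -> (forall n x, D x -> `|f_ n x| <= g x) ->
  mu.-integrable D (EFin \o f) /\
  \int[mu]_(x in D) f_ n x @[n --> \oo] --> \int[mu]_(x in D) f x.
Proof.
move=> mD mf_ f_f ig f_g.
have mf : measurable_fun D f by apply: (measurable_fun_cvg mf_ f_f).
have f_f' : {ae mu, forall x, D x -> ((fun n => EFin \o f_ n) ^~ x @ \oo --> (EFin \o f) x)%E}.
  by apply: aeW => x Dx /=; apply: cvg_EFin; [exact: nearW|exact: f_f].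
have mf' : measurable_fun D (EFin \o f) by exact/measurable_EFinP.
have f_g' : {ae mu, forall x n, D x -> (`|(EFin \o f_ n) x| <= (EFin \o g) x)%E}.
  by apply: aeW => x n Dx /=; rewrite lee_fin f_g.
have mf_' n : measurable_fun D (EFin \o f_ n) by exact/measurable_EFinP.
have [i1 _ i3] := dominated_convergence mD mf_' mf' f_f' ig f_g'.
split => //; apply: fine_cvg; rewrite fineK//; exact: integrable_fin_num.
Qed.

(** On the line through [z] with direction [v] this is differentiation under the integral sign in
    one real variable, over ]-1, 1[. *)
Lemma is_derive_integral (V : normedModType R) (D : set T) (F : V -> T -> R) (G : T -> R) z v :
  measurable D ->
  (forall h : R, `|h| < 1 -> mu.-integrable D (EFin \o F (z + h *: v))) ->
  (forall h t, `|h| < 1 -> D t -> derivable (F ^~ t) (z + h *: v) v) ->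
  mu.-integrable D (EFin \o G) -> (forall t, 0 <= G t) ->
  (forall h t, `|h| < 1 -> D t -> `|'D_v (F ^~ t) (z + h *: v)| <= G t) ->
  is_derive z v (fun z => \int[mu]_(t in D) F z t) (\int[mu]_(t in D) 'D_v (F ^~ t) z).
Proof.
move=> mD iF dF iG G0 hG; apply/is_derive_line.
pose f (h : R) t := F (z + h *: v) t.
have I0 : `](-1), 1[%classic (0 : R) by rewrite /= in_itv/= ltrN10 ltr01.
have hI (h : R) : `](-1), 1[%classic h -> `|h| < 1 by rewrite /= in_itv/= ltr_norml.
have dE (h : R) t : `|h| < 1 -> D t -> is_derive h (1 : R) (f ^~ t) ('D_v (F ^~ t) (z + h *: v)).
  by move=> h1 Dt; apply: derive_line; exact: dF.
have intf h : `](-1), 1[%classic h -> mu.-integrable D (EFin \o f h) by move=> /hI; exact: iF.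
have derf h t : `](-1), 1[%classic h -> D t -> derivable (f ^~ t) h 1.
  by move=> /hI h1 Dt; have [] := dE h t h1 Dt.
have ub h t : `](-1), 1[%classic h -> D t -> `|partial1of2 f h t| <= G t.
  by move=> /hI h1 Dt; rewrite partial1of2E; have [_ ->] := dE h t h1 Dt; exact: hG.
have d1 := derivable_under_integral mD I0 intf derf G0 iG ub.
have d2 := differentiation_under_integral mD I0 intf derf G0 iG ub.
apply: DeriveDef; first exact: d1.
rewrite -derive1E; apply: etrans d2 _.
apply: eq_Rintegral => t /set_mem Dt; rewrite partial1of2E.
have [_ ->] := dE 0 t ltac:(by rewrite normr0) Dt.
by rewrite scale0r addr0.
Qed.

End Rintegral_extra.

Section xy.
Context (R : realType) (n : nat).
Local Notation V := (R * 'rV[R]_n)%type.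
Local Notation mV := (measurableTypeR R * 'rV[R]_n)%type.
Local Notation mu := (@lebesgue_xy R n).

Lemma measurable_xy_affine (r q : R) (v : V) :
  measurable_fun setT (fun z : mV => ((r * z.1 + v.1)%R, q *: z.2 + v.2) : mV).
Proof.
apply: measurable_fun_pair.
  by apply: measurable_funD => //; apply: measurable_funM.
exact: (measurableT_comp (measurable_rV_affine q v.2) measurable_snd).
Qed.

(** Two separate scalings: translations take both equal to 1, while the argument y/e of the
    coefficients needs [r = 1] and [q = e^-1]. *)
Lemma lebesgue_xy_affine (r q : R) (v : V) (A : set mV) : 0 < r -> 0 < q -> measurable A ->
  (mu ((fun z : mV => ((r * z.1 + v.1)%R, (q *: z.2 + v.2)%R) : mV) @^-1` A) * (r * q ^+ n)%:E)%E = mu A.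
Proof.
move=> r0 q0 mA; rewrite /lebesgue_xy/= /product_measure1.
rewrite -[RHS](@integral_comp_preserving _ _ _ _ (fun x : measurableTypeR R => r * x + v.1 : measurableTypeR R) r) //; last first.
- exact: (measurable_fun_xsection _ mA).
- by move=> C mC; rewrite lebesgue_measure_affine.
- by apply: measurable_funD => //; apply: measurable_funM.
rewrite mulrC EFinM muleA; congr (_ * _)%E.
rewrite -ge0_integralZr//; last 2 first.
- apply: measurable_fun_xsection.
  by rewrite -[X in measurable X]setTI; exact: measurable_xy_affine.
- by rewrite lee_fin exprn_ge0 // ltW.
apply: eq_integral => x _ /=.
rewrite -(lebesgue_rV_affine v.2 q0 (A := xsection A (r * x + v.1))).
  by congr (_ * _)%E.
exact: measurable_xsection.
Qed.

Lemma lebesgue_xy_shift (v : V) (A : set mV) : measurable A ->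
  (mu ((fun z : V => (z + v)%R : mV) @^-1` A) * 1%:E)%E = mu A.
Proof.
move=> mA; rewrite -(@lebesgue_xy_affine 1 1 v A)// expr1n mulr1.
have -> // : (fun z : V => (z + v)%R : mV) = (fun z : mV => ((1 * z.1 + v.1)%R, 1 *: z.2 + v.2) : mV).
by apply/funext => z; rewrite mul1r scale1r.
Qed.

Lemma measurable_shift_xy (v : V) : measurable_fun (setT : set mV) (fun z : V => z + v : mV).
Proof.
rewrite (_ : (fun _ => _) = (fun z : mV => ((1 * z.1 + v.1)%R, 1 *: z.2 + v.2) : mV)).
  exact: measurable_xy_affine.
by apply/funext => z; rewrite mul1r scale1r.
Qed.

Lemma integral_shift_xy (f : V -> \bar R) (v : V) : measurable_fun (setT : set mV) f ->
  (\int[mu]_z f ((z : V) + v)%R = \int[mu]_z f z)%E.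
Proof.
move=> mf; rewrite -[RHS](@integral_comp_preserving _ _ _ mu (fun z : V => z + v : mV) 1)//.
- by rewrite mule1.
- exact: measurable_shift_xy.
- exact: lebesgue_xy_shift.
Qed.

Lemma Rintegral_shift_xy (f : V -> R) (v : V) : measurable_fun (setT : set mV) f ->
  \int[mu]_z f (z + v) = \int[mu]_z f z.
Proof.
move=> mf; rewrite /Rintegral (integral_shift_xy v (f := EFin \o f))//.
exact/measurable_EFinP.
Qed.

Lemma integrable_shift_xy (f : V -> R) (v : V) : mu.-integrable setT (EFin \o f) ->
  mu.-integrable setT (EFin \o (fun z => f (z + v))).
Proof.
move=> /integrableP[mf foo]; apply/integrableP; split.
  exact: (measurableT_comp mf (measurable_shift_xy v)).
rewrite (integral_shift_xy v (f := abse \o (EFin \o f)))//.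
exact: measurableT_comp.
Qed.

Lemma lebesgue_xy_box (r : R) : 0 < r ->
  mu (`]-r, r[%classic `*` @cube_rV R n r) = ((2 * r) * (2 * r) ^+ n)%:E.
Proof.
move=> r0; rewrite /lebesgue_xy/= product_measure1E//; last exact: measurable_cube_rV.
rewrite lebesgue_rV_cube//.
have h : lebesgue_measure (`](- r)%R, r[%classic : set (measurableTypeR R)) = (2 * r)%:E.
  by rewrite lebesgue_measure_itv/= lte_fin gtrN// -EFinD opprK -mulr2n mulr_natl.
by rewrite [X in (X * _)%E]h.
Qed.

Lemma box_xyE (r : R) : 0 < r ->
  `]-r, r[%classic `*` @cube_rV R n r = [set z : V | `|z| < r].
Proof.
move=> r0; apply/seteqP; split => z /=.
  by rewrite in_itv/= -ltr_norml => -[h1 h2]; exact: xy_norm_lt.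
move=> h; split; first by rewrite in_itv/= -ltr_norml (le_lt_trans (xy_norm1 z)).
by move=> j; rewrite (le_lt_trans (xy_norm2 z j)).
Qed.

Lemma lebesgue_xy_ball (r : R) : 0 < r ->
  mu [set z : V | `|z| < r] = ((2 * r) * (2 * r) ^+ n)%:E.
Proof. by move=> r0; rewrite -box_xyE// lebesgue_xy_box. Qed.

Lemma measurable_ball_xy (r : R) : measurable ([set z : V | `|z| < r] : set mV).
Proof.
apply: open_measurable_xy; rewrite (_ : mkset _ = (fun z : V => `|z|) @^-1` [set x | x < r])//.
by apply: open_comp => [x _|]; [exact: norm_continuous|exact: open_lt].
Qed.

Lemma compact_closed_ball_xy (r : R) : compact [set z : V | `|z| <= r].
Proof.
apply: (@subclosed_compact _ _ (`[(-r), r]%classic `*` [set y : 'rV[R]_n | forall j, `[(-r), r]%classic (y ord0 j)])).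
- rewrite (_ : mkset _ = (fun z : V => `|z|) @^-1` [set x | x <= r])//.
  by apply: closed_comp => [x _|]; [exact: norm_continuous|exact: closed_le].
- apply: compact_setX; first exact: segment_compact.
  by apply: (@rV_compact R n (fun=> `[(-r), r]%classic)) => _; exact: segment_compact.
- move=> z /= h; split; first by rewrite in_itv/= -ler_norml (le_trans (xy_norm1 z)).
  by move=> j; rewrite in_itv/= -ler_norml (le_trans (xy_norm2 z j)).
Qed.

(** For these finite-dimensional spaces this amounts to compact support; phrased by a radius, it
    passes to derivatives at once. *)
Definition bsupp (f : V -> R) := exists r : R, forall z, r < `|z| -> f z = 0.

Lemma Cc_bounded (f : V -> R) : continuous f -> bsupp f -> exists M : R, forall z, `|f z| <= M.
Proof.
move=> cf [r hr].
have : compact (f @` [set z : V | `|z| <= r]).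
  by apply: continuous_compact; [exact: continuous_subspaceT|exact: compact_closed_ball_xy].
move=> /compact_bounded[M [_ hM]]; exists (Num.max 0 (M + 1)) => z.
have [zr|rz] := lerP `|z| r; last by rewrite hr// normr0 le_max lexx.
by rewrite le_max; apply/orP; right; apply: (hM (M + 1)); [rewrite ltrDl|exists z].
Qed.

Lemma Cc_integrable (f : V -> R) : continuous f -> bsupp f -> mu.-integrable setT (EFin \o f).
Proof.
move=> cf bf; have [M hM] := Cc_bounded cf bf; have [r hr] := bf.
pose s := Num.max 1 (r + 1); have s0 : 0 < s by rewrite lt_max ltr01.
have rs : r < s by rewrite lt_max ltrDl ltr01 orbT.
have mf : measurable_fun (setT : set mV) f by exact: continuous_measurable_xy.
have -> : f = f \_ [set z : V | `|z| < s].
  apply/funext => z; rewrite patchE; case: ifPn => //; rewrite notin_setE/= => /negP.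
  by rewrite -leNgt => sz; rewrite hr// (lt_le_trans rs).
rewrite -restrict_EFin; apply/(integrable_mkcond _ _).1.
  exact: measurable_ball_xy.
apply: measurable_bounded_integrable.
- exact: measurable_ball_xy.
- by rewrite lebesgue_xy_ball// ltry.
- exact: measurable_funS mf.
- exists M; split; first exact: num_real.
  by move=> x Mx z _; exact: le_trans (hM z) (ltW Mx).
Qed.

(** Compactness, as near covering over radii tending to 0, gives one radius for all points of a
    large ball. If only the second point lies in that ball, the roles are exchanged; if none does,
    both values are 0. *)
Lemma Cc_unif (f : V -> R) (e : R) : continuous f -> bsupp f -> 0 < e ->
  exists2 d : R, 0 < d & forall z z', `|z - z'| < d -> `|f z - f z'| < e.
Proof.
move=> cf [r hr] e0.
have cK := @compact_closed_ball_xy r.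
move/compact_near_coveringP : cK => /(_ R (0^'+) (fun d z => forall z', `|z - z'| < d -> `|f z - f z'| < e)).
case.
  move=> z zr; have := cf z => /cvgrPdist_lt/(_ (e / 2)).
  rewrite divr_gt0// => /(_ isT)/nbhs_ballP[d/= d0 hd].
  exists ([set z' | `|z - z'| < d / 2], [set x | x < d / 2]); first split => /=.
  - apply/nbhs_ballP; exists (d / 2); first by rewrite /= divr_gt0.
    by move=> z' /=; rewrite -ball_normE.
  - by apply: nbhs_right_lt; rewrite divr_gt0.
  move=> [z1 x] /= [h1 h2] z2 h3.
  rewrite [ltRHS]splitr (le_lt_trans (ler_distD (f z) _ _))// ltrD//.
    rewrite distrC; apply: hd; rewrite -ball_normE/=; apply: lt_trans h1 _.
    by rewrite ltr_pdivrMr// mulr_natr mulr2n ltrDl.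
  apply: hd; rewrite -ball_normE/= [d]splitr (le_lt_trans (ler_distD z1 _ _))// ltrD//.
  exact: lt_trans h3 h2.
move=> d /= d0 hd; pose d' := d / 2.
have d'0 : 0 < d' by rewrite divr_gt0.
have d'd : d' < d by rewrite ltr_pdivrMr// mulr_natr mulr2n ltrDl.
have hd' : forall z, `|z| <= r -> forall z', `|z - z'| < d' -> `|f z - f z'| < e.
  by move=> z zr; apply: (hd d') => //=; rewrite sub0r normrN gtr0_norm.
exists d' => // z z' zz'.
have [zr|zr] := lerP `|z| r; first exact: hd'.
have [z'r|z'r] := lerP `|z'| r; first by rewrite distrC hd'// distrC.
by rewrite !hr// subrr normr0.
Qed.

Lemma compact_open_dist (K U : set V) : compact K -> open U -> K `<=` U ->
  exists2 d : R, 0 < d & forall z w, K z -> `|z - w| < d -> U w.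
Proof.
move=> cK oU KU.
move/compact_near_coveringP : cK => /(_ R (0^'+) (fun d z => forall w, `|z - w| < d -> U w)).
case.
  move=> z /KU Uz; have /nbhs_ballP[d/= d0 hd] : nbhs z U by exact: open_nbhs_nbhs.
  exists ([set z' | `|z - z'| < d / 2], [set x | x < d / 2]); first split => /=.
  - apply/nbhs_ballP; exists (d / 2); first by rewrite /= divr_gt0.
    by move=> z' /=; rewrite -ball_normE.
  - by apply: nbhs_right_lt; rewrite divr_gt0.
  move=> [z1 x] /= [h1 h2] w h3.
  apply: hd; rewrite -ball_normE/= [d]splitr (le_lt_trans (ler_distD z1 _ _))// ltrD//.
  exact: lt_trans h3 h2.
move=> d /= d0 hd; pose d' := d / 2.
have d'0 : 0 < d' by rewrite divr_gt0.
have d'd : d' < d by rewrite ltr_pdivrMr// mulr_natr mulr2n ltrDl.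
by exists d' => // z w Kz; apply: (hd d') => //=; rewrite sub0r normrN gtr0_norm.
Qed.

Definition Cc_smooth (k : V -> R) := smooth_on setT k /\ bsupp k.

Lemma bsupp_derive (k : V -> R) v : bsupp k -> bsupp ('D_v k).
Proof.
move=> [r hr]; exists r => z rz.
rewrite (near_eq_derive (g := fun=> 0)) ?derive_cst//.
near=> w; apply: hr; near: w.
have : open [set w : V | r < `|w|].
  rewrite (_ : mkset _ = (fun z : V => `|z|) @^-1` [set x | r < x])//.
  by apply: open_comp => [x _|]; [exact: norm_continuous|exact: open_gt].
by move=> oU; apply: (open_nbhs_nbhs (conj oU _)).
Unshelve. all: by end_near. Qed.

Lemma Cc_smooth_derive (k : V -> R) v : Cc_smooth k -> Cc_smooth ('D_v k).
Proof. by move=> [sk bk]; split; [exact: smooth_derive|exact: bsupp_derive]. Qed.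

Lemma Cc_smooth_continuous (k : V -> R) : Cc_smooth k -> continuous k.
Proof. by move=> [sk _]; exact: smooth_continuous. Qed.

(** The kernel is not reflected, [k (w - z)]: this costs a sign under differentiation, but makes the
    value at [z] an average of [f] over [z] plus the support of [k]. *)
Definition conv (f k : V -> R) (z : V) : R := \int[mu]_w (f w * k ((w : V) - z)).

Lemma continuous_bounded_mul_integrable (f g : V -> R) (M : R) :
  mu.-integrable setT (EFin \o f) -> measurable_fun (setT : set mV) g ->
  (forall z, `|g z| <= M) -> mu.-integrable setT (EFin \o (fun z => f z * g z)).
Proof.
move=> fi mg gM.
rewrite (_ : EFin \o _ = (EFin \o f) \* (EFin \o g))%E; last first.
  by apply/funext => z /=; rewrite EFinM.
apply: integrableMl => //.
exists M; split; first exact: num_real.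
by move=> x Mx z _; exact: le_trans (gM z) (ltW Mx).
Qed.

Lemma measurable_conv_kernel (k : V -> R) (z : V) : continuous k ->
  measurable_fun (setT : set mV) (fun w : V => k (w - z)).
Proof.
by move=> ck; apply: (measurableT_comp (continuous_measurable_xy ck)); exact: measurable_shift_xy.
Qed.

Lemma conv_integrable (f k : V -> R) (z : V) : mu.-integrable setT (EFin \o f) ->
  continuous k -> bsupp k -> mu.-integrable setT (EFin \o (fun w : V => f w * k (w - z))).
Proof.
move=> fi ck bk; have [M hM] := Cc_bounded ck bk.
by apply: (@continuous_bounded_mul_integrable _ _ M) => //; exact: measurable_conv_kernel.
Qed.

Lemma conv_continuous (f k : V -> R) : mu.-integrable setT (EFin \o f) ->
  continuous k -> bsupp k -> continuous (conv f k).
Proof.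
move=> fi ck bk z; apply/cvgrPdist_le => e e0.
(* The added 1 keeps the divisor positive when [f] vanishes almost everywhere. *)
pose N := \int[mu]_w `|f w| + 1.
have N0 : 0 < N by rewrite ltr_wpDl// Rintegral_ge0.
have [d d0 hd] := Cc_unif ck bk (divr_gt0 e0 N0).
apply: (@filterS _ (nbhs (z : V)) _ (ball (z : V) d)); last exact: nbhsx_ballx.
move=> z'; rewrite -ball_normE/= => zz'.
rewrite /conv -RintegralB//; [|exact: conv_integrable..].
have ib : mu.-integrable setT (EFin \o (fun w : V => f w * k (w - z) - f w * k (w - z'))).
  rewrite /comp; under eq_fun do rewrite EFinB.
  by apply: integrableB => //; exact: conv_integrable.
apply: le_trans (le_normr_Rintegral _ ib) _ => //.
apply: (@le_trans _ _ (\int[mu]_w (`|f w| * (e / N)))).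
  apply: le_Rintegral => //.
  - exact: integrable_norm.
  - rewrite /comp; under eq_fun do rewrite EFinM.
    apply: integrableZr => //; exact: integrable_norm.
  - move=> w _; rewrite -mulrBr normrM ler_wpM2l// ltW// hd//.
    have -> : w - z - (w - z') = z' - z by rewrite opprB addrC addrA subrK.
    by rewrite distrC.
rewrite RintegralZr//; last exact: integrable_norm.
by rewrite mulrA ler_pdivrMr// mulrC ler_pM2l// lerDl.
Qed.

Lemma is_derive_reflect (k : V -> R) (w z v : V) : smooth_on setT k ->
  is_derive z v (fun z => k (w - z)) (- 'D_v k (w - z)).
Proof.
move=> sk; apply/is_derive_line.
have h : is_derive (- (0 : R)) (1 : R) (fun t : R => k ((w - z) + t *: v)) ('D_v k (w - z)).
  rewrite oppr0; apply/is_derive_line; apply: DeriveDef => //; exact: smooth_derivable.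
have := is_derive1_comp h (is_deriveNid (0 : R) (1 : R)).
rewrite mulrN mulr1; congr is_derive; apply/funext => t /=.
by rewrite scaleNr opprD addrA.
Qed.

Lemma conv_derive (f k : V -> R) z v : mu.-integrable setT (EFin \o f) -> Cc_smooth k ->
  is_derive z v (conv f k) (conv (fun w => - f w) ('D_v k) z).
Proof.
move=> fi sk; have [M hM] := Cc_bounded (Cc_smooth_continuous (Cc_smooth_derive v sk)) (Cc_smooth_derive v sk).2.
have dF (w z' : V) : is_derive z' v (fun z => f w * k (w - z)) (- f w * 'D_v k (w - z')).
  have := is_derive_mul (is_derive_cst (f w) z' v) (is_derive_reflect w z' v sk.1).
  by rewrite mul0r add0r mulrN mulNr.
have -> : conv (fun w => - f w) ('D_v k) z = \int[mu]_w 'D_v (fun z => f w * k ((w : V) - z)) z.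
  by apply: eq_Rintegral => w _; have [_ ->] := dF w z.
apply: (@is_derive_integral _ _ _ mu V setT (fun z w => f w * k (w - z)) (fun w => `|f w| * M)) => //.
- by move=> h _; apply: conv_integrable => //; [exact: Cc_smooth_continuous|exact: sk.2].
- rewrite /comp; under eq_fun do rewrite EFinM.
  by apply: integrableZr => //; exact: integrable_norm.
- by move=> t; rewrite mulr_ge0// (le_trans _ (hM 0)).
- by move=> h t _ _; have [_ ->] := dF t (z + h *: v); rewrite normrM normrN ler_wpM2l.
Qed.

(** A derivative of a convolution is again a convolution, of [- f] with a derivative of [k], so
    convolutions form a class closed under differentiation. *)
Lemma conv_smooth (f k : V -> R) : mu.-integrable setT (EFin \o f) -> Cc_smooth k ->
  smooth_on setT (conv f k).
Proof.
move=> fi sk; apply: (@smooth_class_smooth _ _ [set g | exists f' k',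
  [/\ mu.-integrable setT (EFin \o f'), Cc_smooth k' & g = conv f' k']]); last by exists f, k.
move=> _ [f' [k' [fi' sk' ->]]]; split.
  by apply: conv_continuous => //; [exact: Cc_smooth_continuous|exact: sk'.2].
move=> v; split; first by move=> x; have [] := conv_derive x v fi' sk'.
exists (fun w => - f' w), ('D_v k'); split; last first.
- by apply/funext => x; have [_ ->] := conv_derive x v fi' sk'.
- exact: Cc_smooth_derive.
- rewrite /comp; under eq_fun do rewrite EFinN; exact: integrableN.
Qed.

Lemma conv_shift (f k : V -> R) z : continuous f -> continuous k ->
  conv f k z = \int[mu]_w (f ((w : V) + z) * k w).
Proof.
move=> cf ck; rewrite /conv.
rewrite -(@Rintegral_shift_xy (fun w : V => f w * k (w - z)) z); last first.
  by apply: measurable_funM; [exact: continuous_measurable_xy|exact: measurable_conv_kernel].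
by apply: eq_Rintegral => w _; rewrite addrK.
Qed.

Lemma conv_shift_integrable (f k : V -> R) (z : V) : continuous f -> bsupp f ->
  continuous k -> bsupp k ->
  mu.-integrable setT (EFin \o (fun w : V => f (w + z) * k w)).
Proof.
move=> cf bf ck bk; have [M hM] := Cc_bounded cf bf.
under eq_fun do rewrite mulrC.
apply: (@continuous_bounded_mul_integrable _ _ M) => //; first exact: Cc_integrable.
by apply: (measurableT_comp (continuous_measurable_xy cf)); exact: measurable_shift_xy.
Qed.

Lemma conv_derive_left (f k : V -> R) (e z : V) : continuous f -> bsupp f ->
  (forall z, derivable f z e) -> continuous ('D_e f) -> continuous k -> bsupp k ->
  is_derive z e (conv f k) (conv ('D_e f) k z).
Proof.
move=> cf bf df cdf ck bk.
have [M hM] := Cc_bounded cdf (bsupp_derive e bf).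
have -> : conv f k = (fun z => \int[mu]_w (f ((w : V) + z) * k w)).
  by apply/funext => x; exact: conv_shift.
have dF (w z' : V) : is_derive z' e (fun z => f (w + z) * k w) ('D_e f (w + z') * k w).
  have h : is_derive z' e (fun z => f (w + z)) ('D_e f (w + z')).
    apply/is_derive_line.
    have /is_derive_line : is_derive (w + z') e f ('D_e f (w + z')) by apply: DeriveDef.
    by congr is_derive; apply/funext => t; rewrite addrA.
  have := is_derive_mul h (is_derive_cst (k w) z' e).
  by rewrite mulr0 addr0.
have -> : conv ('D_e f) k z = \int[mu]_w 'D_e (fun z => f ((w : V) + z) * k w) z.
  rewrite conv_shift//; by apply: eq_Rintegral => w _; have [_ ->] := dF w z.
apply: (@is_derive_integral _ _ _ mu V setT (fun z w => f (w + z) * k w) (fun w => M * `|k w|)) => //.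
- by move=> h _; exact: conv_shift_integrable.
- rewrite /comp; under eq_fun do rewrite EFinM.
  by apply: integrableZl => //; apply: integrable_norm; exact: Cc_integrable.
- by move=> t; rewrite mulr_ge0// (le_trans _ (hM 0)).
- by move=> h t _ _; have [_ ->] := dF t (z + h *: e); rewrite normrM ler_wpM2r.
Qed.

Lemma conv_supp (f k : V -> R) z : conv f k z != 0 -> exists2 w, f w != 0 & k (w - z) != 0.
Proof.
move=> h; apply: contrapT => H; move/eqP: h; apply.
rewrite /conv (_ : (fun _ => _) = cst 0) ?Rintegral_cst ?mul0r//.
apply/funext => w; apply/eqP; rewrite mulf_eq0; apply: contrapT => /negP.
by rewrite negb_or => /andP[fw kw]; apply: H; exists w.
Qed.

(** A weighted mean of values within [e] of [c] stays within [e] of [c]. Taking [c = f z] gives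
    convergence of mollifications, [c = 0] their uniform bound. *)
Lemma conv_approx (f k : V -> R) z (e c d : R) : continuous f -> bsupp f ->
  continuous k -> bsupp k -> (forall w, 0 <= k w) -> \int[mu]_w k w = 1 ->
  (forall w, k w != 0 -> `|w| < d) ->
  (forall w, `|w| < d -> `|f (w + z) - c| <= e) -> `|conv f k z - c| <= e.
Proof.
move=> cf bf ck bk k0 k1 kd fe; rewrite conv_shift//.
have ki := Cc_integrable ck bk.
have ki' : mu.-integrable setT (EFin \o (fun w => c * k w)).
  by rewrite /comp; under eq_fun do rewrite EFinM; exact: integrableZl.
have fki := conv_shift_integrable z cf bf ck bk.
have -> : c = \int[mu]_w (c * k w) by rewrite RintegralZl// k1 mulr1.
rewrite -RintegralB//.
have ib : mu.-integrable setT (EFin \o (fun w : V => f (w + z) * k w - c * k w)).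
  by rewrite /comp; under eq_fun do rewrite EFinB; apply: integrableB.
apply: le_trans (le_normr_Rintegral _ ib) _ => //.
have -> : e = \int[mu]_w (e * k w) by rewrite RintegralZl// k1 mulr1.
apply: le_Rintegral => //.
- exact: integrable_norm.
- by rewrite /comp; under eq_fun do rewrite EFinM; exact: integrableZl.
- move=> w _; rewrite -mulrBl normrM [X in _ * X]ger0_norm//.
  have [->|kw] := eqVneq (k w) 0; first by rewrite !mulr0.
  by rewrite ler_wpM2r// fe// kd.
Qed.

Lemma mollifier_ex (d : R) : 0 < d -> exists k : V -> R,
  [/\ Cc_smooth k, forall z, 0 <= k z, \int[mu]_z k z = 1 & forall z, k z != 0 -> `|z| < d].
Proof.
move=> d0; have [rho [srho rho0 rho00 rhod]] := @bump_ex R n d d0.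
have brho : bsupp rho.
  exists d => z dz; apply/eqP; apply: contraTT dz => /rhod zd; rewrite -leNgt ltW//.
have crho := smooth_continuous srho.
have irho := Cc_integrable crho brho.
pose c := \int[mu]_z rho z.
have c0 : 0 < c.
  have := crho 0 => /cvgrPdist_lt/(_ (rho 0 / 2)).
  rewrite divr_gt0// => /(_ isT)/nbhs_ballP[r/= r0 hr].
  (* By continuity [rho] exceeds half its value at 0 on a small ball, which has positive measure. *)
  apply: (@lt_le_trans _ _ (rho 0 / 2 * fine (mu [set z : V | `|z| < r]))).
    by rewrite lebesgue_xy_ball// mulr_gt0 ?divr_gt0//= mulr_gt0 ?exprn_gt0 ?mulr_gt0.
  have mB := @measurable_ball_xy r.
  rewrite -Rintegral_cst// Rintegral_mkcond; apply: le_Rintegral => //.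
    rewrite -restrict_EFin; apply/(integrable_mkcond _ _).1 => //.
    apply/integrableP; split; first exact: measurable_cst.
    rewrite (_ : (fun _ => _) = cst (rho 0 / 2)%:E); last first.
      by apply/funext => z /=; rewrite ger0_norm// divr_ge0.
    by rewrite integral_cst// lebesgue_xy_ball// -EFinM ltry.
  move=> z _; rewrite patchE; case: ifPn => //; rewrite inE/= => zr.
  have := hr z; rewrite -ball_normE/= sub0r normrN => /(_ zr).
  by rewrite ltr_norml => /andP[_]; lra.
exists (fun z => c^-1 * rho z); split.
- split; last by have [r hr] := brho; exists r => z /hr ->; rewrite mulr0.
  apply: (@smooth_class_smooth _ _ [set g | exists2 f, smooth_on setT f & g = (fun z => c^-1 * f z)]); last by exists rho.
  move=> _ [f sf ->]; split.
    by move=> x; apply: cvgM; [exact: cvg_cst|exact: smooth_continuous].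
  have dd x v : is_derive x v (fun z => c^-1 * f z) (c^-1 * 'D_v f x).
    have := is_derive_mul (is_derive_cst c^-1 x v) (DeriveDef (@smooth_derivable _ _ f x v sf) erefl).
    by rewrite mul0r add0r.
  move=> v; split; first by move=> x; have [] := dd x v.
  exists ('D_v f); first exact: smooth_derive.
  by apply/funext => x; have [_ ->] := dd x v.
- by move=> z; rewrite mulr_ge0// invr_ge0 ltW.
- by rewrite RintegralZl// mulVf// gt_eqF.
- by move=> z; rewrite mulf_eq0 negb_or => /andP[_]; exact: rhod.
Qed.

Lemma compact_bsupp (K : set V) (f : V -> R) : compact K -> (forall z, f z != 0 -> K z) -> bsupp f.
Proof.
move=> /compact_bounded[M [_ hM]] fK; exists (M + 1) => z Mz.
apply/eqP; apply: contraTT Mz => /fK Kz; rewrite -leNgt; apply: (hM (M + 1)) => //.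
by rewrite ltrDl.
Qed.

Lemma closed_bounded_compact_xy (A : set V) (r : R) : closed A ->
  (forall z, A z -> `|z| <= r) -> compact A.
Proof. by move=> cA Ar; apply: (subclosed_compact cA (@compact_closed_ball_xy r)). Qed.

(** One sequence serves all directions [e]. The uniform bounds are recorded because the
    approximations are later put under integrals by dominated convergence. *)
Lemma mollify (U K : set V) (f : V -> R) : open U -> compact K -> K `<=` U ->
  continuous f -> (forall z, f z != 0 -> K z) ->
  exists f_ : nat -> V -> R,
  [/\ forall m, test_function U (f_ m),
      forall z, f_ m z @[m --> \oo] --> f z,
      exists M : R, forall m z, `|f_ m z| <= M &
      forall e : V, (forall z, derivable f z e) -> continuous ('D_e f) ->
        (forall z, 'D_e (f_ m) z @[m --> \oo] --> 'D_e f z) /\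
        exists M : R, forall m z, `|'D_e (f_ m) z| <= M].
Proof.
move=> oU cK KU cf fK; have bf := compact_bsupp cK fK.
have [d d0 hd] := compact_open_dist cK oU KU.
(* The bound d/2 keeps the closed supports inside [U], the bound 1/(m+1) forces convergence. *)
pose d_ (m : nat) : R := Num.min (d / 2) m.+1%:R^-1.
have d_0 m : 0 < d_ m by rewrite lt_min divr_gt0//= invr_gt0.
have [k hk] := choice (fun m => mollifier_ex (d_0 m)).
have ck m : continuous (k m) by have [/Cc_smooth_continuous] := hk m.
have bk m : bsupp (k m) by have [[]] := hk m.
have approx (g : V -> R) : continuous g -> bsupp g ->
    (forall z, conv g (k m) z @[m --> \oo] --> g z) /\
    exists M : R, forall m z, `|conv g (k m) z| <= M.
  move=> cg bg; split.
    move=> z; apply/cvgrPdist_le => e e0.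
    have [r r0 hr] := Cc_unif cg bg e0.
    near=> m; rewrite distrC; have [_ k0 k1 kd] := hk m.
    apply: (@conv_approx _ _ _ _ _ (d_ m)) => // w wd.
    rewrite ltW// hr// addrK; apply: lt_trans wd _; rewrite gt_min; apply/orP; right.
    near: m; exact: near_infty_natSinv_lt (PosNum r0).
  have [M hM] := Cc_bounded cg bg; exists M => m z; have [_ k0 k1 kd] := hk m.
  rewrite -[conv _ _ _]subr0; apply: (@conv_approx _ _ _ _ _ (d_ m)) => // w _.
  by rewrite subr0.
exists (fun m => conv f (k m)); split.
- move=> m; have [sk k0 k1 kd] := hk m.
  have clU z : closure [set x | conv f (k m) x != 0] z -> exists2 w, K w & `|w - z| < d.
    move=> clz; have [z' [/= /conv_supp[w /fK Kw /kd wz']]] := clz (ball z (d / 2)) ltac:(by apply: nbhsx_ballx; rewrite divr_gt0).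
    rewrite -ball_normE/= => zz'; exists w => //.
    rewrite [d]splitr (le_lt_trans (ler_distD z' _ _))// ltrD//; last by rewrite distrC.
    by apply: lt_le_trans wz' _; rewrite ge_min lexx.
  split.
  + by apply: conv_smooth => //; exact: Cc_integrable.
  + have [M [_ hM]] := compact_bounded cK.
    apply: (@closed_bounded_compact_xy _ (M + 1 + d)); first exact: closed_closure.
    move=> z /clU[w Kw wz]; rewrite -[z](subrK w) (le_trans (ler_normD _ _))// addrC lerD//.
      by apply: (hM (M + 1)) => //; rewrite ltrDl.
    by rewrite distrC ltW.
  + by move=> z /clU[w Kw wz]; exact: (hd w).
- by have [] := approx f cf bf.
- by have [] := approx f cf bf.
- move=> e df cdf; have [h1 h2] := approx _ cdf (bsupp_derive e bf).
  have E m z : 'D_e (conv f (k m)) z = conv ('D_e f) (k m) z.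
    by have [_ ->] := conv_derive_left z cf bf df cdf (ck m) (bk m).
  split=> [z|]; last by have [M hM] := h2; exists M => m z; rewrite E.
  have -> : (fun m => 'D_e (conv f (k m)) z) = (fun m => conv ('D_e f) (k m) z).
    by apply/funext => m; exact: E.
  exact: h1.
Unshelve. all: by end_near. Qed.

End xy.

(** * Weak derivatives *)

Section distance_to_complement.
Context (R : realType) (V : normedModType R) (O : set V) (p : V).
Hypothesis Op : ~ O p.

(** The distance to the complement of [O]; the outside point [p] makes the infimum run over a
    nonempty set. *)
Definition cdist (z : V) : R := inf [set `|z - w| | w in ~` O].

Lemma cdist_has_inf z : has_inf [set `|z - w| | w in ~` O].
Proof.
split; first by exists `|z - p|, p.
by exists 0 => _ [w _ <-].
Qed.

Lemma cdist_ge0 z : 0 <= cdist z.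
Proof. by apply: lb_le_inf; [exact: (cdist_has_inf z).1|move=> _ [w _ <-]]. Qed.

Lemma cdist_le z w : ~ O w -> cdist z <= `|z - w|.
Proof. by move=> Ow; apply: ge_inf; [exact: (cdist_has_inf z).2|exists w]. Qed.

Lemma cdist_out z : ~ O z -> cdist z = 0.
Proof. by move=> Oz; apply/eqP; rewrite eq_le cdist_ge0 andbT (le_trans (cdist_le z Oz))// subrr normr0. Qed.

Lemma cdist_lip z z' : cdist z <= `|z - z'| + cdist z'.
Proof.
rewrite -lerBlDl; apply: lb_le_inf; first exact: (cdist_has_inf z').1.
move=> _ [w Ow <-]; rewrite lerBlDl; apply: le_trans (cdist_le z Ow) _.
exact: ler_distD.
Qed.

Lemma cdist_continuous : continuous cdist.
Proof.
move=> z; apply/cvgrPdist_le => e e0.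
apply: (@filterS _ (nbhs z) _ (ball z e)); last exact: nbhsx_ballx.
move=> z'; rewrite -ball_normE/= => zz'; rewrite ler_norml.
have := cdist_lip z z'; have := cdist_lip z' z; rewrite (distrC z').
by move=> h1 h2; apply/andP; split; lra.
Qed.

Lemma cdist_in z : open O -> O z -> 0 < cdist z.
Proof.
move=> oO Oz; have /nbhs_ballP[e /= e0 eO] : nbhs z O by exact: open_nbhs_nbhs.
apply: lt_le_trans e0 _; apply: lb_le_inf; first exact: (cdist_has_inf z).1.
move=> _ [w Ow <-]; rewrite leNgt; apply/negP => zw; apply: Ow; apply: eO.
by rewrite -ball_normE.
Qed.

End distance_to_complement.

Section clamp.
Context (R : realType).

(** Truncation of [t] to [0, 1], written with absolute values so that continuity is immediate. *)
Definition clamp01 (t : R) : R := (`|t| - `|t - 1| + 1) / 2.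

Lemma clamp01_bound t : 0 <= clamp01 t <= 1.
Proof.
rewrite /clamp01; have [t0|t0] := ltrP t 0.
  by rewrite ltr0_norm// ltr0_norm; [apply/andP; split|]; lra.
rewrite ger0_norm//; have [t1|t1] := lerP 1 t.
  by apply/andP; split; lra.
by apply/andP; split; lra.
Qed.

Lemma clamp01_le0 t : t <= 0 -> clamp01 t = 0.
Proof. by move=> t0; rewrite /clamp01 ler0_norm// ler0_norm; lra. Qed.

Lemma clamp01_ge1 t : 1 <= t -> clamp01 t = 1.
Proof. by move=> t1; rewrite /clamp01 !ger0_norm; lra. Qed.

Lemma clamp01_continuous : continuous clamp01.
Proof.
move=> t; apply: cvgM; last exact: cvg_cst.
apply: cvgD; last exact: cvg_cst.
apply: cvgB; first exact: norm_continuous.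
by apply: cvg_norm; apply: cvgB; [exact: cvg_id|exact: cvg_cst].
Qed.

End clamp.

Section weak.
Context (R : realType) (n : nat).
Local Notation V := (R * 'rV[R]_n)%type.
Local Notation mV := (measurableTypeR R * 'rV[R]_n)%type.
Local Notation mu := (@lebesgue_xy R n).

(** The coordinates are measurable for the sigma-algebra generated by open sets, hence so is the
    identity. With this, a Dynkin argument can start from open sets. *)
Lemma open_generate : @measurable _ mV `<=` <<s [set U : set V | open U] >>.
Proof.
move=> A mA.
pose T' := g_sigma_algebraType [set U : set V | open U].
have m1 : measurable_fun (setT : set T') (fun z : T' => (z : V).1 : measurableTypeR R).
  apply: (measurability _ (RGenOpens.measurableE R)) => _ [_ [a [b ->]] <-].
  apply: sub_sigma_algebra; rewrite setTI.
  apply: (@open_comp _ _ (fun z : V => z.1) `]a, b[%classic) => [z _|]; first exact: cvg_fst.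
  exact: interval_open.
have m2 : measurable_fun (setT : set T') (fun z : T' => (z : V).2).
  apply: measurable_fun_rV => i.
  apply: (measurability _ (RGenOpens.measurableE R)) => _ [_ [a [b ->]] <-].
  apply: sub_sigma_algebra; rewrite setTI.
  apply: (@open_comp _ _ (fun z : V => z.2 ord0 i) `]a, b[%classic) => [z _|]; last exact: interval_open.
  apply: (@continuous_comp _ _ _ snd (fun y : 'rV[R]_n => y ord0 i)); first exact: cvg_snd.
  exact: coord_continuous.
have := measurable_fun_pair m1 m2 measurableT mA; rewrite setTI.
by congr (_ _); apply/seteqP; split => -[].
Qed.

Lemma test_function_continuous (U : set V) (phi : V -> R) : test_function U phi -> continuous phi.
Proof. by move=> [s _ _]; exact: smooth_continuous. Qed.

Lemma test_function_bsupp (U : set V) (phi : V -> R) : test_function U phi -> bsupp phi.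
Proof.
move=> [_ cK _]; apply: (compact_bsupp cK) => z hz; exact: subset_closure.
Qed.

Lemma mul_continuous_integrable (D : set V) (F g : V -> R) (M : R) : measurable (D : set mV) ->
  mu.-integrable D (EFin \o F) -> continuous g -> (forall z, `|g z| <= M) ->
  mu.-integrable D (EFin \o (fun z => F z * g z)).
Proof.
move=> mD iF cg gM.
rewrite (_ : EFin \o _ = (EFin \o F) \* (EFin \o g))%E; last first.
  by apply/funext => z /=; rewrite EFinM.
apply: integrableMl => //.
  by apply: measurable_funS (continuous_measurable_xy cg).
exists M; split; first exact: num_real.
by move=> x Mx z _; exact: le_trans (gM z) (ltW Mx).
Qed.

Lemma Rdominated_mul (D : set V) (F : V -> R) (g_ : nat -> V -> R) (g : V -> R) (M : R) :
  measurable (D : set mV) -> mu.-integrable D (EFin \o F) ->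
  (forall m, continuous (g_ m)) ->
  (forall z, D z -> g_ m z @[m --> \oo] --> g z) -> (forall m z, `|g_ m z| <= M) ->
  \int[mu]_(z in D) (F z * g_ m z) @[m --> \oo] --> \int[mu]_(z in D) (F z * g z).
Proof.
move=> mD iF cg gg gM.
apply: (@Rdominated_cvg _ _ _ mu D _ _ (fun z => M * `|F z|) mD _ _ _ _).2.
- by move=> m; apply/measurable_EFinP; exact: (measurable_int _ (mul_continuous_integrable mD iF (cg m) (gM m))).
- by move=> z Dz; apply: cvgM; [exact: cvg_cst|exact: gg].
- rewrite /comp; under eq_fun do rewrite EFinM.
  by apply: integrableZl => //; exact: integrable_norm.
- by move=> m z Dz; rewrite normrM mulrC ler_wpM2r.
Qed.

(** Differentiability of [f] is asked only in the direction [e], and only once. This admits the test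
    fields built from [a], which is merely C^1: each component is differentiated in its own
    direction alone. *)
Lemma weak_derivative_Cc (D K : set V) (e : V) (u v f : V -> R) :
  open D -> mu.-integrable D (EFin \o u) -> mu.-integrable D (EFin \o v) ->
  weak_derivative D e u v -> compact K -> K `<=` D ->
  continuous f -> (forall z, f z != 0 -> K z) ->
  (forall z, derivable f z e) -> continuous ('D_e f) ->
  \int[mu]_(z in D) (u z * 'D_e f z) = - \int[mu]_(z in D) (v z * f z).
Proof.
move=> oD iu iv wd cK KD cf fK df cdf.
have mD : measurable (D : set mV) := open_measurable_xy oD.
have [f_ [tf ff [M hM] /(_ e df cdf)[dff [M' hM']]]] := mollify oD cK KD cf fK.
have c1 : \int[mu]_(z in D) (u z * 'D_e (f_ m) z) @[m --> \oo] --> \int[mu]_(z in D) (u z * 'D_e f z).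
  apply: (Rdominated_mul mD iu _ (fun z _ => dff z) hM') => m.
  by have [s _ _] := tf m; apply: smooth_continuous; exact: smooth_derive.
have c2 : \int[mu]_(z in D) (v z * f_ m z) @[m --> \oo] --> \int[mu]_(z in D) (v z * f z).
  by apply: (Rdominated_mul mD iv _ (fun z _ => ff z) hM) => m; exact: test_function_continuous (tf m).
have /cvgN {}c2 := c2.
have E : (fun m => \int[mu]_(z in D) (u z * 'D_e (f_ m) z)) = (fun m => - \int[mu]_(z in D) (v z * f_ m z)).
  by apply/funext => m; exact: wd.
by rewrite E in c1; apply: (cvg_unique _ c1 c2).
Qed.

(** Vanishing pairings pass from test functions to continuous functions by mollification, then to
    indicators of open sets by truncated multiples of the distance to the complement, then to all
    measurable sets by Dynkin's theorem. *)
Lemma du_Bois_Reymond (D : set V) (r : R) (F : V -> R) :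
  open D -> (forall z, D z -> `|z| <= r) -> mu.-integrable D (EFin \o F) ->
  (forall phi, test_function D phi -> \int[mu]_(z in D) (F z * phi z) = 0) ->
  {ae mu, forall z, D z -> F z = 0}.
Proof.
move=> oD Dr iF h.
have mD : measurable (D : set mV) := open_measurable_xy oD.
have hC (K : set V) (f : V -> R) : compact K -> K `<=` D -> continuous f ->
    (forall z, f z != 0 -> K z) -> \int[mu]_(z in D) (F z * f z) = 0.
  move=> cK KD cf fK; have [f_ [tf ff [M hM] _]] := mollify oD cK KD cf fK.
  have c1 : \int[mu]_(z in D) (F z * f_ m z) @[m --> \oo] --> \int[mu]_(z in D) (F z * f z).
    by apply: (Rdominated_mul mD iF _ (fun z _ => ff z) hM) => m; exact: test_function_continuous (tf m).
  have E : (fun m => \int[mu]_(z in D) (F z * f_ m z)) = (fun=> 0).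
    by apply/funext => m; exact: h.
  by rewrite E in c1; apply: (cvg_unique _ c1 (cvg_cst _)).
have hO (O : set V) : open O -> O `<=` D -> \int[mu]_(z in D) (F z * \1_O z) = 0.
  move=> oO OD; pose p : V := (`|r| + 1, 0).
  have Op : ~ O p.
    move=> /OD/Dr; apply/negP; rewrite -ltNge prod_normE lt_max/=.
    by rewrite ger0_norm ?addr_ge0// ltr_pwDr// ler_norm.
  (* Subtracting 1 before truncating keeps the support where m times the distance is at least 1, a
     closed set inside [O]. *)
  pose f_ (m : nat) z := clamp01 (m%:R * cdist O z - 1).
  have cf m : continuous (f_ m).
    move=> z; apply: (@continuous_comp _ _ _ (fun z => m%:R * cdist O z - 1) (@clamp01 R)); last exact: clamp01_continuous.
    by apply: cvgB; [apply: cvgM; [exact: cvg_cst|exact: (cdist_continuous Op)]|exact: cvg_cst].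
  have fE m z : ~ O z -> f_ m z = 0.
    by move=> Oz; rewrite /f_ (cdist_out Op)// mulr0 sub0r clamp01_le0// lerN10.
  have c1 : \int[mu]_(z in D) (F z * f_ m z) @[m --> \oo] --> \int[mu]_(z in D) (F z * \1_O z).
    apply: (@Rdominated_mul _ _ _ _ 1 mD iF) => //.
      move=> z Dz; have [Oz|Oz] := pselect (O z); last first.
        rewrite indicE memNset//=; under eq_fun do rewrite fE//; exact: cvg_cst.
      rewrite indicE mem_set//=; apply: cvg_near_cst.
      have d0 := cdist_in Op oO Oz.
      near=> m; rewrite /f_ clamp01_ge1// lerBrDr -ler_pdivrMr//.
      near: m; exact: nbhs_infty_ger.
    by move=> m z; rewrite ger0_norm; have /andP[] := clamp01_bound (m%:R * cdist O z - 1).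
  have E : (fun m => \int[mu]_(z in D) (F z * f_ m z)) = (fun=> 0).
    apply/funext => m; apply: (hC [set z | 1 <= m%:R * cdist O z]) => //.
    - apply: (@closed_bounded_compact_xy _ _ _ r).
        rewrite (_ : mkset _ = (fun z : V => m%:R * cdist O z) @^-1` [set x | 1 <= x])//.
        apply: closed_comp => [x _|]; last exact: closed_ge.
        by apply: cvgM; [exact: cvg_cst|exact: (cdist_continuous Op)].
      move=> z /= mz; apply: Dr; apply: OD; apply: contrapT => Oz.
      by move: mz; rewrite (cdist_out Op)// mulr0 ler10.
    - move=> z /= mz; apply: OD; apply: contrapT => Oz.
      by move: mz; rewrite (cdist_out Op)// mulr0 ler10.
    - move=> z; apply: contraR; rewrite -ltNge => mz; rewrite /f_ clamp01_le0// subr_le0 ltW//.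
  by rewrite E in c1; apply: (cvg_unique _ c1 (cvg_cst _)).
(* Extended by 0, [F] has integrals over all measurable sets, and the Dynkin class can contain the
   whole space. *)
pose F0 := F \_ D.
have iF0 : mu.-integrable setT (EFin \o F0).
  by rewrite /F0 -restrict_EFin; apply/(integrable_mkcond _ mD).1.
pose H := [set A : set mV | measurable A /\ \int[mu]_(z in A) F0 z = 0].
have openH : [set U : set V | open U] `<=` H.
  move=> U /= oU; have mU := open_measurable_xy oU; split => //.
  have oUD : open (U `&` D) by exact: openI.
  rewrite -(hO _ oUD) 1?Rintegral_mkcond; last by move=> ? [].
  rewrite [RHS]Rintegral_mkcond; apply: eq_Rintegral => z _.
  rewrite /F0 !patchE indicE in_setI; case: (z \in U); case: (z \in D) => //=.
  - by rewrite mulr1.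
  - by rewrite mulr0.
have dH : lambda_system setT H.
  apply/dynkin_lambda_system; split.
  - by apply: openH; exact: openT.
  - move=> A [mA A0]; split; first exact: measurableC.
    have [_ T0] := openH setT openT.
    have := @Rintegral_setU _ _ _ mu A (~` A) F0 mA (measurableC mA).
    rewrite setUv => /(_ iF0); rewrite A0 T0 add0r => <- //.
    by apply/disj_setPCl.
  - move=> G tG HG; split; first by apply: bigcupT_measurable => k; have [] := HG k.
    rewrite /Rintegral integral_bigcup//; last 2 first.
    + by move=> k; have [] := HG k.
    + apply: integrableS iF0 => //; by apply: bigcupT_measurable => k; have [] := HG k.
    + rewrite eseries0// => k _ _; have [mG G0] := HG k.
      rewrite -[LHS]fineK; first by rewrite -/(Rintegral mu (G k) F0) G0.
      by apply: integrable_fin_num => //; apply: integrableS iF0.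
have allH (A : set mV) : measurable A -> \int[mu]_(z in A) F0 z = 0.
  move=> /open_generate; move: A; suff : <<s [set U : set V | open U] >> `<=` H by move=> sH A /sH[].
  by apply: lambda_system_subset => // A B oA oB; exact: openI.
have hE (E : set mV) : E `<=` D -> measurable E ->
    (\int[mu]_(x in E) (EFin \o F) x = \int[mu]_(x in E) cst 0 x)%E.
  move=> ED mE; rewrite integral0 -[LHS]fineK; last first.
    by apply: integrable_fin_num => //; apply: integrableS iF.
  congr EFin; rewrite -[RHS](allH E mE); apply: eq_Rintegral => z /set_mem zE.
  by rewrite /F0 patchE mem_set//; exact: ED.
apply: filterS (integral_ae_eq mD iF (measurable_cst _) hE) => z /= hz Dz.
by have [] := hz Dz.
Unshelve. all: by end_near. Qed.

End weak.

(** * Square-integrable functions *)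

Section square_integrable.
Context d (T : measurableType d) (R : realType) (mu : {measure set T -> \bar R}).
Implicit Types (D : set T) (u v : T -> R).

(** L^2 through integrability of the square, the form in which algebra and Fubini's theorem use it;
    [L2P] relates it to [L2]. *)
Definition sqint D u := measurable_fun D u /\ mu.-integrable D (EFin \o (fun x => u x ^+ 2)).

Lemma sqint_mul D u v : measurable D -> sqint D u -> sqint D v ->
  mu.-integrable D (EFin \o (fun x => u x * v x)).
Proof.
move=> mD [mu_ iu] [mv iv].
apply: (@le_integrable _ _ _ mu D mD _ (EFin \o (fun x => u x ^+ 2 + v x ^+ 2))).
- by apply/measurable_EFinP; exact: measurable_funM.
- move=> x _; rewrite /= lee_fin [leRHS]ger0_norm ?addr_ge0 ?sqr_ge0// normrM.
  rewrite -[u x ^+ 2]real_normK ?num_real// -[v x ^+ 2]real_normK ?num_real//.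
  have := sqr_ge0 (`|u x| - `|v x|); have := normr_ge0 (u x); have := normr_ge0 (v x).
  nra.
- by rewrite /comp; under eq_fun do rewrite EFinD; exact: integrableD.
Qed.

Lemma sqintD D u v : measurable D -> sqint D u -> sqint D v -> sqint D (fun x => u x + v x).
Proof.
move=> mD su sv; have iuv := sqint_mul mD su sv.
have [mu_ iu] := su; have [mv iv] := sv.
split; first exact: measurable_funD.
rewrite (_ : EFin \o _ = (EFin \o (fun x => (u x ^+ 2)%R)) \+ ((fun x => 2%:E * (u x * v x)%R%:E) \+ (EFin \o (fun x => (v x ^+ 2)%R))))%E; last first.
  by apply/funext => x /=; rewrite -EFinM -!EFinD; congr EFin; ring.
by apply: integrableD => //; apply: integrableD => //; exact: integrableZl.
Qed.

Lemma sqintMl D u v (M : R) : measurable D -> measurable_fun D v ->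
  (forall x, D x -> `|v x| <= M) -> sqint D u -> sqint D (fun x => v x * u x).
Proof.
move=> mD mv vM [mu_ iu]; split; first exact: measurable_funM.
apply: (@le_integrable _ _ _ mu D mD _ (EFin \o (fun x => M ^+ 2 * u x ^+ 2))).
- by apply/measurable_EFinP; apply: measurable_funX; exact: measurable_funM.
- move=> x Dx; rewrite /= lee_fin [X in X <= _]ger0_norm ?sqr_ge0// [X in _ <= X]ger0_norm; last by rewrite mulr_ge0 ?sqr_ge0.
  rewrite exprMn.
  rewrite ler_wpM2r ?sqr_ge0// -[v x ^+ 2]real_normK ?num_real// ler_sqr ?nnegrE ?vM//.
  exact: le_trans (vM x Dx).
- by rewrite /comp; under eq_fun do rewrite EFinM; exact: integrableZl.
Qed.

Lemma sqintZ D u (c : R) : measurable D -> sqint D u -> sqint D (fun x => c * u x).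
Proof. by move=> mD; apply: (@sqintMl _ _ _ `|c|). Qed.

Lemma sqintB D u v : measurable D -> sqint D u -> sqint D v -> sqint D (fun x => u x - v x).
Proof.
move=> mD su sv; have := sqintD mD su (sqintZ (-1) mD sv).
by congr sqint; apply/funext => x; rewrite mulN1r.
Qed.

Lemma sqint_sum D (I : Type) (s : seq I) (u : I -> T -> R) : measurable D ->
  (forall i, sqint D (u i)) -> sqint D (fun x => \sum_(i <- s) u i x).
Proof.
move=> mD su; elim: s => [|i s IH].
  under eq_fun do rewrite big_nil; split; first exact: measurable_cst.
  under eq_fun do rewrite expr0n/=; exact: integrable0.
under eq_fun do rewrite big_cons; exact: sqintD.
Qed.

(** The quadratic in t is the integral of (t u + v)^2. *)
Lemma sqint_CauchySchwarz D u v : measurable D -> sqint D u -> sqint D v ->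
  (\int[mu]_(x in D) (u x * v x)) ^+ 2 <=
  (\int[mu]_(x in D) u x ^+ 2) * (\int[mu]_(x in D) v x ^+ 2).
Proof.
move=> mD su sv; have iuv := sqint_mul mD su sv.
have [mu_ iu] := su; have [mv iv] := sv.
apply: discriminant_le; [by apply: Rintegral_ge0 => x _; rewrite sqr_ge0..|].
move=> t.
have i1 : mu.-integrable D (EFin \o (fun x => t ^+ 2 * u x ^+ 2)).
  by rewrite /comp; under eq_fun do rewrite EFinM; exact: integrableZl.
have i2 : mu.-integrable D (EFin \o (fun x => (2 * t) * (u x * v x))).
  by rewrite /comp; under eq_fun do rewrite EFinM; exact: integrableZl.
have -> : (\int[mu]_(x in D) u x ^+ 2) * t ^+ 2 + 2 * (\int[mu]_(x in D) (u x * v x)) * t +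
    \int[mu]_(x in D) v x ^+ 2 = \int[mu]_(x in D) (t ^+ 2 * u x ^+ 2 + (2 * t) * (u x * v x) + v x ^+ 2).
  rewrite RintegralD//; last first.
    by rewrite /comp; under eq_fun do rewrite EFinD; exact: integrableD.
  by rewrite RintegralD// !RintegralZl//; ring.
apply: Rintegral_ge0 => x _.
have -> : t ^+ 2 * u x ^+ 2 + 2 * t * (u x * v x) + v x ^+ 2 = (t * u x + v x) ^+ 2 by ring.
exact: sqr_ge0.
Qed.

Lemma sqint_integrable D u : measurable D -> (mu D < +oo)%E -> sqint D u -> mu.-integrable D (EFin \o u).
Proof.
move=> mD fD su; have s1 : sqint D (cst 1).
  split; first exact: measurable_cst.
  under eq_fun do rewrite expr1n; apply/integrableP; split; first exact: measurable_cst.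
  by under eq_integral do rewrite /= normr1; rewrite integral_cst// mul1e.
have := sqint_mul mD su s1; congr (_.-integrable _ _).
by apply/funext => x /=; rewrite mulr1.
Qed.

Lemma sqint_eq D u v : measurable D -> (forall x, D x -> u x = v x) -> sqint D u -> sqint D v.
Proof.
move=> mD uv [m i]; split; first by apply: eq_measurable_fun m => x /set_mem; exact: uv.
by apply: (eq_integrable mD) i => x /set_mem Dx /=; rewrite uv.
Qed.

End square_integrable.
Arguments sqint {d T R} mu D u.

Section L2_sqint.
Context (R : realType) (n : nat).
Local Notation V := (R * 'rV[R]_n)%type.
Local Notation mV := (measurableTypeR R * 'rV[R]_n)%type.
Local Notation mu := (@lebesgue_xy R n).

Lemma L2normE (D : set V) (u : V -> R) : measurable (D : set mV) ->
  (L2norm D u = (\int[mu]_(z in D) (u z ^+ 2)%:E) `^ 2^-1)%E.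
Proof.
move=> mD; rewrite /L2norm unlock; congr (_ `^ _)%E.
rewrite [RHS]integral_mkcond; apply: eq_integral => z _.
rewrite /= !patchE; case: ifPn => _.
  by rewrite powR_mulrn// real_normK ?num_real.
(* Off [D] the patched function takes the default value 0. *)
by change ((`|(0 : R)| `^ 2)%:E = 0%:E); rewrite normr0 powR0.
Qed.

Lemma L2P (D : set V) (u : V -> R) : measurable (D : set mV) -> L2 D u <-> sqint mu D u.
Proof.
move=> mD; split.
  move=> h; have i := Lfun2_integrable_sqr h.
  have mu_ : measurable_fun D u.
    by move: h; rewrite /L2 inE => /andP[+ _]; rewrite inE/= => /(measurable_restrictT u mD).
  split => //; apply/(integrable_mkcond _ mD).
  move: i; congr (_.-integrable _ _); apply/funext => z /=.
  by rewrite !patchE; case: ifP => //; rewrite expr0n.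
move=> [mu_ iu]; rewrite /L2 inE; apply/andP; split; rewrite inE/=.
  exact/(measurable_restrictT u mD).
rewrite /finite_norm -/(L2norm D u) L2normE// poweR_lty//.
have /integrableP[_] := iu; apply: le_lt_trans; apply: ge0_le_integral => //.
- by move=> x _; rewrite lee_fin sqr_ge0.
- exact: (measurable_int _ iu).
- by apply: measurableT_comp => //; exact: (measurable_int _ iu).
- by move=> z _ /=; rewrite lee_fin ler_norm.
Qed.

End L2_sqint.

(** * Bounds for a function of class C^1 on the closed interval *)

Section C1.
Context (R : realType) (a : R -> R).
Hypothesis a_C1 : C1_01 a.

Lemma C1_01_data : exists (a' : R -> R) (M : R),
  [/\ 0 < M, forall x : R, 0 < x < 1 -> is_derive x 1 a (a' x),
      forall x : R, 0 < x < 1 -> {for x, continuous a'},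
      forall x : R, 0 < x < 1 -> `|a' x| <= M &
      forall x : R, 0 < x < 1 -> `|a x| <= M].
Proof.
have [a' ca' da'] := a_C1.
have dd (x : R) : 0 < x < 1 -> is_derive x 1 a (a' x).
  move=> /andP[x0 x1].
  have h : h^-1 *: (a (h *: 1 + x) - a x) @[h --> 0^'] --> a' x.
    apply/cvgrPdist_le => e e0.
    have := da' x; rewrite !ltW// => /(_ isT)/cvgrPdist_le/(_ e e0) H.
    have {H} : nbhs x [set y | y != x -> `[0, 1]%classic y -> `|a' x - (a y - a x) / (y - x)| <= e] by exact: H.
    move=> /nbhs_ballP[r /= r0 hr].
    near=> h.
    have h0 : h != 0 by near: h; exact: nbhs_dnbhs_neq.
    have hx : `|h| < Num.min r (Num.min x (1 - x)).
      near: h; apply: dnbhs0_lt; by rewrite !lt_min r0 x0 subr_gt0.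
    move: hx; rewrite !lt_min => /and3P[hr' hx1 hx2].
    have := hr (h *: 1 + x); rewrite -ball_normE/= /GRing.scale/= mulr1.
    rewrite opprD addrCA subrr addr0 normrN => /(_ hr').
    rewrite -subr_eq0 addrK => /(_ h0); rewrite mulrC; apply.
    rewrite in_itv/=; have := ler_norm h; have := ler_norm (- h); rewrite normrN => ? ?.
    by apply/andP; split; lra.
  by apply: DeriveDef; [apply/cvg_ex; exists (a' x)|apply/cvg_lim].
have ca (x : R) : 0 < x < 1 -> {for x, continuous a'}.
  move=> x01; have sub01 : `]0, 1[%classic `<=` (`[0, 1]%classic : set R) by exact: subset_itv_oo_cc.
  have := continuous_subspaceW sub01 ca'.
  by rewrite continuous_open_subspace; [apply; rewrite inE/= in_itv|exact: interval_open].
have [M1 hM1] : exists M1 : R, forall x : R, 0 < x < 1 -> `|a' x| <= M1.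
  have : compact (a' @` `[0, 1]%classic) by apply: continuous_compact => //; exact: segment_compact.
  move=> /compact_bounded[M [_ hM]]; exists (M + 1) => x x01.
  apply: (hM (M + 1)); first by rewrite ltrDl.
  by exists x => //=; rewrite in_itv/=; have /andP[/ltW-> /ltW->] := x01.
have M10 : 0 <= M1 by apply: le_trans (hM1 (2^-1) _) => //; apply/andP; split; lra.
have cont (x : R) : 0 < x < 1 -> {for x, continuous a}.
  by move=> x01; apply: differentiable_continuous; apply/derivable1_diffP; have [] := dd x x01.
pose c : R := 2^-1.
have c01 : 0 < c < 1 by rewrite /c; apply/andP; split; lra.
have mvt (x y : R) : 0 < x -> x <= y -> y < 1 -> `|a y - a x| <= M1.
  move=> x0 xy y1.
  have sub z : `[x, y]%classic z -> 0 < z < 1.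
    by rewrite /= in_itv/= => /andP[h1 h2]; rewrite (lt_le_trans x0)//= (le_lt_trans h2).
  have [z zxy ->] : exists2 z, z \in `[x, y]%R & a y - a x = a' z * (y - x).
    apply: MVT_segment => //.
      by move=> z zxy; apply: dd; apply: sub; exact: (subset_itv_oo_cc zxy).
    by apply: continuous_in_subspaceT => z /set_mem zxy; apply: cont; exact: sub.
  rewrite normrM -[M1]mulr1.
  apply: ler_pM => //; first by apply: hM1; exact: sub.
  by rewrite ger0_norm ?subr_ge0//; lra.
(* One constant serves both bounds, and the added 1 makes it positive. *)
exists a', (M1 + `|a c| + 1); split => //.
- by rewrite ltr_wpDl// addr_ge0.
- by move=> x x01; rewrite (le_trans (hM1 x x01))// -addrA lerDl addr_ge0.
- move=> x /[dup] x01 /andP[x0 x1].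
  have : `|a x - a c| <= M1.
    have [xc|cx] := lerP x c; first by rewrite distrC; apply: mvt; rewrite // ?(andP c01).2.
    by apply: mvt => //; [case/andP: c01|exact: ltW].
  move=> h; rewrite -[a x](subrK (a c)) (le_trans (ler_normD _ _))//.
  by rewrite -addrA lerD// lerDl.
Unshelve. all: by end_near. Qed.

End C1.

Lemma ae_imp d (T : measurableType d) (R : realType) (mu : {measure set T -> \bar R})
    (P Q : T -> Prop) : (forall x, P x -> Q x) -> {ae mu, forall x, P x} -> {ae mu, forall x, Q x}.
Proof. by move=> PQ; apply: filterS. Qed.

Lemma integrable_ae_eq d (T : measurableType d) (R : realType) (mu : {measure set T -> \bar R})
    (D : set T) (f g : T -> R) : measurable D -> measurable_fun D g ->
  {ae mu, forall x, D x -> f x = g x} -> mu.-integrable D (EFin \o f) -> mu.-integrable D (EFin \o g).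
Proof.
move=> mD mg fg /integrableP[mf foo]; apply/integrableP; split; first exact/measurable_EFinP.
rewrite (ae_eq_integral (abse \o (EFin \o f)))//.
- by apply: measurableT_comp => //; exact/measurable_EFinP.
- exact: measurableT_comp.
- by apply: filterS fg => x h Dx /=; rewrite h.
Qed.

(** * Fubini's theorem for real-valued integrals *)

Section Rfubini.
Context d1 d2 (T1 : measurableType d1) (T2 : measurableType d2) (R : realType).
Variables (m1 : {sigma_finite_measure set T1 -> \bar R}).
Variables (m2 : {sigma_finite_measure set T2 -> \bar R}).
Variable f : T1 * T2 -> R.
Hypothesis fi : (m1 \x m2)%E.-integrable setT (EFin \o f).

Lemma Rfubini_ae : {ae m1, forall x, m2.-integrable setT (EFin \o (fun y => f (x, y)))}.
Proof. exact: (ae_integrable1 fi). Qed.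

Lemma Rfubini_integrable : m1.-integrable setT (EFin \o (fun x => \int[m2]_y f (x, y))).
Proof.
apply: (@le_integrable _ _ _ m1 setT measurableT _ (fubini_F m2 (EFin \o f))).
- apply/measurable_EFinP; apply: measurableT_comp; first exact: fine_measurable.
  exact: measurable_fubini_F fi.
- move=> x _ /=; rewrite /Rintegral /fubini_F.
  (* [fine] sends infinite values to 0, so the domination holds on bad slices as well. *)
  by case: (integral _ _ _) => [r| |] //=; rewrite ?normr0 ?leey.
- exact: integrable_fubini_F.
Qed.

(** The real inner integral agrees with the extended one on integrable slices, that is, on almost
    all of them. *)
Lemma Rfubini : \int[(m1 \x m2)%E]_z f z = \int[m1]_x \int[m2]_y f (x, y).
Proof.
congr fine; rewrite -(integral12_prod_meas1 fi); apply: ae_eq_integral => //.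
- exact: measurable_fubini_F fi.
- exact: (measurable_int _ Rfubini_integrable).
- apply: filterS Rfubini_ae => x ix _; rewrite /Rintegral /fubini_F fineK//.
  exact: integrable_fin_num ix.
Qed.

End Rfubini.

Lemma ae_eq_Rintegral d (T : measurableType d) (R : realType) (mu : {measure set T -> \bar R})
    (D : set T) (f g : T -> R) : measurable D -> measurable_fun D f -> measurable_fun D g ->
  {ae mu, forall x, D x -> f x = g x} -> \int[mu]_(x in D) f x = \int[mu]_(x in D) g x.
Proof.
move=> mD mf mg fg; congr fine; apply: ae_eq_integral => //; [exact/measurable_EFinP..|].
by apply: filterS fg => x h Dx; rewrite h.
Qed.

(** * The thin domain and averaging over slices *)

(** Everything is asked on the open interval, where [a] is positive. The bound [M] is chosen before
    [e], which is what makes the final constant uniform in [e]. *)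
Record thin_profile (R : realType) (a a' : R -> R) (M e : R) : Prop := ThinProfile {
  prof_M_gt0 : 0 < M;
  prof_derive : forall x : R, 0 < x < 1 -> is_derive x 1 a (a' x);
  prof_continuous : forall x : R, 0 < x < 1 -> {for x, continuous a'};
  prof_derive_le : forall x : R, 0 < x < 1 -> `|a' x| <= M;
  prof_le : forall x : R, 0 < x < 1 -> `|a x| <= M;
  prof_gt0 : forall x : R, 0 < x < 1 -> 0 < a x;
  prof_e_gt0 : 0 < e }.

Section thin_domain.
Context (R : realType) (n : nat) (a a' : R -> R) (M e : R).
Hypothesis (H : thin_profile a a' M e).
Let M_gt0 := prof_M_gt0 H.
Let a_derive := prof_derive H.
Let a'_continuous := prof_continuous H.
Let a_le := prof_le H.
Let a_gt0 := prof_gt0 H.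
Let e_gt0 := prof_e_gt0 H.
Local Notation V := (R * 'rV[R]_n)%type.
Local Notation mV := (measurableTypeR R * 'rV[R]_n)%type.
Local Notation mu := (@lebesgue_xy R n).
Local Notation leb := (@lebesgue_measure R).
Local Notation L := (lebesgue_rV R n).
Local Notation I01 := (`]0%R, 1%R[%classic : set R).
Local Notation D := (@thin R n a e).
Local Notation B x := (@eball R n (e * a x)).

Lemma I01P (x : R) : I01 x <-> 0 < x < 1.
Proof. by rewrite /= in_itv. Qed.

Lemma a_continuous (x : R) : 0 < x < 1 -> {for x, continuous a}.
Proof.
by move=> /a_derive[d _]; apply: differentiable_continuous; exact/derivable1_diffP.
Qed.

Lemma measurable_a : measurable_fun I01 a.
Proof.
apply: open_continuous_measurable_fun; first exact: interval_open.
by move=> x /set_mem/I01P; exact: a_continuous.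
Qed.

Lemma ea_gt0 (x : R) : 0 < x < 1 -> 0 < e * a x.
Proof. by move=> /a_gt0; exact: mulr_gt0. Qed.

Lemma open_lt_on (U : set V) (g : V -> R) : open U -> {in U, continuous g} ->
  open [set z | U z /\ 0 < g z].
Proof.
move=> oU cg; rewrite openE => z [Uz gz].
apply: filterI; first exact: open_nbhs_nbhs.
have := cg z (mem_set Uz); move/cvgr_gt; apply => //.
Qed.

Lemma open_strip : open [set z : V | 0 < z.1 < 1].
Proof.
rewrite (_ : mkset _ = fst @^-1` I01); last by apply/seteqP; split => z /I01P.
by apply: open_comp => [z _|]; [exact: cvg_fst|exact: interval_open].
Qed.

Lemma thin_open : open D.
Proof.
rewrite (_ : D = [set z : V | [set z : V | 0 < z.1 < 1] z /\ 0 < e * a z.1 - enorm z.2]); last first.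
  by apply/seteqP; split => z [h1]; rewrite /eball/= subr_gt0.
apply: open_lt_on; first exact: open_strip.
move=> z /set_mem/= z01; apply: cvgB.
  apply: cvgM; first exact: cvg_cst.
  by apply: (@continuous_comp _ _ _ fst a); [exact: cvg_fst|exact: a_continuous].
by apply: (@continuous_comp _ _ _ snd (@enorm R 1 n)); [exact: cvg_snd|exact: enorm_continuous].
Qed.

Lemma thin_measurable : measurable (D : set mV).
Proof. by apply: open_measurable_xy; exact: thin_open. Qed.

Lemma thin_le z : D z -> `|z| <= 1 + e * M.
Proof.
move=> [z01 hz]; have ea : e * a z.1 <= e * M.
  by rewrite ler_wpM2l ?(ltW e_gt0)// (le_trans (ler_norm _)) ?a_le.
have eM : 0 < e * M by rewrite mulr_gt0.
apply: xy_norm_le; first by rewrite addr_ge0 ?ltW.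
  by have /andP[h1 h2] := z01; rewrite ger0_norm ?ltW// (lt_le_trans h2)// lerDl ltW.
move=> j; rewrite (le_trans (ler_enorm _ _ _))// (le_trans (ltW hz))//.
by rewrite (le_trans ea)// lerDr.
Qed.

Lemma thin_fin : (mu D < +oo)%E.
Proof.
have r0 : 0 < 1 + e * M + 1 by rewrite !addr_gt0 ?mulr_gt0.
apply: (@le_lt_trans _ _ (mu [set z : V | `|z| < 1 + e * M + 1])).
  apply: le_measure; rewrite ?inE; [exact: thin_measurable|exact: measurable_ball_xy|].
  by move=> z /thin_le h; rewrite /= (le_lt_trans h)// ltrDl.
by rewrite lebesgue_xy_ball// ltry.
Qed.

(** Stated for pointed types to serve both real and extended real integrands: patching on the domain
    is patching on each slice. *)
Lemma thin_patch (T : pointedType) (F : V -> T) x y :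
  (F \_ D) (x, y) = if x \in I01 then ((fun y => F (x, y)) \_ (B x)) y else point.
Proof.
rewrite !patchE; have [xI|xI] := boolP (x \in I01).
  have x01 : 0 < x < 1 by apply/I01P/set_mem.
  case: ifPn => [/set_mem[_ hy]|hn]; first by rewrite mem_set.
  by rewrite memNset// => hy; move: hn; rewrite mem_set.
rewrite memNset// => -[/= /I01P x01 _]; move: xI; rewrite mem_set//.
Qed.

Lemma thin_Tonelli (F : V -> \bar R) : measurable_fun (D : set mV) F ->
  (forall z, D z -> (0 <= F z)%E) ->
  (\int[mu]_(z in D) F z = \int[leb]_(x in I01) \int[L]_(y in B x) F (x, y))%E.
Proof.
move=> mF F0; rewrite integral_mkcond fubini_tonelli1; last 2 first.
- by apply/(measurable_restrictT _ thin_measurable).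
- move=> z; rewrite patchE; case: ifPn => // /set_mem; exact: F0.
rewrite [RHS]integral_mkcond; apply: eq_integral => x _; rewrite patchE.
rewrite /fubini_F; case: ifPn => xI; last first.
  by apply: integral0_eq => y _; rewrite thin_patch (negbTE xI).
rewrite [RHS]integral_mkcond; apply: eq_integral => y _.
by rewrite thin_patch xI.
Qed.

Section thin_Fubini.
Variable F : V -> R.
Hypothesis iF : mu.-integrable D (EFin \o F).

Let iF0 : mu.-integrable setT (EFin \o (F \_ D)).
Proof. by rewrite -restrict_EFin; apply/(integrable_mkcond _ thin_measurable).1. Qed.

Let sliceE x : \int[L]_y (F \_ D) (x, y) =
  ((fun x => \int[L]_(y in B x) F (x, y)) \_ I01) x.
Proof.
rewrite patchE; case: ifPn => xI.
  rewrite [RHS]Rintegral_mkcond; apply: eq_Rintegral => y _.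
  by rewrite thin_patch xI.
rewrite (_ : (fun y => _) = cst 0); first by rewrite Rintegral_cst// mul0r.
by apply/funext => y; rewrite thin_patch (negbTE xI).
Qed.

Lemma thin_Fubini_integrable :
  leb.-integrable I01 (EFin \o (fun x => \int[L]_(y in B x) F (x, y))).
Proof.
apply/integrable_mkcond => //; rewrite restrict_EFin.
have := Rfubini_integrable iF0; congr (_.-integrable _ _).
by apply/funext => x; rewrite /= sliceE.
Qed.

Lemma thin_Fubini : \int[mu]_(z in D) F z =
  \int[leb]_(x in I01) \int[L]_(y in B x) F (x, y).
Proof.
rewrite Rintegral_mkcond (Rfubini iF0) [RHS]Rintegral_mkcond.
by apply: eq_Rintegral => x _; rewrite sliceE.
Qed.

Lemma thin_Fubini_ae : {ae leb, forall x, I01 x ->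
  L.-integrable (B x) (EFin \o (fun y => F (x, y)))}.
Proof.
apply: filterS (Rfubini_ae iF0) => x h xI.
apply/integrable_mkcond; first exact: measurable_eball.
rewrite restrict_EFin; move: h; congr (_.-integrable _ _).
by apply/funext => y /=; rewrite thin_patch mem_set.
Qed.

End thin_Fubini.

Lemma measurable_fst_D (h : R -> R) : measurable_fun I01 h ->
  measurable_fun (D : set mV) (fun z : V => h z.1).
Proof.
move=> mh; apply: (@measurable_comp _ _ _ _ _ _ I01 h _ (fun z : mV => z.1)) => //.
  by move=> _ [z [/I01P z01 _] <-].
exact: measurable_funS measurable_fst.
Qed.

Lemma measurable_section_D (F : V -> R) x : I01 x -> measurable_fun (D : set mV) F ->
  measurable_fun (B x) (fun y => F (x, y)).
Proof.
move=> /I01P x01 mF.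
apply: (@measurable_comp _ _ _ _ _ _ (D : set mV) F _ (fun y : 'rV[R]_n => ((x : measurableTypeR R), y))) => //.
- exact: thin_measurable.
- by move=> _ [y By <-].
- apply: measurable_funS (@pair1_measurable _ _ _ _ (x : measurableTypeR R)) => //.
Qed.

Lemma lebesgue_slice x : 0 < x < 1 -> L (B x) = ((e * a x) ^+ n * vol_ball R n)%:E.
Proof. by move=> x01; rewrite lebesgue_eball// ea_gt0. Qed.

(** Integrating out y produces the slice volume: this is where the weight a^n of the limit spaces
    comes from. *)
Lemma thin_E_Tonelli (h : R -> R) : measurable_fun I01 h -> (forall x, I01 x -> 0 <= h x) ->
  (\int[mu]_(z in D) (h z.1)%:E = \int[leb]_(x in I01) (h x * ((e * a x) ^+ n * vol_ball R n))%:E)%E.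
Proof.
move=> mh h0; rewrite thin_Tonelli; last 2 first.
- by apply/measurable_EFinP; exact: measurable_fst_D.
- by move=> z [/I01P z01 _]; rewrite lee_fin h0.
apply: eq_integral => x /set_mem/I01P x01; rewrite /= integral_cst; last exact: measurable_eball.
by rewrite EFinM; congr (_ * _)%E; exact: lebesgue_slice.
Qed.

Lemma thin_E_integrable (h : R -> R) : measurable_fun I01 h ->
  leb.-integrable I01 (EFin \o (fun x => a x ^+ n * h x)) ->
  mu.-integrable D (EFin \o (fun z => h z.1)).
Proof.
move=> mh ih; apply/integrableP; split.
  by apply/measurable_EFinP; exact: measurable_fst_D.
rewrite (thin_E_Tonelli (h := fun x => `|h x|)) //; last exact: measurableT_comp.
rewrite (eq_integral (fun x : measurableTypeR R => ((e ^+ n * vol_ball R n)%:E * `|(a x ^+ n * h x)%:E|)%E)); last first.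
  move=> x /set_mem/I01P x01; rewrite -EFinM; congr EFin.
  by rewrite normrM (ger0_norm (exprn_ge0 _ _)) ?(ltW (a_gt0 _))// exprMn; ring.
rewrite ge0_integralZl//.
- have /integrableP[_ ioo] := ih; rewrite lte_mul_pinfty// lee_fin.
  by rewrite mulr_ge0 ?exprn_ge0 ?ltW ?vol_ball_gt0.
- by apply: measurableT_comp => //; exact: (measurable_int _ ih).
- by rewrite lee_fin mulr_ge0 ?exprn_ge0 ?ltW ?vol_ball_gt0.
Qed.

Lemma L2a_sqint (u : R -> R) : L2a n a u -> sqint mu D (E_ext u).
Proof.
move=> [mu_ iu]; split; first exact: measurable_fst_D.
apply: (@thin_E_integrable (fun x => u x ^+ 2)); first exact: measurable_funX.
apply/integrableP; split.
  apply/measurable_EFinP; apply: measurable_funM; last exact: measurable_funX.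
  by apply: measurable_funX; exact: measurable_a.
move: iu; congr (_ < _)%E; apply: eq_integral => x /set_mem/I01P x01 /=.
by rewrite ger0_norm// mulr_ge0 ?sqr_ge0// exprn_ge0// ltW// a_gt0.
Qed.

Lemma sqint_L2a (u : R -> R) : measurable_fun I01 u -> sqint mu D (E_ext u) -> L2a n a u.
Proof.
move=> mu_ [_ iu]; split => //.
have /integrableP[_] := iu.
rewrite (_ : integral _ _ _ = (\int[mu]_(z in D) (u z.1 ^+ 2)%:E)%E); last first.
  by apply: eq_integral => z _ /=; rewrite ger0_norm// sqr_ge0.
rewrite (thin_E_Tonelli (h := fun x => u x ^+ 2)); last 2 first.
- exact: measurable_funX.
- by move=> x _; exact: sqr_ge0.
have c0 : 0 < e ^+ n * vol_ball R n by rewrite mulr_gt0 ?exprn_gt0 ?vol_ball_gt0.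
rewrite (eq_integral (fun x : measurableTypeR R => ((e ^+ n * vol_ball R n)%:E * (a x ^+ n * u x ^+ 2)%:E)%E)); last first.
  by move=> x _; rewrite -EFinM; congr EFin; rewrite exprMn; ring.
rewrite ge0_integralZl//; last 3 first.
- apply/measurable_EFinP; apply: measurable_funM; last exact: measurable_funX.
  by apply: measurable_funX; exact: measurable_a.
- by move=> x /I01P x01; rewrite lee_fin mulr_ge0 ?sqr_ge0// exprn_ge0// ltW// a_gt0.
- by rewrite lee_fin ltW.
by case: (integral _ _ _) => [r| |]//; rewrite ?ltry// gt0_muley ?lte_fin.
Qed.

Lemma sqint_slice (u : V -> R) : sqint mu D u ->
  {ae leb, forall x, I01 x -> sqint L (B x) (fun y => u (x, y))}.
Proof.
move=> [mu_ iu]; apply: (ae_imp _ (thin_Fubini_ae iu)) => x h xI.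
by split; [exact: measurable_section_D|exact: h].
Qed.

Lemma measurable_M_avg (u : V -> R) : sqint mu D u -> measurable_fun I01 (M_avg a e u).
Proof.
move=> su; apply: measurable_funM; last first.
  have iu := sqint_integrable thin_measurable thin_fin su.
  apply/measurable_EFinP; exact: (measurable_int _ (thin_Fubini_integrable iu)).
have c_gt0 x : I01 x -> 0 < e ^+ n * a x ^+ n * vol_ball R n.
  by move=> /I01P x01; rewrite !mulr_gt0 ?exprn_gt0 ?a_gt0 ?vol_ball_gt0.
have mc : measurable_fun I01 (fun x => e ^+ n * a x ^+ n * vol_ball R n).
  apply: measurable_funM => //; apply: measurable_funM => //; apply: measurable_funX.
  exact: measurable_a.
apply: (@measurable_comp _ _ _ _ _ _ [set x : measurableTypeR R | 0 < x] (fun x : measurableTypeR R => x^-1 : measurableTypeR R)) => //.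
- apply: open_measurable; exact: open_gt.
- by move=> _ [x xI <-]; exact: c_gt0.
- apply: open_continuous_measurable_fun; first exact: open_gt.
  by move=> x /set_mem/= x0; apply: inv_continuous; rewrite gt_eqF.
Qed.

Lemma slice_volume_neq0 x : 0 < x < 1 -> e ^+ n * a x ^+ n * vol_ball R n != 0.
Proof. by move=> x01; rewrite gt_eqF// !mulr_gt0 ?exprn_gt0 ?a_gt0 ?vol_ball_gt0. Qed.

Lemma M_avgK (u : V -> R) x : 0 < x < 1 ->
  \int[L]_(y in B x) u (x, y) = e ^+ n * vol_ball R n * (a x ^+ n * M_avg a e u x).
Proof.
move=> x01; rewrite /M_avg.
rewrite (_ : _ * (_ * _) = (e ^+ n * a x ^+ n * vol_ball R n) * (e ^+ n * a x ^+ n * vol_ball R n)^-1 * \int[L]_(y in B x) u (x, y)); last by ring.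
by rewrite mulfV ?mul1r// slice_volume_neq0.
Qed.

Lemma sqint_E_mul (u : V -> R) (psi : R -> R) : sqint mu D u -> L2a n a psi ->
  mu.-integrable D (EFin \o (fun z => u z * psi z.1)).
Proof. by move=> su /L2a_sqint sp; exact: (sqint_mul thin_measurable su sp). Qed.

(** Averaging is the adjoint of extension up to the constant e^n |B_1|. This moves identities
    between the weighted interval and the thin domain. *)
Lemma M_avg_adjoint (u : V -> R) (psi : R -> R) : sqint mu D u -> L2a n a psi ->
  leb.-integrable I01 (EFin \o (fun x => a x ^+ n * M_avg a e u x * psi x)) /\
  \int[mu]_(z in D) (u z * psi z.1) =
  e ^+ n * vol_ball R n * \int[leb]_(x in I01) (a x ^+ n * M_avg a e u x * psi x).
Proof.
move=> su sp; have iup := sqint_E_mul su sp.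
have iu := sqint_integrable thin_measurable thin_fin su.
pose c := e ^+ n * vol_ball R n.
have c0 : c != 0 by rewrite gt_eqF// mulr_gt0 ?exprn_gt0 ?vol_ball_gt0.
have mg : measurable_fun I01 (fun x => a x ^+ n * M_avg a e u x * psi x).
  apply: measurable_funM; last by have [] := sp.
  apply: measurable_funM; last exact: measurable_M_avg.
  by apply: measurable_funX; exact: measurable_a.
have E : {ae leb, forall x, I01 x ->
    \int[L]_(y in B x) (u (x, y) * psi x) = c * (a x ^+ n * M_avg a e u x * psi x)}.
  apply: (ae_imp _ (thin_Fubini_ae iu)) => x h /[dup] /h ix /I01P x01.
  rewrite RintegralZr//; last exact: measurable_eball.
  by rewrite M_avgK// !mulrA.
have i1 := thin_Fubini_integrable iup.
have i2 : leb.-integrable I01 (EFin \o (fun x => c * (a x ^+ n * M_avg a e u x * psi x))).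
  apply: integrable_ae_eq E i1 => //; exact: measurable_funM.
have i3 : leb.-integrable I01 (EFin \o (fun x => a x ^+ n * M_avg a e u x * psi x)).
  rewrite (_ : EFin \o _ = (fun x => (c^-1)%:E * (c * (a x ^+ n * M_avg a e u x * psi x))%:E)%E); last first.
    by apply/funext => x /=; rewrite -EFinM mulKf.
  by apply: (integrableZl _ _ i2).
split => //.
rewrite (thin_Fubini iup) -RintegralZl//; apply: ae_eq_Rintegral => //.
- by apply/measurable_EFinP; exact: (measurable_int _ i1).
- exact: measurable_funM.
Qed.

(** Cauchy-Schwarz against the constant 1 on almost every slice: the square of a mean is at most the
    mean of the squares. *)
Lemma M_avg_le (u : V -> R) : sqint mu D u ->
  sqint mu D (E_ext (M_avg a e u)) /\
  \int[mu]_(z in D) E_ext (M_avg a e u) z ^+ 2 <= \int[mu]_(z in D) u z ^+ 2.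
Proof.
move=> su; have mM := measurable_M_avg su.
have key : (\int[mu]_(z in D) (E_ext (M_avg a e u) z ^+ 2)%:E <= \int[mu]_(z in D) (u z ^+ 2)%:E)%E.
  rewrite (thin_E_Tonelli (h := fun x => M_avg a e u x ^+ 2)); last 2 first.
  - exact: measurable_funX.
  - by move=> x _; exact: sqr_ge0.
  rewrite thin_Tonelli; last 2 first.
  - by apply/measurable_EFinP; apply: measurable_funX; case: su.
  - by move=> z _; rewrite lee_fin sqr_ge0.
  apply: ae_ge0_le_integral => //.
  - move=> x /I01P x01; rewrite lee_fin mulr_ge0 ?sqr_ge0// mulr_ge0 ?exprn_ge0 ?ltW ?vol_ball_gt0//.
    exact: ea_gt0.
  - apply/measurable_EFinP; apply: measurable_funM; first exact: measurable_funX.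
    apply: measurable_funM => //; apply: measurable_funX; apply: measurable_funM => //.
    exact: measurable_a.
  - by move=> x _; apply: integral_ge0 => y _; rewrite lee_fin sqr_ge0.
  - have iu2 : mu.-integrable D (EFin \o (fun z => u z ^+ 2)) by case: su.
    have mT : measurable_fun setT (fubini_F L ((fun z : V => (u z ^+ 2)%:E) \_ D)).
      apply: (@measurable_fun_fubini_tonelli_F _ _ _ _ _ L ((fun z : V => (u z ^+ 2)%:E) \_ D)).
        by apply/(measurable_restrictT _ thin_measurable); exact: (measurable_int _ iu2).
      by move=> z; rewrite patchE; case: ifPn => // _; rewrite lee_fin sqr_ge0.
    apply: eq_measurable_fun (measurable_funS measurableT (@subsetT _ _) mT) => x xI.
    rewrite /fubini_F [RHS]integral_mkcond; apply: eq_integral => y _.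
    by rewrite thin_patch xI.
  - apply: (ae_imp _ (sqint_slice su)) => x h /[dup] /h sx /I01P x01.
    have mB := @measurable_eball R n (e * a x).
    have fB : (L (B x) < +oo)%E by exact: lebesgue_eball_fin.
    have s1 : sqint L (B x) (cst 1).
      split; first exact: measurable_cst.
      under eq_fun do rewrite expr1n; apply/integrableP; split; first exact: measurable_cst.
      by under eq_integral do rewrite /= normr1; rewrite integral_cst// mul1e.
    have := sqint_CauchySchwarz mB sx s1.
    under eq_Rintegral do rewrite mulr1.
    under [X in _ <= _ * X]eq_Rintegral do rewrite expr1n.
    have [_ isx] := sx.
    rewrite (M_avgK u x01) Rintegral_cst// mul1r.
    rewrite [X in _ <= _ * X -> _](_ : _ = (e * a x) ^+ n * vol_ball R n); last exact: (congr1 fine (lebesgue_slice x01)).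
    move=> hCS.
    rewrite -[leRHS]fineK; last exact: integrable_fin_num isx.
    rewrite lee_fin -/(Rintegral L (B x) (fun y => u (x, y) ^+ 2)).
    have c0 : 0 < (e * a x) ^+ n * vol_ball R n by rewrite mulr_gt0 ?exprn_gt0 ?vol_ball_gt0 ?ea_gt0.
    rewrite -(ler_pM2r c0); apply: le_trans hCS.
    have -> : (e * a x) ^+ n = e ^+ n * a x ^+ n by exact: exprMn.
    by rewrite le_eqVlt; apply/orP; left; apply/eqP; ring.
have [mu_ iu2] := su.
have iM : mu.-integrable D (EFin \o (fun z => E_ext (M_avg a e u) z ^+ 2)).
  apply/integrableP; split.
    by apply/measurable_EFinP; apply: measurable_funX; exact: measurable_fst_D.
  under eq_integral do rewrite /= ger0_norm ?sqr_ge0//.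
  apply: le_lt_trans key _; have /integrableP[_] := iu2.
  by under eq_integral do rewrite /= ger0_norm ?sqr_ge0//.
split; first by split => //; exact: measurable_fst_D.
apply: fine_le => //.
  by have := integrable_fin_num thin_measurable iM.
by have := integrable_fin_num thin_measurable iu2.
Qed.

Lemma M_avg_L2a (u : V -> R) : sqint mu D u -> L2a n a (M_avg a e u).
Proof. by move=> su; apply: sqint_L2a; [exact: measurable_M_avg|have [] := M_avg_le su]. Qed.

End thin_domain.

Lemma integrable_indic_lty d (T : measurableType d) (R : realType)
    (mu : {measure set T -> \bar R}) (A : set T) : measurable A -> (mu A < +oo)%E ->
  mu.-integrable setT (fun x => (\1_A x)%:E).
Proof.
move=> mA Aoo; apply/integrableP; split; first exact/measurable_EFinP.
under eq_integral do rewrite gee0_abs ?lee_fin//.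
by rewrite integral_indic// setIT.
Qed.

Lemma derive_supp (R : realType) (V : normedModType R) (phi : V -> R) (v z : V) : 'D_v phi z != 0 -> closure [set z | phi z != 0] z.
Proof.
move=> dz; apply: contrapT => nz; move/eqP: dz; apply.
have oc : open (~` closure [set z | phi z != 0]) by apply: closed_openC; exact: closed_closure.
rewrite (near_eq_derive (g := fun=> 0)) ?derive_cst//.
have := open_nbhs_nbhs (conj oc nz); apply: (@filterS _ (nbhs z)) => w /= nw.
by apply/eqP; apply: contrapT => /negP hw; apply: nw; exact: subset_closure.
Qed.

(** * Integrals of smooth functions over y *)

Section marginal.
Context (R : realType) (n : nat).
Local Notation V := (R * 'rV[R]_n)%type.
Local Notation mV := (measurableTypeR R * 'rV[R]_n)%type.
Local Notation mu := (@lebesgue_xy R n).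
Local Notation L := (lebesgue_rV R n).

Lemma Rintegral_shift_rV (f : 'rV[R]_n -> R) (v : 'rV[R]_n) : measurable_fun setT f ->
  \int[L]_y f (y + v) = \int[L]_y f y.
Proof.
move=> mf; congr fine.
have := @integral_comp_preserving _ _ _ L (fun y : 'rV[R]_n => 1 *: y + v) 1 ltr01
  (measurable_rV_affine 1 v) _ (EFin \o f) (measurableT_comp (@EFin_measurable _ setT) mf).
rewrite mule1 => <-.
  by apply: eq_integral => y _; rewrite /= scale1r.
by move=> A mA; rewrite -[RHS](lebesgue_rV_affine v ltr01 mA) expr1n.
Qed.

Lemma measurable_slice (phi : V -> R) x : continuous phi ->
  measurable_fun setT (fun y : 'rV[R]_n => phi (x, y)).
Proof.
move=> cphi; apply: (measurableT_comp (continuous_measurable_xy cphi)).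
exact: (@pair1_measurable _ _ _ _ (x : measurableTypeR R)).
Qed.

(** A majorant independent of [x], as continuity and differentiation under the integral over y
    require. *)
Lemma slice_bound (phi : V -> R) : continuous phi -> bsupp phi ->
  exists (r C : R), [/\ 0 < r, 0 <= C & forall x y, `|phi (x, y)| <= C * \1_(@cube_rV R n r) y].
Proof.
move=> cphi bphi; have [C hC] := Cc_bounded cphi bphi; have [r hr] := bphi.
exists (`|r| + 1), C; split.
- by rewrite ltr_wpDl.
- exact: le_trans (hC 0).
move=> x y; rewrite indicE; have [yr|yr] := boolP (y \in _); [|rewrite mulr0].
  by rewrite mulr1.
rewrite hr ?normr0//; move: yr; rewrite ltNge; apply: contra => xyr; rewrite inE => j.
by rewrite (le_lt_trans (xy_norm2 (x, y) j))// (le_lt_trans xyr)// ltr_pwDr// ler_norm.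
Qed.

Lemma cube_fin (r : R) : 0 < r -> (L (@cube_rV R n r) < +oo)%E.
Proof. by move=> r0; rewrite (@lebesgue_rV_cube R n r r0) ltry. Qed.

Lemma cube_integrable (r C : R) : 0 < r ->
  L.-integrable setT (EFin \o (fun y => C * \1_(@cube_rV R n r) y)).
Proof.
move=> r0; rewrite /comp; under eq_fun do rewrite EFinM; apply: integrableZl => //.
apply: integrable_indic_lty => //; first exact: measurable_cube_rV.
exact: cube_fin.
Qed.

Lemma slice_integrable (phi : V -> R) x : continuous phi -> bsupp phi ->
  L.-integrable setT (EFin \o (fun y => phi (x, y))).
Proof.
move=> cphi bphi; have [r [C [r0 C0 h]]] := slice_bound cphi bphi.
apply: le_integrable (cube_integrable C r0) => //.
- by apply/measurable_EFinP; exact: measurable_slice.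
- by move=> y _ /=; rewrite lee_fin (le_trans (h x y))// ler_norm.
Qed.

(** Pairing an extended function of x with [phi] on the thin domain is pairing the function itself
    with [marg phi] on (0, 1). *)
Definition marg (phi : V -> R) (x : R) : R := \int[L]_y phi (x, y).

Lemma marg_continuous (phi : V -> R) : continuous phi -> bsupp phi -> continuous (marg phi).
Proof.
move=> cphi bphi x; apply/cvgrPdist_le => e e0.
have [r [C [r0 C0 h]]] := slice_bound cphi bphi.
pose N := fine (L (@cube_rV R n r)).
have N0 : 0 < N by rewrite /N lebesgue_rV_cube//= exprn_gt0// mulr_gt0.
have [d d0 hd] := Cc_unif cphi bphi (divr_gt0 e0 N0).
apply: (@filterS _ (nbhs x) _ (ball x d)); last exact: nbhsx_ballx.
move=> x'; rewrite -ball_normE/= => xx'.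
rewrite /marg -RintegralB//; [|exact: slice_integrable..].
have ib : L.-integrable setT (EFin \o (fun y => phi (x, y) - phi (x', y))).
  by rewrite /comp; under eq_fun do rewrite EFinB; apply: integrableB => //; exact: slice_integrable.
apply: le_trans (le_normr_Rintegral _ ib) _ => //.
have iC := cube_integrable (e / N) r0.
apply: (@le_trans _ _ (\int[L]_y (e / N * \1_(@cube_rV R n r) y))).
  apply: le_Rintegral => //; first exact: integrable_norm.
  move=> y _; rewrite indicE; have [yr|yr] := boolP (y \in _).
    rewrite mulr1 ltW// hd//; apply: le_lt_trans xx'; apply: xy_norm_le => //= j.
    by rewrite subrr mxE normr0.
  have h0 x1 : phi (x1, y) = 0.
    apply/eqP; rewrite -normr_le0 (le_trans (h x1 y))// indicE (negbTE yr) mulr0//.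
  by rewrite !h0 subrr normr0 mulr0.
rewrite RintegralZl//; last first.
  apply: integrable_indic_lty => //; first exact: measurable_cube_rV.
  exact: cube_fin.
rewrite (_ : \int[L]_x _ = N); last first.
  by rewrite /Rintegral integral_indic// ?setIT//; exact: measurable_cube_rV.
by rewrite divfK// gt_eqF.
Qed.

Lemma marg_derive (phi : V -> R) (x w : R) : Cc_smooth phi ->
  is_derive x w (marg phi) (marg ('D_((w, 0) : V) phi) x).
Proof.
move=> sphi; pose v : V := (w, 0).
have sdphi := Cc_smooth_derive v sphi.
have [r [C [r0 C0 h]]] := slice_bound (Cc_smooth_continuous sdphi) sdphi.2.
have dF (y : 'rV[R]_n) (x' : R) : is_derive x' w (fun x => phi (x, y)) ('D_v phi (x', y)).
  apply/is_derive_line.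
  have /is_derive_line : is_derive (x', y) v phi ('D_v phi (x', y)).
    by apply: DeriveDef => //; exact: smooth_derivable sphi.1.
  congr is_derive; apply/funext => t; congr phi.
  by rewrite /v; congr pair; rewrite /= scaler0 addr0.
have -> : marg ('D_v phi) x = \int[L]_y 'D_w (fun x => phi (x, y)) x.
  by apply: eq_Rintegral => y _; have [_ ->] := dF y x.
apply: (@is_derive_integral _ _ _ L R setT (fun x y => phi (x, y)) (fun y => C * \1_(@cube_rV R n r) y)) => //.
- by move=> t _; apply: slice_integrable; [exact: Cc_smooth_continuous|exact: sphi.2].
- exact: cube_integrable.
- by move=> y; rewrite mulr_ge0.
- by move=> t y _ _; have [_ ->] := dF y (x + t *: w).
Qed.

Lemma marg_smooth (phi : V -> R) : Cc_smooth phi -> smooth_on setT (marg phi).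
Proof.
move=> sphi; apply: (@smooth_class_smooth _ _ [set g | exists2 f, Cc_smooth f & g = marg f]); last by exists phi.
move=> _ [f sf ->]; split.
  by apply: marg_continuous; [exact: Cc_smooth_continuous|exact: sf.2].
move=> w; split; first by move=> x; have [] := marg_derive x w sf.
exists ('D_((w, 0) : V) f); first exact: Cc_smooth_derive.
by apply/funext => x; have [_ ->] := marg_derive x w sf.
Qed.

(** The integral of phi (x, y + t v) over all y does not depend on t; its derivative at t = 0 is the
    claimed integral. *)
Lemma marg_derive_y (phi : V -> R) (x : R) (v : 'rV[R]_n) : Cc_smooth phi ->
  marg ('D_((0, v) : V) phi) x = 0.
Proof.
move=> sphi; pose v' : V := (0, v).
have cphi := Cc_smooth_continuous sphi.
have sdphi := Cc_smooth_derive v' sphi.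
have [r [C [r0 C0 h]]] := slice_bound (Cc_smooth_continuous sdphi) sdphi.2.
have dF (y : 'rV[R]_n) (t : R) : is_derive t (1 : R) (fun t => phi (x, y + t *: v)) ('D_v' phi (x, y + t *: v)).
  have := @derive_line _ _ phi (x, y) v' t ltac:(by apply: smooth_derivable; exact: sphi.1).
  have E s : (x, y) + s *: v' = (x, y + s *: v) by rewrite /v'; congr pair; rewrite /= scaler0 addr0.
  by rewrite E; congr is_derive; apply/funext => s; rewrite E.
have d1 : is_derive (0 : R) (1 : R) (fun t => \int[L]_y phi (x, y + t *: v)) (marg ('D_v' phi) x).
  have -> : marg ('D_v' phi) x = \int[L]_y 'D_(1 : R) (fun t : R => phi (x, y + t *: v)) 0.
    by apply: eq_Rintegral => y _; have [_ ->] := dF y 0; rewrite scale0r addr0.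
  (* For |t| < 1 the translates stay supported in the cube enlarged by the norm of [v]. *)
  apply: (@is_derive_integral _ _ _ L R setT (fun (t : R) y => phi (x, y + t *: v)) (fun y => C * \1_(@cube_rV R n (r + `|((0, v) : V)|)) y)) => //.
  - move=> t _.
    have [r' [C' [r'0 C'0 h']]] := slice_bound cphi sphi.2.
    apply: (@le_integrable _ _ _ L setT measurableT _ (EFin \o (fun y => C' * \1_(@cube_rV R n (r' + `|0 + t *: (1 : R)| * `|((0, v) : V)|)) y))).
    + apply/measurable_EFinP; apply: (measurableT_comp (measurable_slice x cphi)).
      have := measurable_rV_affine 1 ((0 + t *: (1 : R)) *: v); congr measurable_fun.
      by apply/funext => y; rewrite scale1r.
    + move=> y _; rewrite /= lee_fin (le_trans (h' _ _))// [leRHS]ger0_norm ?mulr_ge0// ler_wpM2l//.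
      rewrite !indicE ler_nat; have [hy|//] := boolP (y + _ \in _).
      rewrite mem_set// => j; move: hy; rewrite inE => /(_ j); rewrite !mxE => hy.
      rewrite -[y ord0 j](addrK ((0 + t *: (1 : R)) * v ord0 j)) (le_lt_trans (ler_normB _ _))//.
      by rewrite ltr_leD// normrM ler_wpM2l//; exact: (xy_norm2 ((0, v) : V) j).
    + by apply: cube_integrable; rewrite ltr_pwDl// mulr_ge0.
  - by apply: cube_integrable; rewrite ltr_pwDl.
  - by move=> y; rewrite mulr_ge0.
  - move=> t y t1 _; have [_ ->] := dF y (0 + t *: (1 : R)).
    rewrite (le_trans (h _ _))// ler_wpM2l//.
    rewrite !indicE ler_nat; have [hy|//] := boolP (y + _ \in _).
    rewrite mem_set// => j; move: hy; rewrite inE => /(_ j); rewrite !mxE => hy.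
    rewrite -[y ord0 j](addrK ((0 + t *: (1 : R)) * v ord0 j)) (le_lt_trans (ler_normB _ _))//.
    rewrite ltr_leD// normrM (le_trans _ (xy_norm2 ((0, v) : V) j))// ler_piMl//.
    by rewrite add0r /GRing.scale/= mulr1 ltW.
have E : (fun t : R => \int[L]_y phi (x, y + t *: v)) = cst (marg phi x).
  by apply/funext => t; exact: (Rintegral_shift_rV (t *: v) (measurable_slice x cphi)).
rewrite E in d1; have [_ <-] := d1.
by rewrite derive_cst.
Qed.

End marginal.

(** * Extension of functions of one variable *)

Definition grad_x (R : realType) (n : nat) (du : R -> R) (z : R * 'rV[R]_n) : 'cV[R]_(1 + n) :=
  \col_i (if fintype.split i is inl _ then du z.1 else 0).

Section extension.
Context (R : realType) (n : nat) (a a' : R -> R) (M e : R).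
Hypothesis (H : thin_profile a a' M e).
Local Notation V := (R * 'rV[R]_n)%type.
Local Notation mV := (measurableTypeR R * 'rV[R]_n)%type.
Local Notation mu := (@lebesgue_xy R n).
Local Notation leb := (@lebesgue_measure R).
Local Notation L := (lebesgue_rV R n).
Local Notation I01 := (`]0%R, 1%R[%classic : set R).
Local Notation D := (@thin R n a e).
Local Notation B x := (@eball R n (e * a x)).

Lemma test_Cc_smooth (U : set V) (phi : V -> R) : test_function U phi -> Cc_smooth phi.
Proof. by move=> tphi; split; [case: tphi|exact: test_function_bsupp tphi]. Qed.

Lemma test_off (U : set V) (phi : V -> R) z : test_function U phi -> ~ U z -> phi z = 0.
Proof.
move=> [_ _ KU] nz; apply: contrapT => /eqP hz; apply: nz; apply: KU.
exact: subset_closure.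
Qed.

Lemma test_derive_off (U : set V) (phi : V -> R) v z : test_function U phi -> ~ U z -> 'D_v phi z = 0.
Proof.
move=> [_ _ KU] nz; apply: contrapT => /eqP hz; apply: nz; apply: KU.
exact: derive_supp hz.
Qed.

Lemma test_derive_continuous (U : set V) (phi : V -> R) v : test_function U phi ->
  continuous ('D_v phi).
Proof. by move=> /test_Cc_smooth/(Cc_smooth_derive v); exact: Cc_smooth_continuous. Qed.

Lemma test_derive_bounded (U : set V) (phi : V -> R) v : test_function U phi ->
  exists C : R, forall z, `|'D_v phi z| <= C.
Proof.
move=> /test_Cc_smooth/(Cc_smooth_derive v) sd.
by apply: Cc_bounded; [exact: Cc_smooth_continuous|exact: sd.2].
Qed.

(** The support lies in the projection of the support of [phi], which is compact and contained in
    (0, 1). *)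
Lemma test_marg (phi : V -> R) : test_function D phi -> test_function I01 (marg phi).
Proof.
move=> tphi; have [sphi cK KD] := tphi.
set K := closure _ in cK KD.
have cfK : compact (fst @` K).
  apply: continuous_compact => //; apply: continuous_subspaceT => z; exact: cvg_fst.
have clK : closed (fst @` K) by apply: compact_closed => //; exact: Rhausdorff.
have sub : closure [set x | marg phi x != 0] `<=` fst @` K.
  rewrite [X in _ `<=` X](closure_id _).1//; apply: closure_subset => x /= hx.
  apply: contrapT => nx; move/eqP: hx; apply.
  rewrite /marg (_ : (fun y => _) = cst 0) ?Rintegral_cst ?mul0r//.
  apply/funext => y /=; apply: contrapT => /eqP hy; apply: nx; exists (x, y) => //.
  exact: subset_closure.
split.
- by apply: marg_smooth; exact: test_Cc_smooth tphi.
- apply: subclosed_compact cfK sub; exact: closed_closure.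
- by move=> x /sub[z /KD[z01 _] <-]; apply/I01P.
Qed.

Lemma slice_marg (g : V -> R) x : I01 x -> (forall z, ~ D z -> g z = 0) ->
  \int[L]_(y in B x) g (x, y) = marg g x.
Proof.
move=> xI g0; rewrite Rintegral_mkcond; apply: eq_Rintegral => y _.
rewrite patchE; case: ifPn => // yn; rewrite g0// => -[_ /= hy].
by move: yn; rewrite mem_set.
Qed.

Lemma E_pair_marg (u : R -> R) (g : V -> R) : mu.-integrable D (EFin \o (fun z => u z.1 * g z)) ->
  (forall z, ~ D z -> g z = 0) -> continuous g -> bsupp g ->
  \int[mu]_(z in D) (u z.1 * g z) = \int[leb]_(x in I01) (u x * marg g x).
Proof.
move=> iug g0 cg bg; rewrite (thin_Fubini H iug); apply: eq_Rintegral => x /set_mem xI.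
have ig : L.-integrable (B x) (EFin \o (fun y => g (x, y))).
  apply: integrableS (slice_integrable x cg bg) => //; exact: measurable_eball.
by rewrite /= RintegralZl ?slice_marg//; exact: measurable_eball.
Qed.

Lemma E_integrable (u : R -> R) : L2a n a u -> mu.-integrable D (EFin \o E_ext u).
Proof.
move=> /(L2a_sqint H) su; exact: (sqint_integrable (thin_measurable H) (thin_fin n H) su).
Qed.

Lemma E_weak (u du : R -> R) : L2a n a u -> L2a n a du -> weak_derivative01 u du ->
  weak_derivative D ((1, 0) : V) (E_ext u) (E_ext du).
Proof.
move=> iu idu wu phi tphi; have sphi := test_Cc_smooth tphi.
have [C hC] := test_derive_bounded ((1, 0) : V) tphi.
have [C' hC'] := Cc_bounded (Cc_smooth_continuous sphi) sphi.2.
have cd := @test_derive_continuous _ _ ((1, 0) : V) tphi.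
rewrite E_pair_marg; last 4 first.
- exact: mul_continuous_integrable (thin_measurable H) (E_integrable iu) cd hC.
- by move=> z; exact: test_derive_off tphi.
- exact: cd.
- exact: bsupp_derive sphi.2.
rewrite E_pair_marg; last 4 first.
- exact: mul_continuous_integrable (thin_measurable H) (E_integrable idu) (Cc_smooth_continuous sphi) hC'.
- by move=> z; exact: test_off tphi.
- exact: Cc_smooth_continuous.
- exact: sphi.2.
rewrite -(wu _ (test_marg tphi)); apply: eq_Rintegral => x _; congr (_ * _).
by have [_ ->] := marg_derive x 1 sphi.
Qed.

Lemma E_weak_y (u : R -> R) (v : 'rV[R]_n) : L2a n a u ->
  weak_derivative D ((0, v) : V) (E_ext u) (fun=> 0).
Proof.
move=> iu phi tphi; have sphi := test_Cc_smooth tphi.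
have [C hC] := test_derive_bounded ((0, v) : V) tphi.
have cd := @test_derive_continuous _ _ ((0, v) : V) tphi.
rewrite E_pair_marg; last 4 first.
- exact: mul_continuous_integrable (thin_measurable H) (E_integrable iu) cd hC.
- by move=> z; exact: test_derive_off tphi.
- exact: cd.
- exact: bsupp_derive sphi.2.
under eq_Rintegral do rewrite marg_derive_y// mulr0.
under [in RHS]eq_Rintegral do rewrite mul0r.
by rewrite !Rintegral_cst ?mul0r ?oppr0//; exact: thin_measurable H.
Qed.

Lemma E_H1 (u du : R -> R) : H1a n a u du -> H1 D (E_ext u) (grad_x du).
Proof.
move=> [iu idu wu]; have mD := thin_measurable H (n := n); split.
  by apply/(L2P _ mD); exact: L2a_sqint H _ iu.
move=> i; rewrite /grad_x /dir; under eq_fun do rewrite mxE; case: fintype.split => j.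
  split; last exact: E_weak.
  by apply/(L2P _ mD); exact: (L2a_sqint H idu).
split; last exact: E_weak_y.
apply/(L2P _ mD); split => //; under eq_fun do rewrite expr0n/=; exact: integrable0.
Qed.

End extension.

(** * Weak derivative of the average *)

Section cutoffs.
Context (R : realType).

(** It vanishes once 2 s^(m+1) >= 1, hence before [s] reaches 1, and for fixed [s] in [0, 1) it
    tends to the constant [flat 0 1] as [m] grows. *)
Definition cutoff (m : nat) (s : R) : R := flat 0 (1 - 2 * s ^+ m.+1).

Definition dcutoff (m : nat) (s : R) : R := flat 2 (1 - 2 * s ^+ m.+1) * - (2 * (m.+1%:R * s ^+ m)).

Lemma is_derive_idR (s : R) : is_derive s 1 (fun x : R => x) 1.
Proof. exact: is_derive_id. Qed.

Lemma is_derive_cstV (V : normedModType R) (c : R) (s v : V) : is_derive s v (fun _ : V => c) 0.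
Proof. exact: is_derive_cst. Qed.

Lemma is_derive_cutoff m (s : R) : is_derive s 1 (cutoff m) (dcutoff m s).
Proof.
rewrite /cutoff /dcutoff; have := is_derive_flat 0 (1 - 2 * s ^+ m.+1); rewrite mul0r subr0 => df.
refine (@is_derive_comp1 _ _ (flat 0) (fun s : R => 1 - 2 * s ^+ m.+1) s 1 _ _ df _).
have d1 := is_derive_exp m.+1 (is_derive_idR s).
have d2 := is_derive_mul (is_derive_cstV (-2) s 1) d1.
have := is_derive_add (is_derive_cstV 1 s 1) d2.
rewrite /= add0r mul0r add0r mulr1 mulNr; congr is_derive.
by apply/funext => x; rewrite mulNr.
Qed.

Lemma continuous_expR_nat (m : nat) : continuous (fun s : R => s ^+ m).
Proof. exact: exprn_continuous. Qed.

Lemma cutoff_continuous m : continuous (cutoff m).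
Proof.
move=> s; have [d _] := is_derive_cutoff m s.
by apply: differentiable_continuous; exact/derivable1_diffP.
Qed.

Lemma dcutoff_continuous m : continuous (dcutoff m).
Proof.
move=> s; apply: cvgM; last first.
  apply: cvgN; apply: cvgM; first exact: cvg_cst.
  by apply: cvgM; [exact: cvg_cst|exact: continuous_expR_nat].
apply: (@continuous_comp _ _ _ (fun s : R => 1 - 2 * s ^+ m.+1) (@flat R 2)); last exact: continuous_flat.
apply: cvgB; first exact: cvg_cst.
by apply: cvgM; [exact: cvg_cst|exact: continuous_expR_nat].
Qed.

Lemma cutoff_bound m s : `|cutoff m s| <= 1.
Proof.
rewrite /cutoff /flat; case: ifP => [h|]; last by rewrite normr0.
rewrite expr0 mul1r ger0_norm ?expR_ge0// -[leRHS]expR0 ler_expR oppr_le0 invr_ge0.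
exact: ltW.
Qed.

Lemma cutoff_neq0 m s : cutoff m s != 0 -> 2 * s ^+ m.+1 < 1.
Proof. by rewrite /cutoff /flat; case: ifP; rewrite ?eqxx// subr_gt0. Qed.

Lemma dcutoff_neq0 m s : dcutoff m s != 0 -> 2 * s ^+ m.+1 < 1.
Proof. by rewrite /dcutoff /flat; case: ifP; rewrite ?mul0r ?eqxx// subr_gt0. Qed.

Lemma cutoff_lim s : 0 <= s < 1 -> cutoff m s @[m --> \oo] --> flat 0 (1 : R).
Proof.
move=> /andP[s0 s1].
have h : (1 - 2 * s ^+ m.+1) @[m --> \oo] --> (1 : R).
  rewrite -[X in _ --> X]subr0; apply: cvgB; first exact: cvg_cst.
  rewrite -[X in _ --> X](mulr0 2); apply: cvgM; first exact: cvg_cst.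
  rewrite (cvg_shiftS (fun m => s ^+ m)); apply: cvg_expr.
  by rewrite ger0_norm.
exact: (continuous_cvg _ (@continuous_flat R 0 1) h).
Qed.

Lemma flat01_neq0 : flat 0 (1 : R) != 0.
Proof. by rewrite /flat ltr01 expr0 mul1r gt_eqF// expR_gt0. Qed.

End cutoffs.

Section strip.
Context (R : realType) (n : nat).
Local Notation V := (R * 'rV[R]_n)%type.
Local Notation I01 := (`]0%R, 1%R[%classic : set R).

Lemma dir_lshift (i : 'I_1) : dir R (lshift n i) = (1, 0).
Proof. by rewrite /dir (unsplitK (inl i)). Qed.

Lemma dir_rshift (j : 'I_n) : dir R (rshift 1 j) = (0, delta_mx ord0 j).
Proof. by rewrite /dir (unsplitK (inr j)). Qed.

Lemma is_derive_fst (h : R -> R) (z : V) (d : R) : is_derive z.1 1 h d ->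
  is_derive z ((1, 0) : V) (fun z => h z.1) d.
Proof. by move=> /is_derive_line dh; apply/is_derive_line. Qed.

Lemma is_derive_fst_y (h : R -> R) (z : V) (v : 'rV[R]_n) :
  is_derive z ((0, v) : V) (fun z => h z.1) 0.
Proof.
apply/is_derive_line; rewrite (_ : (fun t => _) = cst (h z.1)); first exact: is_derive_cst.
by apply/funext => t /=; rewrite scaler0 addr0.
Qed.

Lemma is_derive_snd_x (h : 'rV[R]_n -> R) (z : V) :
  is_derive z ((1, 0) : V) (fun z => h z.2) 0.
Proof.
apply/is_derive_line; rewrite (_ : (fun t => _) = cst (h z.2)); first exact: is_derive_cst.
by apply/funext => t /=; rewrite scaler0 addr0.
Qed.

Lemma is_derive_coord (z : V) (v : 'rV[R]_n) (k : 'I_n) :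
  is_derive z ((0, v) : V) (fun z => z.2 ord0 k) (v ord0 k).
Proof.
apply/is_derive_line.
rewrite (_ : (fun t => _) = (fun t => z.2 ord0 k + t * v ord0 k)); last first.
  by apply/funext => t /=; rewrite !mxE.
have := is_derive_add (is_derive_cstV (z.2 ord0 k) (0 : R) 1)
  (is_derive_mul (is_derive_idR 0) (is_derive_cstV (v ord0 k) (0 : R) 1)).
by rewrite add0r mul1r mul0r addr0.
Qed.

Definition sqnorm (z : V) : R := \sum_k z.2 ord0 k ^+ 2.

Lemma is_derive_bigsum (I : Type) (s : seq I) (f : I -> V -> R) (d : I -> R) (z v : V) :
  (forall i, is_derive z v (f i) (d i)) ->
  is_derive z v (fun z => \sum_(i <- s) f i z) (\sum_(i <- s) d i).
Proof.
move=> h; elim: s => [|i s IH].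
  by rewrite big_nil; under eq_fun do rewrite big_nil; exact: is_derive_cst.
by rewrite big_cons; under eq_fun do rewrite big_cons; exact: is_derive_add.
Qed.

Lemma is_derive_sqnorm (z : V) (j : 'I_n) :
  is_derive z ((0, delta_mx ord0 j) : V) sqnorm (2 * z.2 ord0 j).
Proof.
rewrite [X in is_derive _ _ _ X](_ : _ =
    \sum_k (2%:R * z.2 ord0 k ^+ 1 * (delta_mx ord0 j : 'rV[R]_n) ord0 k)).
  by apply: is_derive_bigsum => k; apply: is_derive_exp; exact: is_derive_coord.
rewrite (bigD1 j)//= big1 ?addr0 ?mxE ?eqxx ?mulr1 ?expr1// => k kj.
by rewrite mxE (negbTE kj) andbF mulr0.
Qed.

Lemma coord_continuous_xy (k : 'I_n) : continuous (fun z : V => z.2 ord0 k).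
Proof.
move=> z; apply: (@continuous_comp _ _ _ snd (fun y : 'rV[R]_n => y ord0 k)); first exact: cvg_snd.
exact: coord_continuous.
Qed.

Lemma sqnorm_continuous : continuous sqnorm.
Proof.
rewrite (_ : sqnorm = (fun z => enorm z.2 ^+ 2)); last by apply/funext => z; rewrite enorm_sqr_row.
move=> z; apply: (@continuous_comp _ _ _ (fun z : V => enorm z.2) (fun x : R => x ^+ 2)); last exact: exprn_continuous.
by apply: (@continuous_comp _ _ _ snd (@enorm R 1 n)); [exact: cvg_snd|exact: enorm_continuous].
Qed.

Lemma fst_continuous_at (h : R -> R) (z : V) : {for z.1, continuous h} ->
  {for z, continuous (fun z : V => h z.1)}.
Proof. by move=> ch; apply: (@continuous_comp _ _ _ fst h); [exact: cvg_fst|exact: ch]. Qed.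

Variable K0 : set R.
Hypotheses (clK0 : closed K0) (K01 : K0 `<=` I01).

Lemma strip_off (z : V) : ~ 0 < z.1 < 1 -> \forall w \near z, ~ K0 (w.1 : R).
Proof.
move=> nz; have nK : (~` K0) z.1 by move=> /K01/I01P.
have o : open (~` K0) by exact: closed_openC.
exact: (cvg_fst (open_nbhs_nbhs (conj o nK))).
Qed.

(** Functions carried by the closed set [K0] inside (0, 1) vanish near the rest, so regularity is
    needed only for 0 < x < 1, where the quotients by [a] make sense. *)
Lemma strip_continuous (f : V -> R) : (forall z : V, 0 < z.1 < 1 -> {for z, continuous f}) ->
  (forall z, ~ K0 z.1 -> f z = 0) -> continuous f.
Proof.
move=> cf f0 z; have [z01|nz] := pselect (0 < z.1 < 1); first exact: cf.
apply/cvgrPdist_lt => e e0; have nK : ~ K0 z.1 by move=> /K01/I01P.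
have h : nbhs (z : V) [set w : V | ~ K0 w.1] := strip_off nz.
apply: (@filterS _ (nbhs (z : V)) _ [set w : V | ~ K0 w.1] _ _ h) => w /f0 ->.
by rewrite f0// subrr normr0.
Qed.

Lemma strip_derive (f g : V -> R) (v : V) : (forall z : V, 0 < z.1 < 1 -> is_derive z v f (g z)) ->
  (forall z, ~ K0 z.1 -> f z = 0) -> (forall z, ~ K0 z.1 -> g z = 0) ->
  forall z, is_derive z v f (g z).
Proof.
move=> df f0 g0 z; have [z01|nz] := pselect (0 < z.1 < 1); first exact: df.
rewrite g0; last by move=> /K01/I01P.
have h : nbhs (z : V) [set w : V | ~ K0 w.1] := strip_off nz.
refine (near_eq_is_derive _ (is_derive_cst 0 z v)).
by apply: (@filterS _ (nbhs (z : V)) _ [set w : V | ~ K0 w.1] _ _ h) => w /f0 ->.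
Qed.

End strip.

Lemma Rintegral_sum d (T : measurableType d) (R : realType) (mu : {measure set T -> \bar R})
    (D : set T) (I : Type) (s : seq I) (f : I -> T -> R) : measurable D ->
  (forall i, mu.-integrable D (EFin \o f i)) ->
  mu.-integrable D (EFin \o (fun x => \sum_(i <- s) f i x)) /\
  \int[mu]_(x in D) (\sum_(i <- s) f i x) = \sum_(i <- s) \int[mu]_(x in D) f i x.
Proof.
move=> mD fi; elim: s => [|i s [IH1 IH2]].
  rewrite big_nil; under eq_fun do rewrite big_nil; split; first exact: integrable0.
  by rewrite Rintegral_cst// mul0r.
rewrite big_cons; split.
  under eq_fun do rewrite big_cons; rewrite /comp; under eq_fun do rewrite EFinD.
  exact: (integrableD mD (fi i) IH1).
by under eq_Rintegral do rewrite big_cons; rewrite RintegralD// IH2.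
Qed.

(* [D_x w + (a'/a) y . D_y w]: the function whose average is the derivative of
   the average of [w]. *)
Definition avg_grad (R : realType) (n : nat) (a a' : R -> R) (gw : R * 'rV[R]_n -> 'cV[R]_(1 + n)) z : R :=
  gw z (lshift n ord0) ord0 +
  a' z.1 / a z.1 * \sum_j z.2 ord0 j * gw z (rshift 1 j) ord0.

Section average_derivative.
Context (R : realType) (n : nat) (a a' : R -> R) (M e : R).
Hypothesis (H : thin_profile a a' M e).
Local Notation V := (R * 'rV[R]_n)%type.
Local Notation mV := (measurableTypeR R * 'rV[R]_n)%type.
Local Notation mu := (@lebesgue_xy R n).
Local Notation leb := (@lebesgue_measure R).
Local Notation L := (lebesgue_rV R n).
Local Notation I01 := (`]0%R, 1%R[%classic : set R).
Local Notation D := (@thin R n a e).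
Let b (x : R) : R := (e * a x)^-1.
Let lam (x : R) : R := a' x / a x.
Let q (z : V) : R := sqnorm z * b z.1 ^+ 2.

Lemma scaled_a_neq0 x : 0 < x < 1 -> e * a x != 0.
Proof. by move=> x01; rewrite gt_eqF// (ea_gt0 H). Qed.

Let a_neq0 (x : R) : 0 < x < 1 -> a x != 0.
Proof. by move=> x01; rewrite gt_eqF// (prof_gt0 H). Qed.

Let e_neq0 : e != 0. Proof. by rewrite gt_eqF// (prof_e_gt0 H). Qed.

Let is_derive_b (x : R) : 0 < x < 1 -> is_derive x 1 b (- (lam x * b x)).
Proof.
move=> x01; have d1 := is_derive_mul (is_derive_cstV e x 1) (prof_derive H x01).
have := @is_derive_inv _ _ (fun x : R => e * a x) x 1 _ (scaled_a_neq0 x01) d1; congr is_derive.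
rewrite /lam /b; field; rewrite e_neq0 a_neq0//.
Qed.

Let b_continuous (x : R) : 0 < x < 1 -> {for x, continuous b}.
Proof.
by move=> /is_derive_b[d _]; apply: differentiable_continuous; exact/derivable1_diffP.
Qed.

Let lam_continuous (x : R) : 0 < x < 1 -> {for x, continuous lam}.
Proof.
move=> x01; apply: cvgM; first exact: (prof_continuous H x01).
by apply: cvgV; [exact: a_neq0|exact: (a_continuous H)].
Qed.

Let q_continuous (z : V) : 0 < z.1 < 1 -> {for z, continuous q}.
Proof.
move=> z01; apply: cvgM; first exact: sqnorm_continuous.
apply: (@fst_continuous_at _ _ (fun x => b x ^+ 2)).
apply: (@continuous_comp _ _ _ b (fun x : R => x ^+ 2)); last exact: exprn_continuous.
exact: b_continuous.
Qed.

Let is_derive_q_x (z : V) : 0 < z.1 < 1 ->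
  is_derive z ((1, 0) : V) q (- (2 * lam z.1 * q z)).
Proof.
move=> z01.
have d1 := is_derive_snd_x (fun y : 'rV[R]_n => \sum_k y ord0 k ^+ 2) z.
have d2 : is_derive z ((1, 0) : V) (fun z => b z.1 ^+ 2) (2%:R * b z.1 ^+ 1 * - (lam z.1 * b z.1)).
  apply: (@is_derive_fst _ _ (fun x => b x ^+ 2)); apply: is_derive_exp; exact: is_derive_b.
have := is_derive_mul d1 d2; congr is_derive; rewrite /q /sqnorm; ring.
Qed.

Let is_derive_q_y (z : V) (j : 'I_n) :
  is_derive z ((0, delta_mx ord0 j) : V) q (2 * z.2 ord0 j * b z.1 ^+ 2).
Proof.
have := is_derive_mul (is_derive_sqnorm z j) (is_derive_fst_y (fun x => b x ^+ 2) z (delta_mx ord0 j)).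
by rewrite mulr0 addr0.
Qed.

Let q_ge0 z : 0 <= q z.
Proof. by rewrite mulr_ge0 ?sqr_ge0// sumr_ge0// => k _; exact: sqr_ge0. Qed.

Let thin_q (z : V) : 0 < z.1 < 1 -> D z <-> q z < 1.
Proof.
move=> z01; have r0 := ea_gt0 H z01.
have E : (q z < 1) = (enorm z.2 ^+ 2 < (e * a z.1) ^+ 2).
  by rewrite enorm_sqr_row /q /sqnorm /b exprVn ltr_pdivrMr ?mul1r// exprn_gt0.
rewrite E ltr_pXn2r ?nnegrE ?enorm_ge0 ?(ltW r0)//.
by split => [[]|].
Qed.

Section test.
Variable th : R -> R.
Hypothesis tth : test_function I01 th.
Let K0 := closure [set x | th x != 0].
Let dth := 'D_1 th.

Let th_smooth : smooth_on setT th. Proof. by case: tth. Qed.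
Let K0_compact : compact K0. Proof. by case: tth. Qed.
Let K01 : K0 `<=` I01. Proof. by case: tth. Qed.
Let K0_closed : closed K0. Proof. exact: closed_closure. Qed.

Let th_off (x : R) : ~ K0 x -> th x = 0.
Proof. by move=> nx; apply: contrapT => /eqP h; apply: nx; exact: subset_closure. Qed.

Let dth_off (x : R) : ~ K0 x -> dth x = 0.
Proof. by move=> nx; apply: contrapT => /eqP h; apply: nx; exact: derive_supp h. Qed.

Let is_derive_th (x : R) : is_derive x 1 th (dth x).
Proof. by apply: DeriveDef => //; exact: smooth_derivable. Qed.

Let th_continuous : continuous th. Proof. exact: smooth_continuous. Qed.

Let dth_continuous : continuous dth.
Proof. by apply: smooth_continuous; exact: smooth_derive. Qed.

(** [h] is the scalar factor of the test field and [psi] that of its divergence. The term by which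
    the derivative [dh] differs from [psi] is compensated by the divergence of lam y. *)
Let h (x : R) := b x ^+ n * th x.
Let psi (x : R) := b x ^+ n * dth x.
Let dh (x : R) := psi x - n%:R * lam x * h x.

Let bn_continuous (x : R) : 0 < x < 1 -> {for x, continuous (fun x => b x ^+ n)}.
Proof.
move=> x01; apply: (@continuous_comp _ _ _ b (fun x : R => x ^+ n)); first exact: b_continuous.
exact: exprn_continuous.
Qed.

Let h_continuous (x : R) : 0 < x < 1 -> {for x, continuous h}.
Proof. by move=> x01; apply: cvgM; [exact: bn_continuous|exact: th_continuous]. Qed.

Let psi_continuous (x : R) : 0 < x < 1 -> {for x, continuous psi}.
Proof. by move=> x01; apply: cvgM; [exact: bn_continuous|exact: dth_continuous]. Qed.

Let dh_continuous (x : R) : 0 < x < 1 -> {for x, continuous dh}.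
Proof.
move=> x01; apply: cvgB; first exact: psi_continuous.
apply: cvgM; last exact: h_continuous.
by apply: cvgM; [exact: cvg_cst|exact: lam_continuous].
Qed.

Let is_derive_h (x : R) : 0 < x < 1 -> is_derive x 1 h (dh x).
Proof.
move=> x01.
have := is_derive_mul (is_derive_exp n (is_derive_b x01)) (is_derive_th x).
congr is_derive; rewrite /dh /psi /h.
have -> : n%:R * b x ^+ n.-1 * - (lam x * b x) = - (n%:R * lam x * b x ^+ n).
  by case: (n) => [|k]; rewrite ?mul0r ?oppr0//= exprS; ring.
ring.
Qed.

Section level.
Variable m : nat.

(** [z0] and [zj] are the components of the test field, [dz0] and [dzj] their derivatives, each in
    its own direction; [K] carries all of them. *)
Let z0 (z : V) := cutoff m (q z) * h z.1.
Let dz0 (z : V) := dcutoff m (q z) * - (2 * lam z.1 * q z) * h z.1 + cutoff m (q z) * dh z.1.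
Let zj j (z : V) := z.2 ord0 j * (lam z.1 * h z.1 * cutoff m (q z)).
Let dzj j (z : V) := lam z.1 * h z.1 * cutoff m (q z) +
  z.2 ord0 j * (lam z.1 * h z.1 * (dcutoff m (q z) * (2 * z.2 ord0 j * b z.1 ^+ 2))).
Let K := [set z : V | K0 z.1 /\ 2 * q z ^+ m.+1 <= 1].

Let K_D : K `<=` D.
Proof.
move=> z [/K01/I01P z01 qz]; apply/(thin_q z01).
rewrite ltNge; apply/negP => q1.
by have := exprn_ege1 m.+1 q1; lra.
Qed.

Let K_compact : compact K.
Proof.
apply: (closed_bounded_compact_xy (r := 1 + e * M)); last by move=> z /K_D; exact: (thin_le H).
(* [q] is continuous on the strip only, so the complement is split according to whether x lies in
   [K0]. *)
rewrite -openC (_ : ~` K = [set z : V | ~ K0 z.1] `|`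
    [set z : V | [set z : V | 0 < z.1 < 1] z /\ 0 < 2 * q z ^+ m.+1 - 1]); last first.
  apply/seteqP; split => z.
    move=> nK; have [Kz|nKz] := pselect (K0 z.1); last by left.
    right; split; first exact/I01P/K01.
    by rewrite subr_gt0 ltNge; apply/negP => hz; apply: nK.
  by move=> [nKz [Kz _]//|[_ hz] [_]]; move: hz; rewrite subr_gt0 ltNge => /negP.
apply: openU.
  rewrite (_ : mkset _ = fst @^-1` (~` K0)); last by [].
  by apply: open_comp => [z _|]; [exact: cvg_fst|exact: closed_openC].
apply: open_lt_on; first exact: open_strip.
move=> z /set_mem/= z01; apply: cvgB; last exact: cvg_cst.
apply: cvgM; first exact: cvg_cst.
apply: (@continuous_comp _ _ _ q (fun x : R => x ^+ m.+1)); first exact: q_continuous.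
exact: exprn_continuous.
Qed.

Let kapq_continuous (z : V) : 0 < z.1 < 1 -> {for z, continuous (fun z => cutoff m (q z))}.
Proof.
move=> z01; apply: (@continuous_comp _ _ _ q (cutoff m)); first exact: q_continuous.
exact: cutoff_continuous.
Qed.

Let dkapq_continuous (z : V) : 0 < z.1 < 1 -> {for z, continuous (fun z => dcutoff m (q z))}.
Proof.
move=> z01; apply: (@continuous_comp _ _ _ q (dcutoff m)); first exact: q_continuous.
exact: dcutoff_continuous.
Qed.

Let lamh_continuous (z : V) : 0 < z.1 < 1 -> {for z, continuous (fun z : V => lam z.1 * h z.1)}.
Proof.
by move=> z01; apply: cvgM; apply: fst_continuous_at; [exact: lam_continuous|exact: h_continuous].
Qed.

Let h_off (x : R) : ~ K0 x -> h x = 0.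
Proof. by move=> nx; rewrite /h th_off// mulr0. Qed.

Let psi_off (x : R) : ~ K0 x -> psi x = 0.
Proof. by move=> nx; rewrite /psi dth_off// mulr0. Qed.

Let dh_off (x : R) : ~ K0 x -> dh x = 0.
Proof. by move=> nx; rewrite /dh psi_off// h_off// mulr0 subr0. Qed.

Let z0_continuous : continuous z0.
Proof.
apply: (strip_continuous K0_closed K01) => z hz; last by rewrite /z0 h_off// mulr0.
by apply: cvgM; [exact: kapq_continuous|exact/fst_continuous_at/h_continuous].
Qed.

Let dz0_continuous : continuous dz0.
Proof.
apply: (strip_continuous K0_closed K01) => z hz; last by rewrite /dz0 h_off// dh_off// !mulr0 addr0.
apply: cvgD; apply: cvgM.
- apply: cvgM; first exact: dkapq_continuous.
  apply: cvgN; apply: cvgM; last exact: q_continuous.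
  by apply: cvgM; [exact: cvg_cst|exact/fst_continuous_at/lam_continuous].
- exact/fst_continuous_at/h_continuous.
- exact: kapq_continuous.
- exact/fst_continuous_at/dh_continuous.
Qed.

Let zj_continuous j : continuous (zj j).
Proof.
apply: (strip_continuous K0_closed K01) => z hz; last by rewrite /zj h_off// mulr0 mul0r mulr0.
apply: cvgM; first exact: coord_continuous_xy.
by apply: cvgM; [exact: lamh_continuous|exact: kapq_continuous].
Qed.

Let dzj_continuous j : continuous (dzj j).
Proof.
apply: (strip_continuous K0_closed K01) => z hz; last by rewrite /dzj h_off// mulr0 !mul0r mulr0 addr0.
apply: cvgD; first by apply: cvgM; [exact: lamh_continuous|exact: kapq_continuous].
apply: cvgM; first exact: coord_continuous_xy.
apply: cvgM; first exact: lamh_continuous.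
apply: cvgM; first exact: dkapq_continuous.
apply: cvgM; first by apply: cvgM; [exact: cvg_cst|exact: coord_continuous_xy].
apply: (@fst_continuous_at _ _ (fun x => b x ^+ 2)).
apply: (@continuous_comp _ _ _ b (fun x : R => x ^+ 2)); last exact: exprn_continuous.
exact: b_continuous.
Qed.

Let z0_derive : forall z, is_derive z ((1, 0) : V) z0 (dz0 z).
Proof.
apply: (strip_derive K0_closed K01) => z hz; last 2 first.
- by rewrite /z0 h_off// mulr0.
- by rewrite /dz0 h_off// dh_off// !mulr0 addr0.
apply: is_derive_mul; last exact/is_derive_fst/is_derive_h.
apply: (@is_derive_comp1 _ _ (cutoff m) q); last exact: is_derive_q_x.
exact: is_derive_cutoff.
Qed.

Let zj_derive j : forall z, is_derive z ((0, delta_mx ord0 j) : V) (zj j) (dzj j z).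
Proof.
apply: (strip_derive K0_closed K01) => z hz; last 2 first.
- by rewrite /zj h_off// mulr0 mul0r mulr0.
- by rewrite /dzj h_off// mulr0 !mul0r mulr0 addr0.
have d1 := is_derive_coord z (delta_mx ord0 j) j.
have d2 := @is_derive_comp1 _ _ (cutoff m) q z ((0, delta_mx ord0 j) : V) _ _ (is_derive_cutoff m (q z)) (is_derive_q_y z j).
have d3 := is_derive_fst_y (fun x => lam x * h x) z (delta_mx ord0 j).
have := is_derive_mul d1 (is_derive_mul d3 d2).
by rewrite mul0r add0r mxE !eqxx mul1r.
Qed.

Let K_of (g : V -> R) z : (K0 z.1 -> ~ (2 * q z ^+ m.+1 < 1) -> g z = 0) ->
  (~ K0 z.1 -> g z = 0) -> g z != 0 -> K z.
Proof.
move=> g1 g2 gz; have [Kz|nKz] := pselect (K0 z.1); last by move: gz; rewrite g2// eqxx.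
split => //; have [/ltW//|nq] := pselect (2 * q z ^+ m.+1 < 1).
by move: gz; rewrite g1// eqxx.
Qed.

Let kap_off (s : R) : ~ (2 * s ^+ m.+1 < 1) -> cutoff m s = 0.
Proof. by move=> ns; apply: contrapT => /eqP/cutoff_neq0. Qed.

Let dkap_off (s : R) : ~ (2 * s ^+ m.+1 < 1) -> dcutoff m s = 0.
Proof. by move=> ns; apply: contrapT => /eqP/dcutoff_neq0. Qed.

(** The weak equations of all components are added. The derivative of the cutoff drops out of the
    sum, so its growth with [m] does not disturb the limit. *)
Lemma cutoff_identity (w : V -> R) (gw : V -> 'cV[R]_(1 + n)) : H1 D w gw ->
  \int[mu]_(z in D) (w z * (cutoff m (q z) * psi z.1)) =
  - \int[mu]_(z in D) ((gw z (lshift n ord0) ord0 +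
      lam z.1 * \sum_j z.2 ord0 j * gw z (rshift 1 j) ord0) * (cutoff m (q z) * h z.1)).
Proof.
move=> [/(L2P _ (thin_measurable H)) sw Hw].
have mD := thin_measurable H (n := n); have fD := thin_fin n H.
have iw := sqint_integrable mD fD sw.
have ig i : mu.-integrable D (EFin \o (fun z => gw z i ord0)).
  by apply: (sqint_integrable mD fD); apply/(L2P _ mD); exact: (Hw i).1.
have z0K z : z0 z != 0 -> K z.
  by apply: K_of => [_ nq|hz]; rewrite /z0; [rewrite kap_off// mul0r|rewrite h_off// mulr0].
have zjK j z : zj j z != 0 -> K z.
  by apply: K_of => [_ nq|hz]; rewrite /zj; [rewrite kap_off// !mulr0|rewrite h_off// mulr0 mul0r mulr0].
have dz0K z : dz0 z != 0 -> K z.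
  by apply: K_of => [_ nq|hz]; rewrite /dz0; [rewrite kap_off// dkap_off// !mul0r addr0|rewrite h_off// dh_off// !mulr0 addr0].
have dzjK j z : dzj j z != 0 -> K z.
  by apply: K_of => [_ nq|hz]; rewrite /dzj; [rewrite kap_off// dkap_off// mul0r !mulr0 addr0|rewrite h_off// mulr0 !mul0r mulr0 addr0].
have cont_int (F g : V -> R) : mu.-integrable D (EFin \o F) -> continuous g -> (forall z, g z != 0 -> K z) ->
    mu.-integrable D (EFin \o (fun z => F z * g z)).
  move=> iF cg gK; have [C hC] := Cc_bounded cg (compact_bsupp K_compact gK).
  exact: mul_continuous_integrable mD iF cg hC.
have W0 : \int[mu]_(z in D) (w z * dz0 z) = - \int[mu]_(z in D) (gw z (lshift n ord0) ord0 * z0 z).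
  have := (Hw (lshift n ord0)).2; rewrite dir_lshift => W.
  have E : 'D_((1, 0) : V) z0 = dz0 by apply/funext => z; have [_ ->] := z0_derive z.
  rewrite -E; apply: (weak_derivative_Cc (thin_open H : open D) iw (ig _) W K_compact K_D z0_continuous z0K).
    by move=> z; have [] := z0_derive z.
  by rewrite E; exact: dz0_continuous.
have Wj j : \int[mu]_(z in D) (w z * dzj j z) = - \int[mu]_(z in D) (gw z (rshift 1 j) ord0 * zj j z).
  have := (Hw (rshift 1 j)).2; rewrite dir_rshift => W.
  have E : 'D_((0, delta_mx ord0 j) : V) (zj j) = dzj j by apply/funext => z; have [_ ->] := zj_derive j z.
  rewrite -E; apply: (weak_derivative_Cc (thin_open H : open D) iw (ig _) W K_compact K_D (@zj_continuous j) (zjK j)).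
    by move=> z; have [] := zj_derive j z.
  by rewrite E; exact: dzj_continuous.
have [is1 S1] := Rintegral_sum (enum 'I_n) mD (fun j => cont_int _ _ iw (@dzj_continuous j) (dzjK j)).
have [is2 S2] := Rintegral_sum (enum 'I_n) mD (fun j => cont_int _ _ (ig (rshift 1 j)) (@zj_continuous j) (zjK j)).
transitivity (\int[mu]_(z in D) (w z * dz0 z + \sum_(j <- enum 'I_n) w z * dzj j z)).
  (* Summing over j, the [dcutoff] terms add up to 2 lam q h times [dcutoff] and the others to n lam
     h times [cutoff]; both cancel against [dz0]. *)
  apply: eq_Rintegral => z _; rewrite -mulr_sumr -mulrDr; congr (_ * _).
  rewrite big_enum/= /dzj big_split/= sumr_const card_ord.
  rewrite (eq_bigr (fun j => (lam z.1 * h z.1 * dcutoff m (q z) * 2 * b z.1 ^+ 2) * z.2 ord0 j ^+ 2)); last by move=> j _; ring.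
  rewrite -mulr_sumr -/(sqnorm z) -mulr_natl /dz0 /dh /q; ring.
rewrite RintegralD//; last exact: cont_int.
rewrite S1 W0 (eq_bigr _ (fun j _ => Wj j)) sumrN -opprD -S2 -RintegralD//; last exact: cont_int.
congr (- _); apply: eq_Rintegral => z _; rewrite big_enum/= mulrDl; congr (_ + _).
by rewrite mulr_sumr mulr_suml; apply: eq_bigr => j _; rewrite /zj; ring.
Qed.

End level.

Let bounded_on_strip (g : R -> R) : (forall x : R, 0 < x < 1 -> {for x, continuous g}) ->
  (forall x : R, ~ K0 x -> g x = 0) -> exists2 C : R, 0 <= C & forall x, `|g x| <= C.
Proof.
move=> cg g0; have cgK : compact (g @` K0).
  apply: continuous_compact => //; apply: continuous_in_subspaceT => x /set_mem/K01/I01P.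
  exact: cg.
have [C [_ hC]] := compact_bounded cgK.
exists (`|C| + 1); first by rewrite addr_ge0.
move=> x; have [Kx|nx] := pselect (K0 x); last by rewrite g0// normr0 addr_ge0.
apply: (hC (`|C| + 1)); last by exists x.
by rewrite (le_lt_trans (ler_norm C))// ltrDl.
Qed.

Let L2a_bounded (g : R -> R) : (forall x : R, 0 < x < 1 -> {for x, continuous g}) ->
  (forall x : R, ~ K0 x -> g x = 0) -> L2a n a g.
Proof.
move=> cg g0; have [C C0 hC] := bounded_on_strip cg g0.
have mg : measurable_fun I01 g.
  apply: open_continuous_measurable_fun; first exact: interval_open.
  by move=> x /set_mem/I01P; exact: cg.
split => //; apply: (@le_lt_trans _ _ (\int[leb]_(x in I01) (M ^+ n * C ^+ 2)%:E)%E).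
  apply: ge0_le_integral => //.
  - by move=> x /I01P x01; rewrite lee_fin mulr_ge0 ?sqr_ge0// exprn_ge0// ltW// (prof_gt0 H).
  - apply/measurable_EFinP; apply: measurable_funM; last exact: measurable_funX.
    by apply: measurable_funX; exact: (measurable_a H).
  - move=> x /I01P x01; rewrite lee_fin ler_pM ?sqr_ge0 ?exprn_ge0//.
    + by rewrite ltW// (prof_gt0 H).
    + have a0 := prof_gt0 H x01; rewrite lerXn2r ?nnegrE ?(ltW a0) ?(ltW (prof_M_gt0 H))//.
      by rewrite -[leLHS]ger0_norm ?(ltW a0)// (prof_le H).
    + by rewrite -[g x ^+ 2]ger0_norm ?sqr_ge0// normrX lerXn2r ?nnegrE.
rewrite integral_cst//= lebesgue_measure_itv/= lte_fin ltr01 oppr0 addr0 mule1.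
exact: ltry.
Qed.

Let psi_off (x : R) : ~ K0 x -> psi x = 0.
Proof. by move=> nx; rewrite /psi dth_off// mulr0. Qed.

Let h_off (x : R) : ~ K0 x -> h x = 0.
Proof. by move=> nx; rewrite /h th_off// mulr0. Qed.

Let cutoff_integral_lim (F : V -> R) (g : R -> R) : mu.-integrable D (EFin \o F) ->
  (forall x : R, 0 < x < 1 -> {for x, continuous g}) -> (forall x : R, ~ K0 x -> g x = 0) ->
  \int[mu]_(z in D) (F z * (cutoff m (q z) * g z.1)) @[m --> \oo] -->
  \int[mu]_(z in D) (F z * (flat 0 1 * g z.1)).
Proof.
move=> iF cg g0; have [C C0 hC] := bounded_on_strip cg g0.
apply: (@Rdominated_mul _ _ D F (fun m z => cutoff m (q z) * g z.1) (fun z => flat 0 1 * g z.1) C) => //.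
- exact: (thin_measurable H).
- move=> m; apply: (strip_continuous K0_closed K01) => z hz; last by rewrite g0// mulr0.
  apply: cvgM; last exact/fst_continuous_at/cg.
  apply: (@continuous_comp _ _ _ q (cutoff m)); first exact: q_continuous.
  exact: cutoff_continuous.
- move=> z Dz; apply: cvgM; last exact: cvg_cst.
  by apply: cutoff_lim; rewrite q_ge0; apply/thin_q => //; case: Dz.
- move=> m z; rewrite normrM -[C]mul1r ler_pM//; exact: cutoff_bound.
Qed.

(** In the limit of [cutoff_identity] the cutoff is the nonzero constant [flat 0 1], which is
    cancelled. *)
Lemma average_test (w : V -> R) (gw : V -> 'cV[R]_(1 + n)) : H1 D w gw ->
  sqint mu D (avg_grad a a' gw) ->
  [/\ L2a n a psi, L2a n a h &
  \int[mu]_(z in D) (w z * psi z.1) = - \int[mu]_(z in D) (avg_grad a a' gw z * h z.1)].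
Proof.
move=> Hw sG; have Lpsi : L2a n a psi by exact: L2a_bounded.
have Lh : L2a n a h by exact: L2a_bounded.
split => //; have iG := sqint_integrable (thin_measurable H) (thin_fin n H) sG.
have sw := (L2P _ (thin_measurable H)).1 Hw.1.
have iw := sqint_integrable (thin_measurable H) (thin_fin n H) sw.
have l1 := cutoff_integral_lim iw psi_continuous psi_off.
have l2 := cutoff_integral_lim iG h_continuous h_off.
have E : (fun m => \int[mu]_(z in D) (w z * (cutoff m (q z) * psi z.1))) =
    (fun m => - \int[mu]_(z in D) (avg_grad a a' gw z * (cutoff m (q z) * h z.1))).
  by apply/funext => m; exact: cutoff_identity Hw.
rewrite E in l1.
have {l2} l2 : (- \int[mu]_(z in D) (avg_grad a a' gw z * (cutoff m (q z) * h z.1))) @[m --> \oo] -->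
    - \int[mu]_(z in D) (avg_grad a a' gw z * (flat 0 1 * h z.1)) by apply: cvgN; exact: l2.
have L1 := cvg_lim (@Rhausdorff R) l1; have := cvg_lim (@Rhausdorff R) l2; rewrite L1.
have mD := thin_measurable H (n := n).
have c0 := @flat01_neq0 R.
have pull F g : sqint mu D F -> L2a n a g ->
    \int[mu]_(z in D) (F z * (flat 0 1 * g z.1)) = flat 0 1 * \int[mu]_(z in D) (F z * g z.1).
  move=> sF /(sqint_E_mul H sF) iFg; rewrite -RintegralZl//.
  by apply: eq_Rintegral => z _; rewrite mulrCA.
by rewrite (pull _ _ sw Lpsi) (pull _ _ sG Lh) -mulrN => E'; apply: (mulfI c0); exact: E'.
Qed.

(** Adjointness brings in the weight a^n, which b^n turns into e^-n on both sides. This is why the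
    test field carries the factor b^n. *)
Lemma average_weak (w : V -> R) (gw : V -> 'cV[R]_(1 + n)) : H1 D w gw ->
  sqint mu D (avg_grad a a' gw) ->
  \int[leb]_(x in I01) (M_avg a e w x * 'D_1 th x) =
  - \int[leb]_(x in I01) (M_avg a e (avg_grad a a' gw) x * th x).
Proof.
move=> Hw sG; have [Lpsi Lh E] := average_test Hw sG.
have sw := (L2P _ (thin_measurable H)).1 Hw.1.
have [i1 E1] := M_avg_adjoint H sw Lpsi; have [i2 E2] := M_avg_adjoint H sG Lh.
move: E; rewrite E1 E2.
have c0 : e ^+ n * vol_ball R n != 0 by rewrite gt_eqF// mulr_gt0 ?exprn_gt0 ?vol_ball_gt0 ?(prof_e_gt0 H).
have en0 : e ^- n != 0 by rewrite invr_neq0// expf_neq0.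
have pull (f g : R -> R) :
    leb.-integrable I01 (EFin \o (fun x => a x ^+ n * f x * (b x ^+ n * g x))) ->
    \int[leb]_(x in I01) (a x ^+ n * f x * (b x ^+ n * g x)) = e ^- n * \int[leb]_(x in I01) (f x * g x).
  have Ep x : I01 x -> a x ^+ n * f x * (b x ^+ n * g x) = e ^- n * (f x * g x).
    move=> /I01P/a_neq0 ax; rewrite /b exprVn exprMn_comm; last exact: mulrC.
    by field; rewrite !expf_neq0.
  move=> ifg; rewrite -RintegralZl//.
    by apply: eq_Rintegral => x /set_mem/Ep.
  have iZ : leb.-integrable I01 (fun x => (e ^+ n)%:E * (a x ^+ n * f x * (b x ^+ n * g x))%:E)%E.
    by apply: (integrableZl _ _ ifg).
  apply: eq_integrable iZ => // x /set_mem/Ep /= ->.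
  by rewrite -EFinM mulVKf ?expf_neq0.
by rewrite (pull _ _ i1) (pull _ _ i2) -!mulrN => /(mulfI c0)/(mulfI en0).
Qed.

End test.

(** The bound |y| < e a absorbs the singular factor 1/a and leaves |a'| <= M. The resulting factor
    [e] is one source of the rate. *)
Lemma avg_grad_le (gw : V -> 'cV[R]_(1 + n)) (z : V) : D z ->
  `|avg_grad a a' gw z - gw z (lshift n ord0) ord0| <=
    e * M * Num.sqrt (\sum_j gw z (rshift 1 j) ord0 ^+ 2).
Proof.
move=> [z01 hz]; rewrite /avg_grad addrAC subrr add0r.
have a0 := prof_gt0 H z01; have e0 := prof_e_gt0 H.
set S := \sum_j _; set T := \sum_j _.
have hS : `|S| <= e * a z.1 * Num.sqrt T.
  rewrite -(ler_pXn2r (n := 2))// ?nnegrE ?mulr_ge0 ?sqrtr_ge0 ?(ltW e0) ?(ltW a0)//.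
  have T0 : 0 <= T by apply: sumr_ge0 => j _; exact: sqr_ge0.
  rewrite real_normK ?num_real// exprMn_comm; last exact: mulrC.
  rewrite sqr_sqrtr//; apply: le_trans (sum_CauchySchwarz _ _) _; rewrite ler_wpM2r//.
  by rewrite -enorm_sqr_row lerXn2r ?nnegrE ?enorm_ge0 ?mulr_ge0 ?(ltW e0) ?(ltW a0)// ltW.
rewrite normrM normrM normfV (gtr0_norm a0).
apply: (@le_trans _ _ (M / a z.1 * (e * a z.1 * Num.sqrt T))).
  rewrite ler_pM ?mulr_ge0 ?invr_ge0 ?(ltW a0)// ler_wpM2r ?invr_ge0 ?(ltW a0)//.
  exact: (prof_derive_le H).
rewrite le_eqVlt; apply/orP; left; apply/eqP; field; exact: lt0r_neq0.
Qed.

Lemma sqint_avg_grad (gw : V -> 'cV[R]_(1 + n)) : (forall i, sqint mu D (fun z => gw z i ord0)) ->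
  sqint mu D (avg_grad a a' gw).
Proof.
move=> sg; have mD := thin_measurable H (n := n); apply: sqintD => //.
suff s : sqint mu D (fun z : mV => \sum_j (a' z.1 / a z.1 * z.2 ord0 j) * gw z (rshift 1 j) ord0).
  apply: (sqint_eq mD _ s) => z _.
  by rewrite mulr_sumr; apply: eq_bigr => j _; rewrite mulrA.
apply: sqint_sum => // j; apply: (@sqintMl _ _ _ _ _ _ _ (e * M)) => //.
- apply: open_continuous_measurable_xy; first exact: (thin_open H).
  move=> z /set_mem[z01 _]; apply: cvgM; last exact: coord_continuous_xy.
  exact: (@fst_continuous_at _ _ lam _ (lam_continuous z01)).
- move=> z [z01 hz]; have a0 := prof_gt0 H z01.
  rewrite normrM normrM normfV (gtr0_norm a0) -mulrA mulrC ler_pM ?mulr_ge0 ?invr_ge0 ?(ltW a0)//.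
    rewrite mulrC ler_pdivrMr//; exact: le_trans (ler_enorm _ _ _) (ltW hz).
  exact: (prof_derive_le H).
Qed.

Lemma average_H1a (w : V -> R) (gw : V -> 'cV[R]_(1 + n)) : H1 D w gw ->
  H1a n a (M_avg a e w) (M_avg a e (avg_grad a a' gw)).
Proof.
move=> Hw; have mD := thin_measurable H (n := n).
have sw := (L2P _ mD).1 Hw.1.
have sG : sqint mu D (avg_grad a a' gw).
  by apply: sqint_avg_grad => i; apply/(L2P _ mD); exact: (Hw.2 i).1.
split; [exact: (M_avg_L2a H)|exact: (M_avg_L2a H)|].
by move=> th tth; exact: average_weak.
Qed.

End average_derivative.

(** * Differences along segments *)

(* [lebesgue_xy] is not declared sigma-finite; the same set function under another
   name can be, which Fubini's theorem requires. *)
Definition lebesgue_xy_set (R : realType) (n : nat) :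
  set (measurableTypeR R * 'rV[R]_n)%type -> \bar R := @lebesgue_xy R n.

Section sigma_finite.
Context (R : realType) (n : nat).
Local Notation nu := (@lebesgue_xy_set R n).
Local Notation V := (R * 'rV[R]_n)%type.

Let nu0 : nu set0 = 0%E. Proof. exact: measure0. Qed.
Let nu_ge0 A : (0 <= nu A)%E. Proof. exact: measure_ge0. Qed.
Let nu_sigma_additive : semi_sigma_additive nu.
Proof. exact: measure_semi_sigma_additive. Qed.

HB.instance Definition _ := isMeasure.Build _ _ _ nu nu0 nu_ge0 nu_sigma_additive.

Let nu_sigma_finite : sigma_finite setT nu.
Proof.
exists (fun k => [set z : V | `|z| < k.+1%:R]).
  apply/esym; rewrite -subTset => z _; exists (Num.bound `|z|) => //=.
  by apply: lt_trans (archi_boundP (normr_ge0 z)) _; rewrite ltr_nat.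
move=> k; split; first exact: measurable_ball_xy.
by rewrite /lebesgue_xy_set (@lebesgue_xy_ball R n k.+1%:R)// ltry.
Qed.

HB.instance Definition _ := Measure_isSigmaFinite.Build _ _ _ nu nu_sigma_finite.

End sigma_finite.

Section directional.
Context (R : realType) (V : normedModType R).

Lemma is_derive_scale (phi : V -> R) (z v : V) (c d : R) :
  is_derive z v phi d -> is_derive z (c *: v) phi (c * d).
Proof.
move=> /is_derive_line dphi; apply/is_derive_line.
have d1 : is_derive (0 : R) 1 (fun s : R => s * c) c.
  by have := is_derive_mul (is_derive_idR 0) (is_derive_cstV c (0 : R) 1); rewrite mul1r mul0r addr0.
have := @is_derive_comp1 _ _ (fun s : R => phi (z + s *: v)) (fun s : R => s * c) 0 1 c d.
rewrite mul0r mulrC => /(_ dphi d1); congr is_derive.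
by apply/funext => s; rewrite scalerA.
Qed.

(** The increment is split into a step along [u] and a step along [v]; the mean value theorem and
    continuity of the derivative along [v] handle the second one. *)
Lemma is_derive_add_dir (phi : V -> R) (z u v : V) (d : R) :
  (forall z, derivable phi z v) -> continuous ('D_v phi) -> is_derive z u phi d ->
  is_derive z (u + v) phi (d + 'D_v phi z).
Proof.
move=> dphi cphi /is_derive_line du; apply/is_derive_line.
suff dr : is_derive (0 : R) 1 (fun t : R => phi (z + t *: u + t *: v) - phi (z + t *: u)) ('D_v phi z).
  have := is_derive_add du dr; congr is_derive; apply/funext => t.
  by rewrite addrC subrK scalerDr addrA.
(* The segment is parametrised by s in [0, 1], which covers negative t as well. *)
have mvt t : exists2 c : R, `|c| <= 1 & phi (z + t *: u + t *: v) - phi (z + t *: u) =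
    t * 'D_v phi (z + t *: u + (c * t) *: v).
  have dpsi (s : R) : is_derive s 1 (fun s : R => phi (z + t *: u + s *: (t *: v)))
      (t * 'D_v phi (z + t *: u + (s * t) *: v)).
    have h : is_derive (z + t *: u + s *: (t *: v)) (t *: v) phi (t * 'D_v phi (z + t *: u + (s * t) *: v)).
      by rewrite -scalerA; apply: is_derive_scale; apply: DeriveDef => //; rewrite scalerA.
    have [hd hv] := h; have := @derive_line _ _ phi (z + t *: u) (t *: v) s hd.
    by rewrite hv.
  have [|c c01] := @MVT R (fun s : R => phi (z + t *: u + s *: (t *: v)))
      (fun s : R => t * 'D_v phi (z + t *: u + (s * t) *: v)) 0 1 ltr01 (fun s _ => dpsi s).
    apply: continuous_subspaceT => s; have [d1 _] := dpsi s.
    by apply: differentiable_continuous; exact/derivable1_diffP.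
  rewrite scale1r scale0r addr0 subr0 mulr1 => ->.
  exists c => //; move: c01; rewrite in_itv/= => /andP[c0 c1].
  by rewrite ger0_norm ltW.
have lim : (fun h : R => h^-1 *: ((fun t : R => phi (z + t *: u + t *: v) - phi (z + t *: u)) (h *: 1 + 0) -
   (fun t : R => phi (z + t *: u + t *: v) - phi (z + t *: u)) 0)) @ 0^' --> 'D_v phi z.
  apply/cvgrPdist_le => e e0.
  have /cvgrPdist_le/(_ e e0) := cphi z; rewrite -nbhs_nearE => /nbhs_ballP[r /= r0 hr].
  (* The intermediate point is at distance at most |h| k from [z]; the added 1 keeps [k]
     positive. *)
  pose k := `|u| + `|v| + 1.
  have k0 : 0 < k by rewrite ltr_wpDl// addr_ge0.
  exists (r / k); first by rewrite /= divr_gt0.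
  move=> h /=; rewrite sub0r normrN => hk h0.
  rewrite !scale0r !addr0 subrr subr0 /GRing.scale/= mulr1.
  have [c c1 ->] := mvt h; rewrite mulKf//; apply: hr.
  rewrite -ball_normE/= -addrA opprD addrA subrr add0r normrN.
  apply: le_lt_trans (ler_normD _ _) _; rewrite !normrZ ?normrM.
  apply: (@le_lt_trans _ _ (`|h| * k)); last by rewrite -ltr_pdivlMr.
  rewrite /k !mulrDr mulr1 -addrA lerD2l; apply: (@le_trans _ _ (`|h| * `|v|)); last by rewrite lerDl.
  by rewrite ler_wpM2r// ler_piMl.
apply: DeriveDef; first by apply/cvg_ex; exists ('D_v phi z); exact: lim.
exact: cvg_lim lim.
Qed.

End directional.

Section translate.
Context (R : realType) (n : nat).
Local Notation V := (R * 'rV[R]_n)%type.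
Local Notation mV := (measurableTypeR R * 'rV[R]_n)%type.
Local Notation mu := (@lebesgue_xy R n).
Local Notation leb := (@lebesgue_measure R).
Local Notation L := (lebesgue_rV R n).
Local Notation U01 := (`[0%R, 1%R]%classic : set R).

(** [smooth_on] speaks of directional derivatives only, so linearity in the direction is built up
    one basis vector at a time. *)
Lemma is_derive_rV (phi : V -> R) (z : V) (v : 'rV[R]_n) : smooth_on setT phi ->
  is_derive z ((0, v) : V) phi (\sum_j v ord0 j * 'D_((0, delta_mx ord0 j) : V) phi z).
Proof.
move=> sphi.
have gen (s : seq 'I_n) : is_derive z ((0, \sum_(j <- s) v ord0 j *: delta_mx ord0 j) : V) phi
    (\sum_(j <- s) v ord0 j * 'D_((0, delta_mx ord0 j) : V) phi z).
  elim: s => [|j s IH].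
    rewrite !big_nil; apply: DeriveDef; [exact: derivable0|exact: derive0].
  rewrite !big_cons [X in is_derive _ _ _ X]addrC.
  have -> : ((0, v ord0 j *: delta_mx ord0 j + \sum_(j <- s) v ord0 j *: delta_mx ord0 j) : V) =
      (0, \sum_(j <- s) v ord0 j *: delta_mx ord0 j) + v ord0 j *: (0, delta_mx ord0 j).
    by congr pair => /=; rewrite ?scaler0 ?addr0// addrC.
  have E z' : is_derive z' (v ord0 j *: ((0, delta_mx ord0 j) : V)) phi (v ord0 j * 'D_((0, delta_mx ord0 j) : V) phi z').
    by apply: is_derive_scale; apply: DeriveDef => //; exact: smooth_derivable.
  have [_ <-] := E z; apply: is_derive_add_dir => //.
  by apply: smooth_continuous; exact: smooth_derive.
by have := gen (index_enum 'I_n); rewrite -row_sum_delta.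
Qed.

Lemma shift_derive (phi : V -> R) (z e : V) (s : R) : smooth_on setT phi ->
  is_derive s 1 (fun s : R => phi (z - s *: e)) (- 'D_e phi (z - s *: e)).
Proof.
move=> sphi; have d1 : is_derive (z + s *: (- e)) (- e) phi (- 'D_e phi (z - s *: e)).
  have d0 : is_derive (z - s *: e) e phi ('D_e phi (z - s *: e)).
    by apply: DeriveDef => //; exact: smooth_derivable.
  by have := is_derive_scale (-1) d0; rewrite scaleN1r mulN1r scalerN.
have [h1 h2] := d1; have := @derive_line _ _ phi z (- e) s h1; rewrite h2.
by congr is_derive; apply/funext => t; rewrite scalerN.
Qed.

Lemma shift_pairing_integrable (F phi : V -> R) (c : V) : mu.-integrable setT (EFin \o F) ->
  Cc_smooth phi -> mu.-integrable setT (EFin \o (fun z => F z * phi (z - c))).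
Proof.
move=> iF sphi; have [C hC] := Cc_bounded (Cc_smooth_continuous sphi) sphi.2.
apply: (@mul_continuous_integrable _ _ setT F (fun z => phi (z - c)) C) => //.
move=> z; apply: (@continuous_comp _ _ _ (fun z : V => z - c) phi); last exact: Cc_smooth_continuous.
by apply: cvgB; [exact: cvg_id|exact: cvg_cst].
Qed.

(** With the translation placed on [phi], the pairing is differentiable in t although [F] is merely
    integrable. *)
Lemma shift_pairing_derive (F phi : V -> R) (e : V) (t : R) : mu.-integrable setT (EFin \o F) ->
  Cc_smooth phi ->
  is_derive t 1 (fun t : R => \int[mu]_z (F z * phi ((z : V) - t *: e)))
    (- \int[mu]_z (F z * 'D_e phi ((z : V) - t *: e))).
Proof.
move=> iF sphi; have sd := Cc_smooth_derive e sphi.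
have [C hC] := Cc_bounded (Cc_smooth_continuous sd) sd.2.
have d1 z (s : R) : is_derive s 1 (fun s : R => F z * phi (z - s *: e)) (F z * - 'D_e phi (z - s *: e)).
  have := is_derive_mul (is_derive_cstV (F z) s 1) (shift_derive z e s sphi.1).
  by rewrite mul0r add0r.
have C0 : 0 <= C by exact: le_trans (hC 0).
have -> : (- \int[mu]_z (F z * 'D_e phi ((z : V) - t *: e))) = \int[mu]_z 'D_(1 : R) (fun s : R => F z * phi ((z : V) - s *: e)) t.
  have ip := shift_pairing_integrable (t *: e) iF sd.
  have E := @RintegralZl _ mV R mu setT _ (-1) measurableT ip.
  rewrite -mulN1r -E.
  by apply: eq_Rintegral => z _; have [_ ->] := d1 z t; rewrite mulN1r mulrN.
apply: (@is_derive_integral _ _ _ mu R setT (fun (s : R) z => F z * phi ((z : V) - s *: e)) (fun z => C * `|F z|)) => //.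
- by move=> h _; exact: shift_pairing_integrable.
- have -> : (EFin \o (fun z => C * `|F z|)) = (fun z => C%:E * `|F z|%:E)%E by apply/funext => z /=; rewrite EFinM.
  by apply: integrableZl => //; exact: (integrable_abse iF).
- by move=> z; rewrite mulr_ge0.
- move=> h z _ _; have [_ ->] := d1 z (t + h *: 1).
  by rewrite normrM normrN mulrC ler_wpM2r.
Qed.

Lemma shift_pairing_move (F phi : V -> R) (c : V) : mu.-integrable setT (EFin \o F) ->
  continuous phi -> \int[mu]_z (F z * phi (z - c)) = \int[mu]_z (F (z + c) * phi z).
Proof.
move=> iF cphi; rewrite -(@Rintegral_shift_xy _ _ (fun z => F z * phi (z - c)) c).
  by apply: eq_Rintegral => z _; rewrite addrK.
apply: measurable_funM; first by apply/measurable_EFinP; exact: (measurable_int _ iF).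
apply: continuous_measurable_xy => z.
apply: (@continuous_comp _ _ _ (fun z : V => z - c) phi); last exact: cphi.
by apply: cvgB; [exact: cvg_id|exact: cvg_cst].
Qed.

End translate.

Section Rfubini_swap.
Context d1 d2 (T1 : measurableType d1) (T2 : measurableType d2) (R : realType).
Variables (m1 : {sigma_finite_measure set T1 -> \bar R}).
Variables (m2 : {sigma_finite_measure set T2 -> \bar R}).
Variable f : T1 * T2 -> R.
Hypothesis fi : (m1 \x m2)%E.-integrable setT (EFin \o f).

Let fi' : (m2 \x m1)%E.-integrable setT (EFin \o (fun p => f (p.2, p.1))).
Proof.
have mf : measurable_fun setT (EFin \o f) := measurable_int _ fi.
have mf' : measurable_fun setT (EFin \o (fun p : T2 * T1 => f (p.2, p.1))).
  exact: (measurableT_comp mf (@measurable_swap _ _ T2 T1)).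
case: (@integrable12ltyP _ _ _ _ _ m2 m1 _ mf') => _; apply.
by case: (@integrable21ltyP _ _ _ _ _ m1 m2 (EFin \o f) mf) => + _; exact.
Qed.

Lemma Rfubini_ae2 : {ae m2, forall y, m1.-integrable setT (EFin \o (fun x => f (x, y)))}.
Proof. exact: Rfubini_ae fi'. Qed.

Lemma Rfubini_integrable2 : m2.-integrable setT (EFin \o (fun y => \int[m1]_x f (x, y))).
Proof. exact: Rfubini_integrable fi'. Qed.

Lemma Rfubini_swap : \int[m1]_x \int[m2]_y f (x, y) = \int[m2]_y \int[m1]_x f (x, y).
Proof.
rewrite -(Rfubini fi); congr fine; rewrite -(integral21_prod_meas1 fi); apply: ae_eq_integral => //.
- exact: measurable_fubini_G fi.
- exact: (measurable_int _ Rfubini_integrable2).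
- apply: filterS Rfubini_ae2 => y iy _; rewrite /Rintegral /fubini_G fineK//.
  exact: integrable_fin_num iy.
Qed.

End Rfubini_swap.

Section segments.
Context (R : realType) (n : nat).
Local Notation V := (R * 'rV[R]_n)%type.
Local Notation mV := (measurableTypeR R * 'rV[R]_n)%type.
Local Notation mu := (@lebesgue_xy R n).
Local Notation nu := (@lebesgue_xy_set R n).
Local Notation leb := (@lebesgue_measure R).
Local Notation U01 := (`[0%R, 1%R]%classic : set R).

Lemma measurable_segment (v : 'rV[R]_n) :
  measurable_fun (setT : set (measurableTypeR R * mV)%type)
    (fun p : measurableTypeR R * mV => (p.2 : V) + (p.1 : R) *: ((0, v) : V) : mV).
Proof.
apply: measurable_fun_pair => /=.
  under eq_fun do rewrite scaler0 addr0.
  exact: (measurableT_comp measurable_fst measurable_snd).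
apply: measurable_fun_rV => i.
under eq_fun do rewrite !mxE.
apply: measurable_funD.
  exact: (measurableT_comp (measurable_coord_rV i) (measurableT_comp measurable_snd measurable_snd)).
by apply: measurable_funM => //; exact: measurable_fst.
Qed.

Lemma measurable_segment_indic (G : V -> R) (v : 'rV[R]_n) : measurable_fun (setT : set mV) G ->
  measurable_fun (setT : set (measurableTypeR R * mV)%type)
    (fun p : measurableTypeR R * mV => \1_U01 (p.1 : R) * G ((p.2 : V) + (p.1 : R) *: ((0, v) : V))).
Proof.
move=> mG; apply: measurable_funM; last exact: (measurableT_comp mG (measurable_segment v)).
have m1 : measurable_fun (setT : set (measurableTypeR R)) (\1_U01 : measurableTypeR R -> R).
  exact: measurable_indic.
exact: (measurableT_comp m1 measurable_fst).
Qed.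

(** All translates of [G] have the same L^1 norm, so the iterated integral is that norm times the
    length of [0, 1]. *)
Lemma segment_integrable (G : V -> R) (v : 'rV[R]_n) : mu.-integrable setT (EFin \o G) ->
  (leb \x nu)%E.-integrable setT
    (EFin \o (fun p : measurableTypeR R * mV => \1_U01 (p.1 : R) * G ((p.2 : V) + (p.1 : R) *: ((0, v) : V)))).
Proof.
move=> iG; have mG : measurable_fun (setT : set mV) G.
  by apply/measurable_EFinP; exact: (measurable_int _ iG).
have /integrableP[_ Goo] := iG.
apply/integrable12ltyP.
  by apply/measurable_EFinP; exact: measurable_segment_indic.
have A (t : R) : (\int[nu]_z `|(\1_U01 t * G ((z : V) + t *: ((0, v) : V)))%:E| =
    (\1_U01 t)%:E * \int[mu]_z `|G z|%:E)%E.
  transitivity (\int[mu]_z (fun z : V => (\1_U01 t * `|G z|)%:E) ((z : V) + t *: ((0, v) : V))%R)%E.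
    by apply: eq_integral => z _; rewrite /= normrM ger0_norm.
  transitivity (\int[mu]_z (\1_U01 t * `|G z|)%:E)%E.
    apply: (@integral_shift_xy _ _ (fun z : V => (\1_U01 t * `|G z|)%:E)).
    by apply/measurable_EFinP; apply: measurable_funM => //; exact: measurableT_comp.
  under eq_integral do rewrite EFinM; rewrite ge0_integralZl_EFin//.
  by apply/measurable_EFinP; exact: measurableT_comp.
under eq_integral do rewrite A.
rewrite ge0_integralZr//; last 2 first.
- exact/measurable_EFinP.
- by apply: integral_ge0 => z _; rewrite lee_fin.
have U1 : leb U01 = 1%E by rewrite lebesgue_measure_itv/= lte_fin ltr01 oppr0 addr0.
rewrite [X in (X * _)%E](_ : _ = 1%E); last by rewrite integral_indic// setIT; exact: U1.
by rewrite mul1e; exact: Goo.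
Qed.

Lemma patch_integrable (D : set V) (F : V -> R) : measurable (D : set mV) ->
  mu.-integrable D (EFin \o F) -> mu.-integrable setT (EFin \o (F \_ D)).
Proof. by move=> mD iF; rewrite -restrict_EFin; apply/(integrable_mkcond _ mD).1. Qed.

Variables (D : set V) (r : R) (w g : V -> R) (v : 'rV[R]_n).
Local Notation e := ((0, v) : V).
Hypotheses (oD : open D) (Dr : forall z, D z -> `|z| <= r).
Hypotheses (iw : mu.-integrable D (EFin \o w)) (ig : mu.-integrable D (EFin \o g)).
Hypothesis convD : forall z (t : R), D z -> D (z + e) -> 0 <= t <= 1 -> D (z + t *: e).
Hypothesis wg : weak_derivative D e w g.
Let U := [set z | D z /\ D (z + e)].
Let wt := w \_ D.
Let gt := g \_ D.
Let mD : measurable (D : set mV). Proof. exact: open_measurable_xy. Qed.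
Let iwt : mu.-integrable setT (EFin \o wt). Proof. exact: patch_integrable. Qed.
Let igt : mu.-integrable setT (EFin \o gt). Proof. exact: patch_integrable. Qed.

Lemma open_translate : open U.
Proof.
apply: openI => //; apply: open_comp => // z _.
by apply: cvgD; [exact: cvg_id|exact: cvg_cst].
Qed.

Let patch_pair (F phi : V -> R) : (forall z, ~ D z -> phi z = 0) ->
  \int[mu]_z ((F \_ D) z * phi z) = \int[mu]_(z in D) (F z * phi z).
Proof.
move=> phi0; rewrite [RHS]Rintegral_mkcond; apply: eq_Rintegral => z _.
by rewrite !patchE; case: ifPn => // _; rewrite mul0r.
Qed.

(** On the support of [phi] both endpoints lie in [D], hence by convexity so does the whole segment;
    the shifted function is thus an admissible test on [D]. *)
Lemma segment_pairing (phi : V -> R) (t : R) : test_function U phi -> 0 <= t <= 1 ->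
  (- \int[mu]_z (wt z * 'D_e phi ((z : V) - t *: e))) = \int[mu]_z (gt z * phi ((z : V) - t *: e)).
Proof.
move=> tphi t01; have sphi := test_Cc_smooth tphi; have [_ cK KU] := tphi.
set K := closure _ in cK KU.
pose f z := phi (z - t *: e); pose Kt := (fun z : V => z + t *: e) @` K.
have sh z : Kt z <-> K (z - t *: e).
  by split=> [[y Ky <-]|Kz]; [rewrite addrK|exists (z - t *: e); rewrite ?subrK].
have cKt : compact Kt.
  apply: continuous_compact => //; apply: continuous_subspaceT => z.
  by apply: cvgD; [exact: cvg_id|exact: cvg_cst].
have KtD : Kt `<=` D.
  move=> z /sh/KU[h1 h2]; rewrite -[z](subrK (t *: e)); exact: convD.
have cshift : continuous (fun z : V => z - t *: e).
  by move=> z; apply: cvgB; [exact: cvg_id|exact: cvg_cst].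
have cf : continuous f.
  move=> z; apply: (@continuous_comp _ _ _ (fun z : V => z - t *: e) phi); first exact: cshift.
  exact: Cc_smooth_continuous.
have df z : is_derive z e f ('D_e phi (z - t *: e)).
  apply/is_derive_line; have /is_derive_line : is_derive (z - t *: e) e phi ('D_e phi (z - t *: e)).
    by apply: DeriveDef => //; apply: smooth_derivable; exact: sphi.1.
  by congr is_derive; apply/funext => s; rewrite /f addrAC.
have E : 'D_e f = (fun z => 'D_e phi (z - t *: e)) by apply/funext => z; have [_ ->] := df z.
have f0 z : f z != 0 -> Kt z by move=> fz; apply/sh; exact: subset_closure.
have dfe z : derivable f z e by have [] := df z.
have := weak_derivative_Cc oD iw ig wg cKt KtD cf f0 dfe; rewrite E => h.
have cD : continuous (fun z : V => 'D_e phi (z - t *: e)).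
  move=> z; apply: (@continuous_comp _ _ _ (fun z : V => z - t *: e) ('D_e phi)); first exact: cshift.
  exact: (test_derive_continuous tphi).
have {}h := h cD.
rewrite patch_pair; last first.
  move=> z nz; apply: contrapT => /eqP hz; apply: nz; apply: KtD; apply/sh.
  exact: derive_supp hz.
rewrite (patch_pair g (phi := f)); last first.
  by move=> z nz; apply: contrapT => /eqP /f0 hz; apply: nz; exact: KtD.
have Ef : \int[mu]_(z in D) (w z * 'D_e phi ((z : V) - t *: e)) = \int[mu]_(z in D) (w z * 'D_e f z).
  by apply: eq_Rintegral => z _; have [_ ->] := df z.
by rewrite Ef h opprK.
Qed.

(** The pairing of both sides with a test function is compared by the fundamental theorem of
    calculus in t and Fubini's theorem; du Bois-Reymond then removes the test function. *)
Lemma weak_segment : {ae mu, forall z, U z ->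
  w (z + e) - w z = \int[leb]_t (\1_U01 (t : R) * gt ((z : V) + (t : R) *: e))}.
Proof.
pose P z := \int[leb]_t (\1_U01 (t : R) * gt ((z : V) + (t : R) *: e)).
have iS := segment_integrable v igt.
have iP : mu.-integrable setT (EFin \o P) := Rfubini_integrable2 iS.
have iwe : mu.-integrable setT (EFin \o (fun z => wt (z + e))) by exact: integrable_shift_xy.
have iF : mu.-integrable setT (EFin \o (fun z => wt (z + e) - wt z - P z)).
  exact: (integrableB measurableT (integrableB measurableT iwe iwt) iP).
have mU : measurable (U : set mV) by apply: open_measurable_xy; exact: open_translate.
have key : {ae mu, forall z, U z -> wt (z + e) - wt z - P z = 0}.
  apply: (@du_Bois_Reymond _ _ _ r); first exact: open_translate.
  - by move=> z [/Dr].
  - by apply: integrableS iF.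
  move=> phi tphi; have sphi := test_Cc_smooth tphi; have cphi := Cc_smooth_continuous sphi.
  have [C hC] := Cc_bounded cphi sphi.2.
  have imul F : mu.-integrable setT (EFin \o F) -> mu.-integrable setT (EFin \o (fun z => F z * phi z)).
    by move=> iF'; exact: (@mul_continuous_integrable _ _ setT F phi C).
  have -> : \int[mu]_(z in U) ((wt (z + e) - wt z - P z) * phi z) =
      \int[mu]_z (wt (z + e) * phi z - wt z * phi z - P z * phi z).
    rewrite Rintegral_mkcond; apply: eq_Rintegral => z _; rewrite patchE -!mulrBl.
    by case: ifPn => // /negP nz; rewrite (test_off tphi) ?mulr0// => Uz; apply: nz; rewrite inE.
  rewrite RintegralB//; [|exact: integrableB (imul _ iwe) (imul _ iwt)|exact: imul].
  rewrite RintegralB//; [|exact: imul..].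
  (* After a change of variables [It t] pairs w (z + t e) with [phi], so its increment over [0, 1]
     is the pairing of the difference. *)
  pose It (t : R) := \int[mu]_z (wt z * phi ((z : V) - t *: e)).
  pose Jt (t : R) := - \int[mu]_z (wt z * 'D_e phi ((z : V) - t *: e)).
  have dI (t : R) : is_derive t 1 It (Jt t) by exact: shift_pairing_derive.
  have cont_of f (df : R -> R) : (forall t : R, is_derive t 1 f (df t)) -> continuous f.
    move=> h t; have [d _] := h t.
    by apply: differentiable_continuous; exact/derivable1_diffP.
  have cI : continuous It by exact: cont_of dI.
  have cJ : continuous Jt.
    move=> t; apply: cvgN.
    exact: (cont_of _ _ (fun t => shift_pairing_derive e t iwt (Cc_smooth_derive e sphi))).
  have ftc : \int[leb]_(t in U01) Jt t = It 1 - It 0.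
    rewrite /Rintegral (@continuous_FTC2 _ Jt It 0 1)//.
    - exact: continuous_subspaceT.
    - split; first by move=> t _; have [] := dI t.
      + by apply: cvg_at_right_filter; exact: cI.
      + by apply: cvg_at_left_filter; exact: cI.
    - by move=> t _; rewrite derive1E; have [_ ->] := dI t.
  have I0 : It 0 = \int[mu]_z (wt z * phi z).
    by apply: eq_Rintegral => z _; rewrite scale0r subr0.
  have I1 : It 1 = \int[mu]_z (wt ((z : V) + e) * phi z).
    by rewrite -(shift_pairing_move e iwt cphi); apply: eq_Rintegral => z _; rewrite scale1r.
  rewrite -I1 -I0 -ftc.
  have iS2 : (leb \x nu)%E.-integrable setT (EFin \o (fun p : measurableTypeR R * mV =>
      \1_U01 (p.1 : R) * gt ((p.2 : V) + (p.1 : R) *: e) * phi p.2)).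
    have mS := measurable_int _ iS.
    apply: (@le_integrable _ _ _ (leb \x nu)%E setT measurableT _ (fun p => C%:E * (EFin \o (fun p : measurableTypeR R * mV =>
      (\1_U01 (p.1 : R) * gt ((p.2 : V) + (p.1 : R) *: e))%R)) p)%E).
    - apply/measurable_EFinP; apply: measurable_funM; first exact/measurable_EFinP.
      exact: (measurableT_comp (continuous_measurable_xy cphi) measurable_snd).
    - move=> p _; rewrite /= lee_fin normrM mulrC [leRHS]normrM ler_wpM2r//.
      by rewrite (le_trans (hC _))// ler_norm.
    - exact: integrableZl.
  have sw := Rfubini_swap iS2.
  have -> : \int[mu]_z (P z * phi z) = \int[nu]_z \int[leb]_t (\1_U01 (t : R) * gt ((z : V) + (t : R) *: e) * phi z).
    apply: ae_eq_Rintegral => //.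
    - apply: measurable_funM; last exact: continuous_measurable_xy.
      by apply/measurable_EFinP; exact: (measurable_int _ iP).
    - by apply/measurable_EFinP; exact: (measurable_int _ (Rfubini_integrable2 iS2)).
    - apply: ae_imp (Rfubini_ae2 iS) => z iz _; exact/esym/(RintegralZr _ measurableT iz).
  rewrite -sw Rintegral_mkcond; apply/eqP; rewrite subr_eq0; apply/eqP.
  apply: eq_Rintegral => t _; rewrite patchE; case: ifPn => tU.
    have t01 : 0 <= t <= 1 by move: tU; rewrite inE/= in_itv.
    rewrite /Jt (segment_pairing tphi t01) (shift_pairing_move _ igt cphi).
    by apply: eq_Rintegral => z _; rewrite indicE tU mul1r.
  rewrite (_ : (fun y => _) = cst 0) ?Rintegral_cst ?mul0r//.
  by apply/funext => z; rewrite indicE (negbTE tU) !mul0r.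
apply: ae_imp key => z h Uz; have := h Uz; rewrite /wt !patchE.
by have [h1 h2] := Uz; rewrite !mem_set// => /eqP; rewrite subr_eq0 => /eqP.
Qed.

End segments.

Lemma ae_imp2 d (T : measurableType d) (R : realType) (mu : {measure set T -> \bar R})
    (P Q S : T -> Prop) : (forall x, P x -> Q x -> S x) ->
  {ae mu, forall x, P x} -> {ae mu, forall x, Q x} -> {ae mu, forall x, S x}.
Proof. by move=> PQS; exact: filterS2. Qed.

(** * Poincare inequality on the slices *)

Section slices.
Context (R : realType) (n : nat) (a a' : R -> R) (M e : R).
Hypothesis (H : thin_profile a a' M e).
Local Notation V := (R * 'rV[R]_n)%type.
Local Notation mV := (measurableTypeR R * 'rV[R]_n)%type.
Local Notation mu := (@lebesgue_xy R n).
Local Notation nu := (@lebesgue_xy_set R n).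
Local Notation leb := (@lebesgue_measure R).
Local Notation L := (lebesgue_rV R n).
Local Notation I01 := (`]0%R, 1%R[%classic : set R).
Local Notation U01 := (`[0%R, 1%R]%classic : set R).
Local Notation D := (@thin R n a e).
Local Notation B x := (@eball R n (e * a x)).

Lemma leb_U01 : leb U01 = 1%E.
Proof. by rewrite lebesgue_measure_itv/= lte_fin ltr01 oppr0 addr0. Qed.

Lemma thin_convex_y (z : V) (v : 'rV[R]_n) (t : R) : D z -> D (z + ((0, v) : V)) -> 0 <= t <= 1 ->
  D (z + t *: ((0, v) : V)).
Proof.
move=> [z01 hz] [_ hzv] t01; split; rewrite /= ?scaler0 addr0//.
by move: hzv; rewrite /= addr0; exact: enorm_convex.
Qed.

Variables (w : V -> R) (gw : V -> 'cV[R]_(1 + n)).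
Hypothesis Hw : H1 D w gw.
Let mD : measurable (D : set mV) := thin_measurable H (n := n).
Let fD := thin_fin n H.
Let sw : sqint mu D w. Proof. by apply/(L2P _ mD); exact: Hw.1. Qed.
Let sg i : sqint mu D (fun z => gw z i ord0).
Proof. by apply/(L2P _ mD); exact: (Hw.2 i).1. Qed.

Definition grad_y_sq (z : V) : R := \sum_j gw z (rshift 1 j) ord0 ^+ 2.
Let gv (v : 'rV[R]_n) (z : V) : R := \sum_j v ord0 j * gw z (rshift 1 j) ord0.

Let sgv v : sqint mu D (gv v).
Proof. by apply: sqint_sum => // j; exact: sqintZ. Qed.

(** [H1] provides the coordinate directions; a general [v] follows by linearity. *)
Lemma weak_derivative_y (v : 'rV[R]_n) : weak_derivative D ((0, v) : V) w (gv v).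
Proof.
move=> phi tphi; have sphi := test_Cc_smooth tphi.
have iw := sqint_integrable mD fD sw.
have i1 j : mu.-integrable D (EFin \o (fun z => v ord0 j * (w z * 'D_((0, delta_mx ord0 j) : V) phi z))).
  have [C hC] := test_derive_bounded ((0, delta_mx ord0 j) : V) tphi.
  have := mul_continuous_integrable mD iw (test_derive_continuous tphi) hC.
  exact: integrableZl.
have i2 j : mu.-integrable D (EFin \o (fun z => v ord0 j * (gw z (rshift 1 j) ord0 * phi z))).
  have [C hC] := Cc_bounded (Cc_smooth_continuous sphi) sphi.2.
  have := mul_continuous_integrable mD (sqint_integrable mD fD (sg (rshift 1 j))) (Cc_smooth_continuous sphi) hC.
  exact: integrableZl.
have [_ S1] := Rintegral_sum (index_enum 'I_n) mD i1.
have [_ S2] := Rintegral_sum (index_enum 'I_n) mD i2.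
transitivity (\int[mu]_(z in D) \sum_j v ord0 j * (w z * 'D_((0, delta_mx ord0 j) : V) phi z)).
  apply: eq_Rintegral => z _; have [_ ->] := is_derive_rV z v sphi.1.
  by rewrite mulr_sumr; apply: eq_bigr => j _; rewrite mulrCA.
transitivity (- \int[mu]_(z in D) \sum_j v ord0 j * (gw z (rshift 1 j) ord0 * phi z)); last first.
  by congr (- _); apply: eq_Rintegral => z _; rewrite mulr_suml; apply: eq_bigr => j _; rewrite mulrA.
rewrite S1 S2 -sumrN; apply: eq_bigr => j _.
have [C hC] := test_derive_bounded ((0, delta_mx ord0 j) : V) tphi.
have [C' hC'] := Cc_bounded (Cc_smooth_continuous sphi) sphi.2.
have j1 := mul_continuous_integrable mD iw (test_derive_continuous tphi) hC.
have j2 := mul_continuous_integrable mD (sqint_integrable mD fD (sg (rshift 1 j))) (Cc_smooth_continuous sphi) hC'.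
rewrite (RintegralZl _ mD j1) (RintegralZl _ mD j2) -mulrN; congr (_ * _).
by have := (Hw.2 (rshift 1 j)).2 phi tphi; rewrite dir_rshift.
Qed.

Section fixed_translation.
Variable v : 'rV[R]_n.
Local Notation ev := ((0, v) : V).
Let U := [set z : V | D z /\ D (z + ev)].
Let gt := gv v \_ D.

Let mU : measurable (U : set mV).
Proof. by apply: open_measurable_xy; apply: open_translate; exact: (thin_open H). Qed.

Let gt2E z : gt z ^+ 2 = ((fun z => gv v z ^+ 2) \_ D) z.
Proof. by rewrite /gt !patchE; case: ifPn => // _; rewrite expr0n. Qed.

Let igt2 : mu.-integrable setT (EFin \o (fun z => gt z ^+ 2)).
Proof.
under eq_fun do rewrite gt2E.
by apply: patch_integrable => //; have [_] := sgv v.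
Qed.

Let mgt : measurable_fun (setT : set mV) gt.
Proof. by apply/(measurable_restrictT _ mD); have [] := sgv v. Qed.

(** Cauchy-Schwarz in t against the indicator of [0, 1], which is its own square. The right side is
    kept extended real so that Tonelli's theorem applies to it directly. *)
Lemma segment_sq : {ae mu, forall z, U z ->
  (((w (z + ev) - w z) ^+ 2)%:E <= \int[leb]_t (\1_U01 (t : R) * gt ((z : V) + (t : R) *: ev) ^+ 2)%:E)%E}.
Proof.
have iS := segment_integrable v igt2.
have iw := sqint_integrable mD fD sw.
have igv := sqint_integrable mD fD (sgv v).
have h1 := weak_segment (thin_open H : open D) (fun z => @thin_le _ _ _ _ _ _ H z) iw igv
  (fun z t h h' => @thin_convex_y z v t h h') (weak_derivative_y v).
apply: (ae_imp2 _ h1 (Rfubini_ae2 iS)) => z hz iz Uz.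
rewrite (hz Uz).
have E1 : \int[leb]_t (\1_U01 (t : R))%R = 1.
  rewrite /Rintegral integral_indic// setIT; exact: (congr1 fine leb_U01).
have idem (t : R) : (\1_U01 t : R) ^+ 2 = \1_U01 t.
  by rewrite indicE; case: (_ \in _); rewrite ?expr1n ?expr0n.
have s1 : sqint leb setT (\1_U01 : R -> R).
  split; first exact: measurable_indic.
  under eq_fun do rewrite idem.
  apply: integrable_indic_lty => //.
  by rewrite [X in (X < _)%E](_ : _ = 1%E) ?ltry//; exact: leb_U01.
have s2 : sqint leb setT (fun t : R => \1_U01 t * gt (z + t *: ev)).
  split.
    exact: (measurableT_comp (measurable_segment_indic v mgt) (@pair2_measurable _ _ (measurableTypeR R) mV (z : mV))).
  by under eq_fun do rewrite exprMn idem.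
have := sqint_CauchySchwarz measurableT s2 s1.
under [X in X ^+ 2 <= _]eq_Rintegral do rewrite mulrAC -expr2 idem.
under [X in _ <= X * _]eq_Rintegral do rewrite exprMn idem.
under [X in _ <= _ * X]eq_Rintegral do rewrite idem.
rewrite E1 mulr1 => hCS; rewrite -[leRHS]fineK ?lee_fin//.
exact: integrable_fin_num iz.
Qed.

(** The weight depends on x alone and a translation in y leaves it fixed; after exchanging the
    integrals every t in [0, 1] contributes the same amount. *)
Lemma segment_weight (k : R -> R) : measurable_fun setT k -> (forall x, 0 <= k x) ->
  (\int[mu]_(z in U) (k z.1 * (w (z + ev) - w z) ^+ 2)%:E <= \int[mu]_(z in D) (k z.1 * gv v z ^+ 2)%:E)%E.
Proof.
move=> mk k0.
pose F (p : measurableTypeR R * mV) := (k p.2.1 * (\1_U01 (p.1 : R) * gt ((p.2 : V) + (p.1 : R) *: ev) ^+ 2))%:E.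
have F0 p : (0 <= F p)%E by rewrite /F lee_fin mulr_ge0// mulr_ge0 ?sqr_ge0.
have mk1 : measurable_fun (setT : set mV) (fun z : mV => k z.1) by exact: (measurableT_comp mk measurable_fst).
have mF : measurable_fun setT F.
  apply/measurable_EFinP; apply: measurable_funM.
    exact: (measurableT_comp mk1 measurable_snd).
  apply: (@measurable_segment_indic _ _ (fun z => gt z ^+ 2)); exact: measurable_funX.
have mG : measurable_fun setT (fun z : mV => \int[leb]_t F (t, z))%E.
  exact: (measurable_fun_fubini_tonelli_G F).
apply: (@le_trans _ _ (\int[mu]_(z in U) \int[leb]_t F (t, z))%E).
  apply: ae_ge0_le_integral => //.
  - by move=> z _; rewrite lee_fin mulr_ge0 ?sqr_ge0.
  - apply/measurable_EFinP; apply: measurable_funM; first exact: measurable_funS mk1.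
    apply: measurable_funX; apply: measurable_funB; last first.
      by apply: measurable_funS (sw.1) => // z [].
    apply: (@measurable_comp _ _ _ _ _ _ (D : set mV) w _ (fun z : mV => (z : V) + ev : mV)) => //.
    + by move=> _ [z [_ h] <-].
    + exact: sw.1.
    + by apply: measurable_funS (measurable_shift_xy ev).
  - by move=> z _; exact: integral_ge0.
  - exact: measurable_funS mG.
  - apply: (ae_imp _ segment_sq) => z h /h {}h.
    rewrite /F /=; under eq_integral do rewrite EFinM.
    rewrite ge0_integralZl_EFin//; last 2 first.
    + by move=> t _; rewrite lee_fin mulr_ge0 ?sqr_ge0.
    + apply/measurable_EFinP.
      have m2 : measurable_fun setT (fun p : measurableTypeR R * mV => \1_U01 (p.1 : R) * gt ((p.2 : V) + (p.1 : R) *: ev) ^+ 2).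
        by apply: (@measurable_segment_indic _ _ (fun z => gt z ^+ 2)); exact: measurable_funX.
      exact: (measurableT_comp m2 (@pair2_measurable _ _ (measurableTypeR R) mV (z : mV))).
    by rewrite EFinM; apply: lee_wpmul2l => //; rewrite lee_fin.
apply: (@le_trans _ _ (\int[nu]_z \int[leb]_t F (t, z))%E).
  by apply: ge0_subset_integral => // z _; exact: integral_ge0.
rewrite -fubini_tonelli//.
have mkg : measurable_fun (setT : set mV) (fun z => (k z.1 * gt z ^+ 2)%:E).
  by apply/measurable_EFinP; apply: measurable_funM => //; exact: measurable_funX.
have A (t : R) : (\int[nu]_z F (t, z) = (\1_U01 t)%:E * \int[mu]_z (k z.1 * gt z ^+ 2)%:E)%E.
  transitivity (\int[mu]_z (\1_U01 t * (k z.1 * gt z ^+ 2))%:E)%E.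
    transitivity (\int[mu]_z (fun z : V => (\1_U01 t * (k z.1 * gt z ^+ 2))%:E) ((z : V) + t *: ev)%R)%E.
      by apply: eq_integral => z _; rewrite /F /= scaler0 addr0; congr EFin; ring.
    apply: (@integral_shift_xy _ _ (fun z : V => (\1_U01 t * (k z.1 * gt z ^+ 2))%:E)).
    by apply/measurable_EFinP; apply: measurable_funM => //; exact/measurable_EFinP.
  under eq_integral do rewrite EFinM; rewrite ge0_integralZl_EFin//.
  by move=> z _; rewrite lee_fin mulr_ge0 ?sqr_ge0.
under eq_integral do rewrite A.
rewrite ge0_integralZr//; last 2 first.
- exact/measurable_EFinP.
- by apply: integral_ge0 => z _; rewrite lee_fin mulr_ge0 ?sqr_ge0.
rewrite [X in (X * _)%E](_ : _ = 1%E); last by rewrite integral_indic// setIT; exact: leb_U01.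
rewrite mul1e [leRHS]integral_mkcond le_eqVlt; apply/orP; left; apply/eqP.
apply: eq_integral => z _; rewrite patchE gt2E patchE.
by case: ifPn => // _; rewrite mulr0.
Qed.

End fixed_translation.

(** The inverse slice volume. It and [a] are extended by 0 off (0, 1) to be measurable on the whole
    line. *)
Let kappa : R -> R := (fun x => (e ^+ n * a x ^+ n * vol_ball R n)^-1) \_ I01.
Let at0 : R -> R := a \_ I01.

Let kappa_in x : 0 < x < 1 -> kappa x = (e ^+ n * a x ^+ n * vol_ball R n)^-1.
Proof. by move=> x01; rewrite /kappa patchE mem_set//; exact/I01P. Qed.

Let at0_in x : 0 < x < 1 -> at0 x = a x.
Proof. by move=> x01; rewrite /at0 patchE mem_set//; exact/I01P. Qed.

Let kappa_ge0 x : 0 <= kappa x.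
Proof.
rewrite /kappa patchE; case: ifPn => // /set_mem/I01P x01.
by rewrite invr_ge0 ltW// !mulr_gt0 ?exprn_gt0 ?vol_ball_gt0 ?(prof_gt0 H) ?(prof_e_gt0 H).
Qed.

Let measurable_kappa : measurable_fun (setT : set (measurableTypeR R)) kappa.
Proof.
apply/(measurable_restrictT _ (measurable_itv _)).
apply: open_continuous_measurable_fun; first exact: interval_open.
move=> x /set_mem/I01P x01; apply: cvgV; first exact: (slice_volume_neq0 n H).
apply: cvgM; last exact: cvg_cst.
apply: cvgM; first exact: cvg_cst.
apply: (@continuous_comp _ _ _ a (fun x : R => x ^+ n)); first exact: (a_continuous H).
exact: exprn_continuous.
Qed.

Let measurable_at0 : measurable_fun (setT : set (measurableTypeR R)) at0.
Proof. by apply/(measurable_restrictT _ (measurable_itv _)); exact: (measurable_a H). Qed.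

Let wt := w \_ D.
Let Gt := grad_y_sq \_ D.
Let iD : V -> R := \1_D.

Let mwt : measurable_fun (setT : set mV) wt.
Proof. by apply/(measurable_restrictT _ mD); exact: sw.1. Qed.

Let mGt : measurable_fun (setT : set mV) Gt.
Proof.
apply/(measurable_restrictT _ mD); rewrite /grad_y_sq.
by apply: measurable_sum => j; apply: measurable_funX; exact: (sg _).1.
Qed.

Let Gt_ge0 z : 0 <= Gt z.
Proof. by rewrite /Gt patchE; case: ifPn => // _; apply: sumr_ge0 => j _; exact: sqr_ge0. Qed.

Let miD : measurable_fun (setT : set mV) iD.
Proof. exact: measurable_indic. Qed.

Let sqv (v : 'rV[R]_n) : R := \sum_j v ord0 j ^+ 2.

Let msqv : measurable_fun setT sqv.
Proof. by apply: measurable_sum => j; apply: measurable_funX; exact: measurable_coord_rV. Qed.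

(** The mean of (w (x, y') - w (x, y))^2 over y' in the slice, written as an integral over the
    increment v = y' - y so that v can be held fixed. *)
Let FA (p : 'rV[R]_n * mV) : R :=
  iD p.2 * (iD ((p.2 : V) + (0, p.1)) * (kappa p.2.1 * (wt ((p.2 : V) + (0, p.1)) - wt p.2) ^+ 2)).

(** Two points of a slice differ by less than 2 e a. Restricting to such v loses nothing and makes
    the later integral over v finite. *)
Let kv (v : 'rV[R]_n) (x : R) : R :=
  if sqv v < (2 * (e * at0 x)) ^+ 2 then kappa x else 0.

Let FB (p : 'rV[R]_n * mV) : R := kv p.1 p.2.1 * (sqv p.1 * Gt p.2).

Let FA_ge0 p : 0 <= FA p.
Proof. by rewrite /FA /iD mulr_ge0// mulr_ge0// mulr_ge0// sqr_ge0. Qed.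

Let sqv_ge0 v : 0 <= sqv v.
Proof. by apply: sumr_ge0 => j _; exact: sqr_ge0. Qed.

Let kv_ge0 v x : 0 <= kv v x.
Proof. by rewrite /kv; case: ifP. Qed.

Let FB_ge0 p : 0 <= FB p.
Proof. by rewrite /FB mulr_ge0// mulr_ge0. Qed.

Let mshift : measurable_fun (setT : set ('rV[R]_n * mV)%type)
  (fun p : 'rV[R]_n * mV => (p.2 : V) + (0, p.1) : mV).
Proof.
apply: measurable_fun_pair => /=.
  under eq_fun do rewrite addr0.
  exact: (measurableT_comp measurable_fst measurable_snd).
apply: measurable_fun_rV => i; under eq_fun do rewrite !mxE.
apply: measurable_funD.
  exact: (measurableT_comp (measurable_coord_rV i) (measurableT_comp measurable_snd measurable_snd)).
exact: (measurableT_comp (measurable_coord_rV i) measurable_fst).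
Qed.

Let mx : measurable_fun (setT : set ('rV[R]_n * mV)%type) (fun p : 'rV[R]_n * mV => p.2.1).
Proof. exact: (measurableT_comp measurable_fst measurable_snd). Qed.

Let mFA : measurable_fun setT FA.
Proof.
apply: measurable_funM; first exact: (measurableT_comp miD measurable_snd).
apply: measurable_funM; first exact: (measurableT_comp miD mshift).
apply: measurable_funM; first exact: (measurableT_comp measurable_kappa mx).
apply: measurable_funX; apply: measurable_funB; first exact: (measurableT_comp mwt mshift).
exact: (measurableT_comp mwt measurable_snd).
Qed.

Let mFB : measurable_fun setT FB.
Proof.
apply: measurable_funM; last first.
  apply: measurable_funM; first exact: (measurableT_comp msqv measurable_fst).
  exact: (measurableT_comp mGt measurable_snd).
apply: measurable_fun_ifT => //; last exact: (measurableT_comp measurable_kappa mx).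
apply: measurable_fun_ltr; first exact: (measurableT_comp msqv measurable_fst).
apply: measurable_funX; apply: measurable_funM => //; apply: measurable_funM => //.
exact: (measurableT_comp measurable_at0 mx).
Qed.

Let mkv v : measurable_fun (setT : set (measurableTypeR R)) (kv v).
Proof.
apply: measurable_fun_ifT => //; apply: measurable_fun_ltr => //.
by apply: measurable_funX; apply: measurable_funM => //; apply: measurable_funM.
Qed.

Let FA_FB (v : 'rV[R]_n) : (\int[nu]_z (FA (v, z))%:E <= \int[nu]_z (FB (v, z))%:E)%E.
Proof.
pose U := [set z : V | D z /\ D (z + (0, v))].
have -> : (\int[nu]_z (FA (v, z))%:E = \int[mu]_(z in U) (kv v z.1 * (w (z + (0, v)) - w z) ^+ 2)%:E)%E.
  rewrite [RHS]integral_mkcond; apply: eq_integral => z _; rewrite patchE /FA /iD /wt /= !indicE !patchE.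
  have [/set_mem[h1 h2]|/negP nU] := boolP (z \in U).
    rewrite (mem_set (h1 : D z)) (mem_set (h2 : D (z + ((0, v) : V)))) !mul1r /kv at0_in; last by case: h1.
    rewrite ifT//; have := h1.2; have := h2.2; rewrite /= addr0 => l2 l1.
    have ev0 : 0 < e * a z.1 by apply: (ea_gt0 H); case: h1.
    have e0 := prof_e_gt0 H; have a0 := prof_gt0 H h1.1.
    rewrite -/(sqv v) /sqv -enorm_sqr_row ltr_pXn2r ?nnegrE ?enorm_ge0 ?mulr_ge0 ?ltW//.
    have {1}-> : v = (z.2 + v) + (-1) *: z.2 by rewrite scaleN1r addrAC subrr add0r.
    apply: le_lt_trans (ler_enormD _ _) _; rewrite enormZ normrN1 mul1r.
    by rewrite mulr_natl mulr2n ltrD.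
  have [zD|nz] := boolP (z \in D); last by rewrite mul0r.
  have [zD'|nz'] := boolP ((z + (0, v)) \in D); last by rewrite mul0r mulr0.
  by exfalso; apply: nU; rewrite inE; split; exact: set_mem.
apply: le_trans (segment_weight v (mkv v) (kv_ge0 v)) _.
rewrite integral_mkcond; apply: ge0_le_integral => //.
- by move=> z _; rewrite patchE; case: ifPn => // _; rewrite lee_fin mulr_ge0 ?sqr_ge0.
- apply/(measurable_restrictT _ mD); apply/measurable_EFinP; apply: measurable_funM.
    by apply: measurable_funS (measurableT_comp (mkv v) measurable_fst).
  by apply: measurable_funX; exact: (sgv v).1.
- by apply/measurable_EFinP; exact: (measurableT_comp mFB (@pair1_measurable _ _ _ mV v)).
- move=> z _; rewrite patchE /FB /Gt /= patchE; case: ifPn => zD; last by rewrite lee_fin !mulr0.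
  by rewrite lee_fin ler_wpM2l//; exact: sum_CauchySchwarz.
Qed.

(** w - M w is the mean over the slice of w (z) - w (x, y'), so its square is at most the mean of
    the squares. *)
Let FA_ge (z : V) : D z -> (((w z - M_avg a e w z.1) ^+ 2)%:E <= \int[L]_v (FA (v, z))%:E)%E.
Proof.
move=> Dz; have [z01 hz] := Dz; have zI : I01 z.1 by exact/I01P.
set c := e ^+ n * a z.1 ^+ n * vol_ball R n.
have c0 : 0 < c by rewrite !mulr_gt0 ?exprn_gt0 ?vol_ball_gt0 ?(prof_gt0 H) ?(prof_e_gt0 H).
have mB := @measurable_eball R n (e * a z.1).
have fB : (L (B z.1) < +oo)%E := lebesgue_eball_fin n (e * a z.1).
have mws : measurable_fun (B z.1) (fun y => w (z.1, y)) := measurable_section_D H zI sw.1.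
have E : (\int[L]_v (FA (v, z))%:E = c^-1%:E * \int[L]_(y in B z.1) ((w (z.1, y) - w z) ^+ 2)%:E)%E.
  rewrite -ge0_integralZl_EFin//; last 3 first.
  - by move=> y _; rewrite lee_fin sqr_ge0.
  - by apply/measurable_EFinP; apply: measurable_funX; apply: measurable_funB.
  - by rewrite invr_ge0 ltW.
  rewrite [RHS]integral_mkcond.
  have mf : measurable_fun setT ((fun y => (c^-1%:E * ((w (z.1, y) - w z) ^+ 2)%:E)%E) \_ (B z.1)).
    apply/(measurable_restrictT _ mB); under eq_fun do rewrite -EFinM.
    apply/measurable_EFinP; apply: measurable_funM => //; apply: measurable_funX.
    exact: measurable_funB.
  have := @integral_comp_preserving _ _ _ L (fun y : 'rV[R]_n => 1 *: y + z.2) 1 ltr01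
    (measurable_rV_affine 1 z.2) _ _ mf.
  rewrite mule1 => <-; last by move=> A mA; rewrite -[RHS](lebesgue_rV_affine z.2 ltr01 mA) expr1n.
  apply: eq_integral => v _; rewrite /= scale1r patchE /FA /iD /wt /= indicE mem_set// mul1r.
  have Ez : z + (0, v) = (z.1, v + z.2) by congr pair => /=; rewrite ?addr0// addrC.
  rewrite Ez indicE kappa_in// !patchE (mem_set Dz).
  have [h|h] := boolP ((z.1, v + z.2) \in D).
    by rewrite mem_set ?mul1r//; have [] := set_mem h.
  by rewrite mul0r memNset// => hB; move: h; rewrite mem_set.
(* The claim is made for every point of [D]; on slices where [w] is not square integrable the right
   side is infinite. *)
rewrite E; have [fin|] := boolP (\int[L]_(y in B z.1) ((w (z.1, y) - w z) ^+ 2)%:E < +oo)%E; last first.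
  rewrite -leNgt leye_eq => /eqP ->; rewrite gt0_muley ?leey// lte_fin invr_gt0//.
have sq : sqint L (B z.1) (fun y => w (z.1, y) - w z).
  split; first exact: measurable_funB.
  apply/integrableP; split; first by apply/measurable_EFinP; apply: measurable_funX; exact: measurable_funB.
  by under eq_integral do rewrite /= ger0_norm ?sqr_ge0//.
have s1 : sqint L (B z.1) (cst 1).
  split; first exact: measurable_cst.
  under eq_fun do rewrite expr1n; apply/integrableP; split; first exact: measurable_cst.
  by under eq_integral do rewrite /= normr1; rewrite integral_cst// mul1e.
have isq := sqint_integrable mB fB sq.
have ic k : L.-integrable (B z.1) (EFin \o (cst k : _ -> R)).
  apply/integrableP; split; first by apply/measurable_EFinP; exact: measurable_cst.
  by under eq_integral do rewrite /=; rewrite integral_cst// lte_mul_pinfty.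
have fL : fine (L (B z.1)) = c.
  by rewrite (congr1 fine (lebesgue_slice n H z01))/= /c exprMn_comm//; exact: mulrC.
have Ew : \int[L]_(y in B z.1) (w (z.1, y) - w z) = c * (M_avg a e w z.1 - w z).
  have iws : L.-integrable (B z.1) (EFin \o (fun y => w (z.1, y))).
    have := integrableD mB isq (ic (w z)).
    by apply: eq_integrable => // y _; rewrite /= -EFinD subrK.
  rewrite (RintegralB mB iws (ic (w z))) (M_avgK H w z01) Rintegral_cst// fL /c; ring.
have := sqint_CauchySchwarz mB sq s1.
under eq_Rintegral do rewrite mulr1.
under [X in _ <= _ * X]eq_Rintegral do rewrite expr1n.
rewrite Ew Rintegral_cst// mul1r fL => hCS.
have [_ isx] := sq.
rewrite -[X in (_ * X)%E]fineK; last exact: integrable_fin_num isx.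
rewrite -EFinM lee_fin -/(Rintegral L (B z.1) (fun y => (w (z.1, y) - w z) ^+ 2)).
rewrite mulrC ler_pdivlMr// -(ler_pM2r c0); apply: le_trans hCS.
by rewrite le_eqVlt; apply/orP; left; apply/eqP; ring.
Qed.

(** The ball |v| < 2 e a has 2^n times the volume of the slice, and on it |v|^2 is below (2 e a)^2
    <= (2 e M)^2: the two factors of the Poincare constant. *)
Let FB_le (z : V) : (\int[L]_v (FB (v, z))%:E <= (2 ^+ n * (2 * (e * M)) ^+ 2 * Gt z)%:E)%E.
Proof.
have [Dz|nz] := boolP (z \in D); last first.
  rewrite (_ : Gt z = 0); last by rewrite /Gt patchE (negbTE nz).
  rewrite mulr0 integral0_eq// => v _; rewrite /FB /Gt /= patchE (negbTE nz) !mulr0//.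
have [z01 hz] := set_mem Dz; have a0 := prof_gt0 H z01; have e0 := prof_e_gt0 H.
have ea0 := ea_gt0 H z01.
have r0 : 0 < 2 * (e * a z.1) by rewrite mulr_gt0.
pose C := kappa z.1 * (2 * (e * a z.1)) ^+ 2 * Gt z.
have C0 : 0 <= C by rewrite mulr_ge0// mulr_ge0// sqr_ge0.
apply: (@le_trans _ _ (\int[L]_v (C * \1_(@eball R n (2 * (e * a z.1))) v)%:E)%E).
  apply: ge0_le_integral => //.
  - by move=> v _; rewrite lee_fin.
  - by apply/measurable_EFinP; exact: (measurableT_comp mFB (@pair2_measurable _ _ _ mV z)).
  - apply/measurable_EFinP; apply: measurable_funM => //; apply: measurable_indic.
    exact: measurable_eball.
  - move=> v _; rewrite lee_fin /FB /kv /= at0_in//; case: ifPn => hv; last by rewrite mul0r mulr_ge0.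
    have hv' : @eball R n (2 * (e * a z.1)) v.
      move: hv; rewrite /sqv -enorm_sqr_row ltr_pXn2r ?nnegrE ?enorm_ge0//; exact: ltW.
    rewrite indicE mem_set// mulr1 /C -mulrA ler_wpM2l// ler_wpM2r//; exact: ltW.
under eq_integral do rewrite EFinM.
rewrite ge0_integralZl_EFin//; last first.
  by apply/measurable_EFinP; apply: measurable_indic; exact: measurable_eball.
rewrite integral_indic//; last exact: measurable_eball.
rewrite setIT.
rewrite [X in (_ * X <= _)%E](_ : _ = ((2 * (e * a z.1)) ^+ n * vol_ball R n)%:E); last exact: lebesgue_eball.
rewrite -EFinM lee_fin /C kappa_in//.
have v0 := vol_ball_gt0 R n.
have -> : (e ^+ n * a z.1 ^+ n * vol_ball R n)^-1 * (2 * (e * a z.1)) ^+ 2 * Gt z *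
    ((2 * (e * a z.1)) ^+ n * vol_ball R n) = 2 ^+ n * (2 * (e * a z.1)) ^+ 2 * Gt z.
  rewrite [(2 * (e * a z.1)) ^+ n]exprMn_comm; last exact: mulrC.
  rewrite [(e * a z.1) ^+ n]exprMn_comm; last exact: mulrC.
  by field; rewrite !expf_neq0 ?gt_eqF.
rewrite ler_wpM2r// ler_wpM2l ?exprn_ge0//.
rewrite ler_pXn2r ?nnegrE ?mulr_ge0 ?(ltW r0) ?(ltW e0) ?(ltW a0) ?(ltW (prof_M_gt0 H))//.
rewrite ler_wpM2l// ler_wpM2l ?(ltW e0)//.
by have := prof_le H z01; rewrite (gtr0_norm a0).
Qed.

Lemma poincare : \int[mu]_(z in D) (w z - M_avg a e w z.1) ^+ 2 <=
  2 ^+ n * (2 * (e * M)) ^+ 2 * \int[mu]_(z in D) grad_y_sq z.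
Proof.
have sM := (M_avg_le H sw).1.
have [mwM iwM] : sqint mu D (fun z => w z - M_avg a e w z.1) := sqintB mD sw sM.
have [mG iG] : measurable_fun (D : set mV) grad_y_sq /\ mu.-integrable D (EFin \o grad_y_sq).
  rewrite /grad_y_sq; split.
    by apply: measurable_sum => j; apply: measurable_funX; exact: (sg _).1.
  by have [] := Rintegral_sum (index_enum 'I_n) mD (fun j => (sg (rshift 1 j)).2).
have c0 : 0 <= 2 ^+ n * (2 * (e * M)) ^+ 2 by rewrite mulr_ge0 ?sqr_ge0 ?exprn_ge0.
have icG := integrableZl mD (2 ^+ n * (2 * (e * M)) ^+ 2) iG.
rewrite -(RintegralZl _ mD iG).
apply: fine_le.
- by have := integrable_fin_num mD iwM.
- by have := integrable_fin_num mD icG.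
have mFAz : measurable_fun (setT : set mV) (fun z => \int[L]_v (FA (v, z))%:E)%E.
  by apply: (measurable_fun_fubini_tonelli_G (EFin \o FA)) => [|p]; [exact/measurable_EFinP|rewrite lee_fin].
have mFBz : measurable_fun (setT : set mV) (fun z => \int[L]_v (FB (v, z))%:E)%E.
  by apply: (measurable_fun_fubini_tonelli_G (EFin \o FB)) => [|p]; [exact/measurable_EFinP|rewrite lee_fin].
apply: (@le_trans _ _ (\int[mu]_(z in D) \int[L]_v (FA (v, z))%:E)%E).
  apply: ge0_le_integral => //.
  - by move=> z _; rewrite lee_fin sqr_ge0.
  - by apply/measurable_EFinP; apply: measurable_funX.
  - exact: measurable_funS mFAz.
apply: (@le_trans _ _ (\int[nu]_z \int[L]_v (FA (v, z))%:E)%E).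
  by apply: ge0_subset_integral => // z _; apply: integral_ge0 => v _; rewrite lee_fin.
(* The segment estimate works for fixed v, so v becomes the outer variable here and the inner one
   again afterwards. *)
rewrite -(fubini_tonelli (EFin \o FA)); last 2 first.
- exact/measurable_EFinP.
- by move=> p; rewrite lee_fin.
apply: (@le_trans _ _ (\int[L]_v \int[nu]_z (FB (v, z))%:E)%E).
  apply: ge0_le_integral => //.
  - by move=> v _; apply: integral_ge0 => z _; rewrite lee_fin.
  - by apply: (measurable_fun_fubini_tonelli_F (EFin \o FA)) => [|p]; [exact/measurable_EFinP|rewrite lee_fin].
  - by apply: (measurable_fun_fubini_tonelli_F (EFin \o FB)) => [|p]; [exact/measurable_EFinP|rewrite lee_fin].
  - by move=> v _; exact: FA_FB.
rewrite (fubini_tonelli (EFin \o FB)); last 2 first.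
- exact/measurable_EFinP.
- by move=> p; rewrite lee_fin.
rewrite [leRHS]integral_mkcond; apply: ge0_le_integral => //.
- by move=> z _; apply: integral_ge0 => v _; rewrite lee_fin.
- apply/(measurable_restrictT _ mD); apply/measurable_EFinP; exact: measurable_funM.
- move=> z _; apply: le_trans (FB_le z) _; rewrite patchE /Gt patchE.
  by case: ifPn => // _; rewrite mulr0.
Qed.

End slices.

(** * Changing an integrand on a null set *)

Section integral_modification.
Context d (T : measurableType d) (R : realType) (mu : {measure set T -> \bar R}).
Import HBNNSimple.

(* No measurability is needed: the integral is a supremum over simple functions,
   and these can be set to [0] on [N]. This is applied to the limit of the
   coefficient series, which is arbitrary where the series diverges. *)
Lemma integral_null_change (N D : set T) (f g : T -> \bar R) : measurable N -> mu N = 0%E ->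
  (forall x, D x -> ~ N x -> f x = g x) ->
  (\int[mu]_(x in D) f x = \int[mu]_(x in D) g x)%E.
Proof.
move=> mN N0.
have le_aux (F G : T -> \bar R) : (forall x, 0 <= F x)%E -> (forall x, 0 <= G x)%E ->
    (forall x, ~ N x -> F x = G x) -> (\int[mu]_x F x <= \int[mu]_x G x)%E.
  move=> F0 G0 FG; rewrite ge0_integralTE// [leRHS]ge0_integralTE//.
  apply: ge_ereal_sup => _ [h hF <-].
  have mNc := measurableC mN.
  apply: ereal_sup_ubound; exists (mul_nnsfun h (indic_nnsfun R mNc)) => /=.
    move=> x; rewrite /mindic indicE; have [/set_mem Nx|/negP Nx] := boolP (x \in ~` N).
      by rewrite mulr1 -FG.
    by rewrite mulr0.
  rewrite -!integralT_nnsfun; apply: ae_eq_integral => //.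
  - by apply/measurable_EFinP; exact: measurable_funP.
  - by apply/measurable_EFinP; exact: measurable_funP.
  exists N; split => // x /= nx; apply: contrapT => Nx; apply: nx => _.
  by rewrite /mindic indicE mem_set// mulr1.
have eq_aux (F G : T -> \bar R) : (forall x, 0 <= F x)%E -> (forall x, 0 <= G x)%E ->
    (forall x, D x -> ~ N x -> F x = G x) -> (\int[mu]_(x in D) F x = \int[mu]_(x in D) G x)%E.
  move=> F0 G0 FG; rewrite integral_mkcond [RHS]integral_mkcond.
  have p0 K x : (forall x, 0 <= K x)%E -> (0 <= (K \_ D) x)%E by move=> K0; rewrite patchE; case: ifP.
  have FGD x : ~ N x -> (F \_ D) x = (G \_ D) x.
    by move=> Nx; rewrite !patchE; case: ifPn => // /set_mem Dx; rewrite FG.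
  apply/eqP; rewrite eq_le; apply/andP; split; apply: le_aux => x; rewrite ?p0//.
    by move=> /FGD ->.
  by move=> /FGD ->.
move=> fg; rewrite integralE [RHS]integralE.
congr (_ - _)%E; apply: eq_aux => // x Dx Nx; first by rewrite !funeposE fg.
by rewrite !funenegE fg.
Qed.

End integral_modification.

(** * Coefficients *)

Section opnorm.
Context (R : realType).

Lemma enorm_mul_le p q (A : 'M[R]_(p, q)) (xi : 'cV[R]_q) : enorm (A *m xi) <= enorm A * enorm xi.
Proof.
rewrite -(ler_pXn2r (n := 2))// ?nnegrE ?mulr_ge0 ?enorm_ge0// exprMn !enorm_sqr mulr_suml.
apply: ler_sum => i _; rewrite big_ord1 mxE; apply: le_trans (sum_CauchySchwarz _ _) _.
by rewrite ler_wpM2l ?sumr_ge0// => [j _|]; rewrite ?sqr_ge0//; apply: ler_sum => j _; rewrite big_ord1.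
Qed.

(** Bounded by the Frobenius norm, so the supremum in [opnorm] is a genuine one. *)
Lemma opnorm_has_sup p (A : 'M[R]_p) :
  has_sup [set enorm (A *m xi) | xi in [set xi : 'cV[R]_p | enorm xi <= 1]].
Proof.
split; first by exists (enorm (A *m (0 : 'cV[R]_p))), 0 => //=; rewrite enorm0.
exists (enorm A) => _ [xi /= h <-]; apply: le_trans (enorm_mul_le _ _) _.
by rewrite ler_piMr ?enorm_ge0.
Qed.

Lemma opnormP p (A : 'M[R]_p) (xi : 'cV[R]_p) : enorm (A *m xi) <= opnorm A * enorm xi.
Proof.
have [x0|x0] := eqVneq (enorm xi) 0.
  by have := enorm_mul_le A xi; rewrite x0 !mulr0.
have xp : 0 < enorm xi by rewrite lt_def x0 enorm_ge0.
rewrite -ler_pdivrMr//.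
have -> : enorm (A *m xi) / enorm xi = enorm (A *m ((enorm xi)^-1 *: xi)).
  by rewrite -scalemxAr enormZ ger0_norm ?invr_ge0 ?enorm_ge0// mulrC.
apply: sup_upper_bound; first exact: opnorm_has_sup.
exists ((enorm xi)^-1 *: xi) => //=.
by rewrite enormZ ger0_norm ?invr_ge0 ?enorm_ge0// mulVf.
Qed.

Lemma opnorm_ge0 p (A : 'M[R]_p) : 0 <= opnorm A.
Proof.
have -> : 0 = enorm (A *m (0 : 'cV[R]_p)) by rewrite mulmx0 enorm0.
apply: sup_upper_bound; first exact: opnorm_has_sup.
by exists 0 => //=; rewrite enorm0.
Qed.

Lemma enorm_delta p (j : 'I_p) : enorm (delta_mx j ord0 : 'cV[R]_p) = 1.
Proof.
apply/eqP; rewrite -(eqrXn2 (n := 2))// ?enorm_ge0// expr1n enorm_sqr_col (bigD1 j)//= big1.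
  by rewrite mxE !eqxx addr0 expr1n.
by move=> i ij; rewrite mxE (negbTE ij) expr0n.
Qed.

Lemma opnorm_entry p (A : 'M[R]_p) i j : `|A i j| <= opnorm A.
Proof.
have := opnormP A (delta_mx j ord0); rewrite enorm_delta mulr1; apply: le_trans.
have -> : A i j = (A *m (delta_mx j ord0 : 'cV[R]_p)) i ord0 by rewrite -colE mxE.
exact: ler_enorm.
Qed.

Lemma opnorm_form p (A : 'M[R]_p) (C : R) (xi eta : 'cV[R]_p) : opnorm A <= C ->
  `|edot (A *m xi) eta| <= C * enorm xi * enorm eta.
Proof.
move=> AC; apply: le_trans (edot_CauchySchwarz _ _) _; rewrite ler_wpM2r ?enorm_ge0//.
by apply: le_trans (opnormP _ _) _; rewrite ler_wpM2r ?enorm_ge0.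
Qed.

End opnorm.

Section coefficient_series.
Context (R : realType) (p : nat).
Variables (A_ : nat -> 'M[R]_p) (C e : R).
Hypotheses (AC : forall k, opnorm (A_ k) <= C) (e_gt0 : 0 < e) (e_lt1 : e < 1).

Let C_ge0 : 0 <= C. Proof. exact: le_trans (opnorm_ge0 _) (AC 0). Qed.

Let S := series (fun k => e ^+ k *: A_ k).

Let entry_cvg i j : cvgn (fun m => S m i j).
Proof.
have -> : (fun m => S m i j) = series (fun k => e ^+ k * A_ k i j).
  by apply/funext => m; rewrite /S /series/= summxE; apply: eq_bigr => k _; rewrite mxE.
apply: normed_cvg; apply: (@series_le_cvg _ _ (geometric C e)).
- by move=> k /=.
- by move=> k; rewrite /geometric/= mulr_ge0// exprn_ge0// ltW.
- move=> k; rewrite /geometric/= normrM ger0_norm ?exprn_ge0 ?(ltW e_gt0)// mulrC.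
  rewrite ler_wpM2r ?exprn_ge0 ?(ltW e_gt0)//.
  exact: le_trans (opnorm_entry _ _ _) (AC k).
- by apply: is_cvg_geometric_series; rewrite ger0_norm ?ltW.
Qed.

(** The entries converge by comparison with the geometric series of C e^k, and the matrix of their
    limits is a limit in the max norm; hence [limn S] is a true limit. *)
Lemma coefficient_cvg_entry i j : (S m) i j @[m --> \oo] --> (limn S) i j.
Proof.
pose B : 'M[R]_p := \matrix_(i, j) limn (fun m => S m i j).
have SB : S @ \oo --> B.
  apply/cvg_ballP => r r0.
  have near_entries : \forall m \near \oo, forall ij : 'I_p * 'I_p, ball (B ij.1 ij.2) r (S m ij.1 ij.2).
    apply: filter_forall => ij.
    have h : (fun m => S m ij.1 ij.2) @ \oo --> B ij.1 ij.2 by rewrite mxE; exact: entry_cvg.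
    by have /cvg_ballP/(_ r r0) := h.
  by apply: filterS near_entries => m hm; split => // i' j'; exact: (hm (i', j')).
have -> : limn S = B by apply: cvg_lim SB.
by rewrite mxE; exact: entry_cvg.
Qed.

Lemma cvg_bigsum (I : Type) (s : seq I) (u : I -> R ^nat) (l : I -> R) :
  (forall i, u i m @[m --> \oo] --> l i) ->
  \sum_(i <- s) u i m @[m --> \oo] --> \sum_(i <- s) l i.
Proof.
move=> h; elim: s => [|i s IH].
  by rewrite big_nil; under eq_fun do rewrite big_nil; exact: cvg_cst.
by rewrite big_cons; under eq_fun do rewrite big_cons; apply: cvgD.
Qed.

(** The terms with k >= 1 are bounded by C e^k, and their geometric sum is e C / (1 - e); a closed
    bound passes to the limit. *)
Lemma coefficient_perturbation (xi eta : 'cV[R]_p) :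
  `|edot ((limn S - A_ 0) *m xi) eta| <= e * C / (1 - e) * enorm xi * enorm eta.
Proof.
have e1 : 0 < 1 - e by rewrite subr_gt0.
(* The index [m.+1] guarantees that the term k = 0 is present and can be split off. *)
have lim : edot ((S m.+1 - A_ 0) *m xi) eta @[m --> \oo] --> edot ((limn S - A_ 0) *m xi) eta.
  rewrite edotE; under eq_fun do rewrite edotE.
  apply: cvg_bigsum => i; apply: cvgM; last exact: cvg_cst.
  rewrite mxE; under eq_fun do rewrite mxE.
  apply: cvg_bigsum => j; apply: cvgM; last exact: cvg_cst.
  rewrite mxE [(- A_ 0) i j]mxE; under eq_fun do rewrite mxE [(- A_ 0) i j]mxE.
  apply: cvgB; last exact: cvg_cst.
  by rewrite (cvg_shiftS (fun m => S m i j)); exact: coefficient_cvg_entry.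
have bound m : `|edot ((S m.+1 - A_ 0) *m xi) eta| <= e * C / (1 - e) * enorm xi * enorm eta.
  have -> : S m.+1 - A_ 0 = \sum_(0 <= k < m) e ^+ k.+1 *: A_ k.+1.
    by rewrite /S /series/= big_nat_recl// expr0 scale1r addrAC subrr add0r.
  have sumE : edot ((\sum_(0 <= k < m) e ^+ k.+1 *: A_ k.+1) *m xi) eta =
      \sum_(0 <= k < m) e ^+ k.+1 * edot (A_ k.+1 *m xi) eta.
    rewrite mulmx_suml; elim: (index_iota 0 m) => [|k s IH].
      by rewrite !big_nil edotE big1// => i _; rewrite mxE mul0r.
    by rewrite !big_cons edotDl IH -scalemxAl edotZl.
  rewrite sumE; apply: le_trans (ler_norm_sum _ _ _) _.
  apply: (@le_trans _ _ (\sum_(0 <= k < m) (e * C * e ^+ k) * (enorm xi * enorm eta))).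
    apply: ler_sum => k _; rewrite normrM ger0_norm ?exprn_ge0 ?(ltW e_gt0)//.
    rewrite exprS [e * C * _]mulrAC -!mulrA !ler_wpM2l ?exprn_ge0 ?(ltW e_gt0)//.
    by rewrite mulrA; exact: opnorm_form.
  rewrite -mulr_suml -[leRHS]mulrA ler_wpM2r ?mulr_ge0 ?enorm_ge0//.
  have := geometric_seriesE (e * C) (negbT (lt_eqF e_lt1)).
  move=> /(congr1 (@^~ m)); rewrite /series/= => ->.
  rewrite ler_wpM2r ?invr_ge0 ?(ltW e1)// ler_piMr ?mulr_ge0 ?(ltW e_gt0)//.
  by rewrite gerBl exprn_ge0 ?ltW.
apply: (@closed_cvg _ _ _ _ _ [set x : R | `|x| <= e * C / (1 - e) * enorm xi * enorm eta] _ _ _ lim).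
  rewrite (_ : mkset _ = (fun x : R => `|x|) @^-1` [set x | x <= e * C / (1 - e) * enorm xi * enorm eta])//.
  apply: closed_comp; last exact: closed_le.
  by move=> x _; exact: norm_continuous.
by apply: nearW => m; exact: bound.
Qed.

End coefficient_series.

Section coefficients.
Context (R : realType) (n : nat) (a a' : R -> R) (M e e0 alpha0 C0 : R).
Variables (A1 : nat -> R -> R) (A2 : nat -> R * 'rV[R]_n -> 'cV[R]_n)
  (A3 : nat -> R * 'rV[R]_n -> 'M[R]_n).
Hypotheses (H : thin_profile a a' M e) (adm : admissible a A1 A2 A3 e0 alpha0 C0)
  (e_le : e <= e0) (e0_lt1 : e0 < 1).
Local Notation V := (R * 'rV[R]_n)%type.
Local Notation mV := (measurableTypeR R * 'rV[R]_n)%type.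
Local Notation mu := (@lebesgue_xy R n).
Local Notation D := (@thin R n a e).
Local Notation Omega := (@thin R n a 1).
Local Notation A_ := (A_coef A1 A2 A3).
Let e_gt0 : 0 < e := prof_e_gt0 H.
Let e0_gt0 : 0 < e0 := lt_le_trans e_gt0 e_le.

Let profile1 : thin_profile a a' M 1.
Proof. by case: H => *; apply: ThinProfile. Qed.

Let sc (z : V) : V := (z.1, e^-1 *: z.2).

Lemma scale_thin z : D z -> Omega (sc z).
Proof.
move=> [z01 hz]; split => //; rewrite /eball/= enormZ ger0_norm ?invr_ge0 ?(ltW e_gt0)// mul1r.
by rewrite mulrC ltr_pdivrMr// mulrC.
Qed.

Lemma measurable_scale : measurable_fun (setT : set mV) (sc : mV -> mV).
Proof.
have := @measurable_xy_affine R n 1 e^-1 0; congr (measurable_fun _ _).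
by apply/funext => z; rewrite /sc /= mul1r !addr0.
Qed.

(** The coefficients are bounded almost everywhere in the fixed domain but are evaluated at (x,
    y/e), so exceptional sets have to be pulled back. *)
Lemma scale_null (N : set mV) : measurable N -> mu N = 0%E -> mu (sc @^-1` N) = 0%E.
Proof.
move=> mN N0; have ei : 0 < e^-1 by rewrite invr_gt0.
have := @lebesgue_xy_affine R n 1 e^-1 0 N ltr01 ei mN.
rewrite N0 mul1r (_ : (fun z : mV => _) = sc); last first.
  by apply/funext => z; rewrite /sc /= mul1r !addr0.
move=> /eqP; rewrite mule_eq0 eqe => /orP[/eqP//|]; rewrite expf_eq0 invr_eq0 gt_eqF ?andbF//.
Qed.

(** Countably many exceptional sets are merged, so that the whole series is controlled at one and
    the same point. *)
Lemma coefficient_bound_ae : {ae mu, forall z, Omega z -> forall k, opnorm (A_ k z) <= C0}.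
Proof.
(* The norm with infinite exponent is the essential supremum only if the whole space has positive
   measure. *)
have mu0 : (0 < mu setT)%E.
  apply: (@lt_le_trans _ _ (mu [set z : V | `|z| < 1])); last first.
    by apply: le_measure; rewrite ?inE//; exact: measurable_ball_xy.
  by rewrite lebesgue_xy_ball// lte_fin mulr_gt0// exprn_gt0// mulr1.
have hk k : {ae mu, forall z, Omega z -> opnorm (A_ k z) <= C0}.
  have := adm_bound adm k; rewrite /Linfty_norm unlock mu0 => /ess_supP; apply: ae_imp => z.
  rewrite /= patchE; case: ifPn => [_|/negP nz]; last by move=> _ zO; exfalso; apply: nz; rewrite inE.
  by rewrite lee_fin => h _; apply: le_trans h; exact: ler_norm.
by apply: ae_imp (ae_foralln hk) => z h zO k; exact: h.
Qed.

Lemma A0_corner z : A_ 0 z (lshift n ord0) (lshift n ord0) = A1 0 z.1.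
Proof. by rewrite /A_coef block_mxEul mxE eqxx. Qed.

(** Coercivity of A_0 at the centre of the slice, tested with the first basis vector. *)
Lemma A01_ge x : 0 < x < 1 -> alpha0 <= A1 0 x.
Proof.
move=> x01; have O : Omega (x, 0).
  by split => //; rewrite /eball/= enorm0 mul1r (prof_gt0 H).
have := adm_A0_coercive adm O (delta_mx (lshift n ord0) ord0).
rewrite enorm_delta expr1n mulr1 edotE (bigD1 (lshift n ord0))//= big1.
  rewrite addr0 [X in X * _](_ : _ = A1 0 x); last by rewrite -colE mxE A0_corner.
  by rewrite [X in _ * X]mxE !eqxx mulr1.
by move=> i hi; rewrite [X in _ * X]mxE (negbTE hi) mulr0.
Qed.

Lemma A01_continuous x : 0 < x < 1 -> {for x, continuous (A1 0)}.
Proof. by move=> x01; exact: (adm_A01_smooth adm [::] ((I01P x).2 x01)).1. Qed.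

(** The essential bound holds pointwise by continuity: a violation would persist on an open set,
    which contains a ball of positive measure yet lies in a null set. *)
Lemma A01_le x : 0 < x < 1 -> A1 0 x <= C0.
Proof.
move=> x01; rewrite leNgt; apply/negP => hx.
pose U := [set z : V | Omega z /\ 0 < A1 0 z.1 - C0].
have oU : open U.
  apply: open_lt_on; first exact: (thin_open profile1).
  move=> z /set_mem[z01 _]; apply: cvgB; last exact: cvg_cst.
  exact: (@fst_continuous_at _ _ (A1 0) _ (A01_continuous z01)).
have Ux : U (x, 0).
  by split; [split => //; rewrite /eball/= enorm0 mul1r (prof_gt0 H)|rewrite subr_gt0].
have [N [mN N0 hN]] := coefficient_bound_ae.
have UN : U `<=` N.
  move=> z [Oz hz]; apply: hN => /(_ Oz 0) h; move: hz; rewrite subr_gt0 ltNge => /negP; apply.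
  by rewrite -A0_corner; apply: le_trans h; exact: le_trans (ler_norm _) (opnorm_entry _ _ _).
have mU := open_measurable_xy oU.
have U0 : mu U = 0%E by apply/eqP; rewrite eq_le measure_ge0 andbT -N0 le_measure ?inE.
have /nbhs_ballP[r /= r0 hr] := open_nbhs_nbhs (conj oU Ux).
pose Bx := (fun z : V => z + (- ((x, 0) : V))) @^-1` [set z : V | `|z| < r].
have bU : Bx `<=` U.
  by move=> z /= hz; apply: hr; rewrite -ball_normE/= distrC.
have := @lebesgue_xy_shift R n (- ((x, 0) : V)) _ (@measurable_ball_xy R n r).
rewrite mule1 lebesgue_xy_ball// => hb.
have : (mu Bx <= mu U)%E.
  apply: le_measure => //; rewrite ?inE//.
  rewrite -[X in measurable X]setTI; apply: measurable_shift_xy => //; exact: measurable_ball_xy.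
by rewrite hb U0 lee_fin leNgt mulr_gt0// ?exprn_gt0// mulr_gt0.
Qed.

Lemma A0_grad_x (du : R -> R) (z z' : V) (eta : 'cV[R]_(1 + n)) : Omega z -> z.1 = z'.1 ->
  edot (A_ 0 z *m grad_x du z') eta = A1 0 z.1 * du z.1 * eta (lshift n ord0) ord0.
Proof.
move=> Oz zz'; have E i : (A_ 0 z *m grad_x du z') i ord0 = A_ 0 z i (lshift n ord0) * du z.1.
  rewrite mxE big_split_ord/= big_ord1 [X in _ + X]big1 ?addr0.
    by rewrite /grad_x mxE (unsplitK (inl ord0)) zz'.
  by move=> j _; rewrite /grad_x mxE (unsplitK (inr j)) mulr0.
rewrite edotE big_split_ord/= big_ord1 E A0_corner [X in _ + X]big1 ?addr0// => j _.
by rewrite E /A_coef block_mxEdl (adm_A0_diag adm Oz) mxE !mul0r.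
Qed.

Lemma measurable_A01 : measurable_fun (`]0%R, 1%R[%classic : set R) (A1 0).
Proof.
apply: open_continuous_measurable_fun; first exact: interval_open.
by move=> x /set_mem/I01P; exact: A01_continuous.
Qed.

Let K := C0 / (1 - e0).

(** Read off at x = 1/2, where A_01 lies between [alpha0] and [C0]. *)
Lemma C0_ge0 : 0 <= C0.
Proof.
have h : 0 < (2^-1 : R) < 1 by rewrite invr_gt0 ltr0n/= invf_lt1// ltr1n.
apply: le_trans (A01_le h); apply: le_trans (A01_ge h); exact/ltW/(adm_alpha0_gt0 adm).
Qed.

Let perturb_le : e * C0 / (1 - e) <= e * K.
Proof.
have h1 : 0 < 1 - e0 by rewrite subr_gt0.
have h2 : 0 < 1 - e by rewrite subr_gt0 (le_lt_trans e_le).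
rewrite /K mulrA ler_wpM2l ?mulr_ge0 ?C0_ge0 ?(ltW e_gt0)//.
by rewrite lef_pV2 ?posrE// lerD2l lerN2.
Qed.

Lemma enorm_grad_x (du : R -> R) (z : V) : enorm (grad_x du z) = `|du z.1|.
Proof.
apply/eqP; rewrite -(eqrXn2 (n := 2))// ?enorm_ge0// enorm_sqr_col big_split_ord/= big_ord1.
rewrite /grad_x mxE (unsplitK (inl ord0)) big1 ?addr0 ?real_normK ?num_real// => j _.
by rewrite mxE (unsplitK (inr j)) expr0n.
Qed.

(** Replaces A_eps by a field whose entries are measurable and whose bounds hold at every point,
    without changing the integrals of the weak form. In the last clause A_0 enters through A_01
    alone, since it is block diagonal and the vector has no y-component. *)
Lemma coefficient_ex : exists At : V -> 'M[R]_(1 + n),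
  [/\ forall i j, measurable_fun (D : set mV) (fun z => At z i j),
   forall (xi eta : V -> 'cV[R]_(1 + n)) (h : V -> R),
     \int[mu]_(z in D) (edot (A_eps A1 A2 A3 e (z.1, e^-1 *: z.2) *m xi z) (eta z) + h z) =
     \int[mu]_(z in D) (edot (At z *m xi z) (eta z) + h z),
   forall z i j, D z -> `|At z i j| <= C0 + e * K,
   forall z, D z -> forall xi, (alpha0 - e0 * C0 / (1 - e0)) * enorm xi ^+ 2 <= edot (At z *m xi) xi &
   forall z, D z -> forall du eta,
     `|edot (At z *m grad_x du z) eta - A1 0 z.1 * du z.1 * eta (lshift n ord0) ord0| <=
       e * K * `|du z.1| * enorm eta].
Proof.
have [N [mN N0 hN]] := coefficient_bound_ae.
have K0 : 0 <= K by rewrite /K divr_ge0 ?C0_ge0// subr_ge0 ltW.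
have eK0 : 0 <= e * K by rewrite mulr_ge0// ltW.
have e_lt1 : e < 1 by exact: le_lt_trans e_le e0_lt1.
pose N' := sc @^-1` N.
have mN' : measurable (N' : set mV) by rewrite -[X in measurable X]setTI; exact: measurable_scale.
have N'0 : mu N' = 0%E by exact: scale_null.
have good z : D z -> ~ N' z -> forall k, opnorm (A_ k (sc z)) <= C0.
  move=> Dz nz k; apply: contrapT => hk; apply: nz; apply: hN => h; apply: hk.
  by apply: h; exact: scale_thin.
pose Ae z := A_eps A1 A2 A3 e (sc z).
have pert z : D z -> ~ N' z -> forall xi eta,
    `|edot ((Ae z - A_ 0 (sc z)) *m xi) eta| <= e * K * enorm xi * enorm eta.
  move=> Dz nz xi eta.
  apply: le_trans (coefficient_perturbation (good z Dz nz) e_gt0 e_lt1 xi eta) _.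
  by rewrite ler_wpM2r ?enorm_ge0// ler_wpM2r ?enorm_ge0.
have AeE z xi : Ae z *m xi = A_ 0 (sc z) *m xi + (Ae z - A_ 0 (sc z)) *m xi.
  by rewrite -mulmxDl addrC subrK.
(* On the exceptional set a scalar matrix has all the required properties. *)
pose At z := if z \in N' then (A1 0 z.1)%:M else Ae z.
exists At; split => //.
- move=> i j; pose S k z := series (fun k => e ^+ k *: A_ k (sc z)) k i j.
  have mA k : measurable_fun (D : set mV) (fun z : mV => A_ k (sc z) i j).
    apply: (@measurable_comp _ _ _ _ _ _ (Omega : set mV) (fun z : mV => A_ k z i j) _ (sc : mV -> mV)).
    + exact: (thin_measurable profile1).
    + by move=> _ [z Dz <-]; exact: scale_thin.
    + exact: (adm_meas adm).
    + by apply: measurable_funS measurable_scale.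
  have mI : measurable_fun (D : set mV) (fun z : V => ((A1 0 z.1)%:M : 'M[R]_(1 + n)) i j).
    have -> : (fun z : V => ((A1 0 z.1)%:M : 'M[R]_(1 + n)) i j) = (fun z : V => (if i == j then A1 0 else cst 0) z.1).
      by apply/funext => z; rewrite mxE; case: (i == j); rewrite ?mulr1n ?mulr0n.
    by apply: measurable_fst_D; case: (i == j) => //; exact: measurable_A01.
  (* Partial sums, replaced by the same scalar matrix on the exceptional set, converge everywhere on
     [D]. *)
  apply: (measurable_fun_cvg (h := fun k z => if z \in N' then (A1 0 z.1)%:M i j else S k z)).
    move=> k; apply: measurable_fun_if => //.
    + exact: (thin_measurable H).
    + apply: (measurable_fun_bool true); rewrite (_ : _ @^-1` _ = N').
        by apply: measurableI => //; exact: (thin_measurable H).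
      by apply/seteqP; split => [w /= /set_mem//|w h]; exact: mem_set.
    + by apply: measurable_funS mI; [exact: (thin_measurable H)|move=> z []].
    + apply: measurable_funS (_ : measurable_fun (D : set mV) _); [exact: (thin_measurable H)|by move=> z []|].
      rewrite /S /series/=; under eq_fun do rewrite summxE.
      by apply: measurable_sum => l; under eq_fun do rewrite mxE; exact: measurable_funM.
  move=> z Dz; rewrite /At; case: ifPn => zN; first exact: cvg_cst.
  have nz : ~ N' z by move=> h; move: zN; rewrite mem_set.
  exact: coefficient_cvg_entry (good z Dz nz) e_gt0 e_lt1 i j.
- move=> xi eta h; congr fine; apply: (integral_null_change mN' N'0) => z Dz nz.
  by rewrite /At memNset.
- move=> z i j Dz; rewrite /At; case: ifPn => zN.
    rewrite mxE; case: (i == j); rewrite ?mulr0n ?normr0 ?addr_ge0 ?C0_ge0// mulr1n.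
    rewrite ger0_norm; first by rewrite ler_wpDr// A01_le//; case: Dz.
    by apply: le_trans (ltW (adm_alpha0_gt0 adm)) _; apply: A01_ge; case: Dz.
  have nz : ~ N' z by move=> h; move: zN; rewrite mem_set.
  rewrite -[Ae z](subrK (A_ 0 (sc z))) mxE addrC; apply: le_trans (ler_normD _ _) _.
  apply: lerD; first exact: le_trans (opnorm_entry _ _ _) (good z Dz nz 0).
  have := pert z Dz nz (delta_mx j ord0) (delta_mx i ord0).
  rewrite !enorm_delta !mulr1; apply: le_trans.
  rewrite edotE (bigD1 i)//= big1 => [|k ki]; last by rewrite [X in _ * X]mxE (negbTE ki) mulr0.
  by rewrite addr0 [X in _ * X]mxE !eqxx mulr1 -colE [X in _ <= `|X|]mxE.
- move=> z Dz xi.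
  (* Passing from [e] to [e0] makes the coercivity constant independent of [e]. *)
  have h2 : e * K * enorm xi * enorm xi <= e0 * C0 / (1 - e0) * enorm xi ^+ 2.
    have -> : e0 * C0 / (1 - e0) = e0 * K by rewrite /K mulrA.
    by rewrite expr2 [leRHS]mulrA !ler_wpM2r ?enorm_ge0.
  rewrite /At; case: ifPn => zN.
    rewrite mul_scalar_mx edotZl edotxx ler_wpM2r ?sqr_ge0// lerBlDr ler_wpDr//.
      by rewrite divr_ge0 ?mulr_ge0 ?C0_ge0 ?(ltW e0_gt0)// subr_ge0 ltW.
    by apply: A01_ge; case: Dz.
  have nz : ~ N' z by move=> h; move: zN; rewrite mem_set.
  have h0 := adm_A0_coercive adm (scale_thin Dz) xi.
  rewrite AeE edotDl; have := pert z Dz nz xi xi; rewrite ler_norml => /andP[h1 _].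
  by rewrite mulrBl; apply: lerD => //; apply: le_trans h1; rewrite lerN2.
- move=> z Dz du eta; rewrite /At; case: ifPn => zN.
    have -> : edot ((A1 0 z.1)%:M *m grad_x du z) eta = A1 0 z.1 * du z.1 * eta (lshift n ord0) ord0.
      rewrite mul_scalar_mx edotZl edotE big_split_ord/= big_ord1 -mulrA; congr (_ * _).
      rewrite /grad_x mxE (unsplitK (inl ord0)) big1 ?addr0// => j _.
      by rewrite mxE (unsplitK (inr j)) mul0r.
    rewrite subrr normr0; apply: mulr_ge0; last exact: enorm_ge0.
    by apply: mulr_ge0.
  have nz : ~ N' z by move=> h; move: zN; rewrite mem_set.
  rewrite AeE edotDl (A0_grad_x du eta (scale_thin Dz) (erefl : (sc z).1 = z.1)) addrAC subrr add0r.
  by rewrite -enorm_grad_x; exact: pert.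
Qed.

End coefficients.

(** * Energy estimate *)

Section energy.
Context (R : realType) (n : nat) (a a' : R -> R) (M e e0 alpha0 C0 : R).
Variables (A1 : nat -> R -> R) (A2 : nat -> R * 'rV[R]_n -> 'cV[R]_n)
  (A3 : nat -> R * 'rV[R]_n -> 'M[R]_n).
Hypotheses (H : thin_profile a a' M e) (adm : admissible a A1 A2 A3 e0 alpha0 C0)
  (e_le : e <= e0) (e0_lt1 : e0 < 1).
Local Notation V := (R * 'rV[R]_n)%type.
Local Notation mV := (measurableTypeR R * 'rV[R]_n)%type.
Local Notation mu := (@lebesgue_xy R n).
Local Notation leb := (@lebesgue_measure R).
Local Notation I01 := (`]0%R, 1%R[%classic : set R).
Local Notation D := (@thin R n a e).
Local Notation b := (A1 0).
Let e_gt0 : 0 < e := prof_e_gt0 H.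
Let mD : measurable (D : set mV) := thin_measurable H (n := n).
Let fD := thin_fin n H.

Lemma H1_sub (u u' : V -> R) (gu gu' : V -> 'cV[R]_(1 + n)) : H1 D u gu -> H1 D u' gu' ->
  H1 D (fun z => u z - u' z) (fun z => gu z - gu' z).
Proof.
move=> [/(L2P _ mD) su Hu] [/(L2P _ mD) su' Hu'].
split; first by apply/(L2P _ mD); exact: sqintB.
move=> i; have [/(L2P _ mD) sg wg] := Hu i; have [/(L2P _ mD) sg' wg'] := Hu' i.
split.
  apply/(L2P _ mD); have := sqintB mD sg sg'; apply: sqint_eq => // z _.
  by rewrite !mxE.
move=> phi tphi; have sphi := test_Cc_smooth tphi.
have [C hC] := test_derive_bounded (dir R i) tphi.
have [C' hC'] := Cc_bounded (Cc_smooth_continuous sphi) sphi.2.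
have iD v : sqint mu D v -> mu.-integrable D (EFin \o (fun z => v z * 'D_(dir R i) phi z)).
  move=> sv; exact: mul_continuous_integrable mD (sqint_integrable mD fD sv) (test_derive_continuous tphi) hC.
have ip v : sqint mu D v -> mu.-integrable D (EFin \o (fun z => v z * phi z)).
  move=> sv; exact: mul_continuous_integrable mD (sqint_integrable mD fD sv) (Cc_smooth_continuous sphi) hC'.
under eq_Rintegral do rewrite mulrBl.
rewrite (RintegralB mD (iD _ su) (iD _ su')) (wg _ tphi) (wg' _ tphi) -opprD.
rewrite [X in _ = - X](_ : _ = \int[mu]_(z in D) (gu z i ord0 * phi z - gu' z i ord0 * phi z)).
  by rewrite (RintegralB mD (ip _ sg) (ip _ sg')).
by apply: eq_Rintegral => z _; rewrite !mxE mulrBl.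
Qed.

Lemma form_integrable (At : V -> 'M[R]_(1 + n)) (C : R) (xi eta : V -> 'cV[R]_(1 + n)) :
  (forall i j, measurable_fun (D : set mV) (fun z => At z i j)) ->
  (forall z i j, D z -> `|At z i j| <= C) ->
  (forall i, sqint mu D (fun z => xi z i ord0)) -> (forall i, sqint mu D (fun z => eta z i ord0)) ->
  mu.-integrable D (EFin \o (fun z => edot (At z *m xi z) (eta z))).
Proof.
move=> mA bA sxi seta.
have si i : sqint mu D (fun z => \sum_j At z i j * xi z j ord0).
  apply: sqint_sum => // j; apply: (@sqintMl _ _ _ _ _ _ _ C) => // z Dz; exact: bA.
have [h _] := Rintegral_sum (index_enum 'I_(1 + n)) mD (fun i => sqint_mul mD (si i) (seta i)).
apply: eq_integrable h => // z _ /=; rewrite edotE; congr EFin.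
by apply: eq_bigr => i _; rewrite mxE.
Qed.

Lemma enorm_sq_integrable (xi : V -> 'cV[R]_(1 + n)) : (forall i, sqint mu D (fun z => xi z i ord0)) ->
  mu.-integrable D (EFin \o (fun z => enorm (xi z) ^+ 2)).
Proof.
move=> sxi.
have [h _] := Rintegral_sum (index_enum 'I_(1 + n)) mD (fun i => (sxi i).2).
by apply: eq_integrable h => // z _ /=; rewrite enorm_sqr_col.
Qed.

Variables (f u : V -> R) (gu : V -> 'cV[R]_(1 + n)) (u0 du0 : R -> R).
Hypotheses (Lf : L2 D f) (thin_sol : solves_thin a A1 A2 A3 e f u gu)
  (limit_sol : solves_limit a A1 e f u0 du0).
Let w z := u z - E_ext u0 z.
Let gw z := gu z - grad_x du0 z.
Let Hw : H1 D w gw.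
Proof. by apply: H1_sub; [case: thin_sol|apply: (E_H1 H); case: limit_sol]. Qed.
Let Mw := M_avg a e w.
Let G := avg_grad a a' gw.
Let K := C0 / (1 - e0).
(** [C0 * M] accounts for exchanging D_x w with [G], [K] for exchanging A_eps with A_0. *)
Let K1 := C0 * M + K.
Let gamma := alpha0 - e0 * C0 / (1 - e0).
(** Coercivity constant for the full H^1 norm, including the zeroth-order term. *)
Let m := Num.min gamma 1.
(** The slice Poincare constant with its factor e^2 removed. *)
Let c := 2 ^+ n * (2 * M) ^+ 2.

Let sf : sqint mu D f. Proof. by apply/(L2P _ mD). Qed.
Let sw : sqint mu D w. Proof. by apply/(L2P _ mD); exact: Hw.1. Qed.
Let sgw i : sqint mu D (fun z => gw z i ord0). Proof. by apply/(L2P _ mD); exact: (Hw.2 i).1. Qed.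
Let Lu0 : L2a n a u0. Proof. by case: limit_sol => -[]. Qed.
Let Ldu0 : L2a n a du0. Proof. by case: limit_sol => -[]. Qed.
Let su0 : sqint mu D (fun z => u0 z.1). Proof. exact: (L2a_sqint H Lu0). Qed.
Let sdu0 : sqint mu D (fun z => du0 z.1). Proof. exact: (L2a_sqint H Ldu0). Qed.
Let sG : sqint mu D G. Proof. exact: (sqint_avg_grad H sgw). Qed.
Let sMw : sqint mu D (fun z => Mw z.1). Proof. exact: (M_avg_le H sw).1. Qed.

Let b_ge x : 0 < x < 1 -> alpha0 <= b x. Proof. exact: (A01_ge H adm). Qed.
Let b_le x : 0 < x < 1 -> b x <= C0. Proof. exact: (A01_le H adm). Qed.
Let b_ge0 x : 0 < x < 1 -> 0 <= b x.
Proof. by move=> x01; apply: le_trans (b_ge x01); exact/ltW/(adm_alpha0_gt0 adm). Qed.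
Let b_norm x : 0 < x < 1 -> `|b x| <= C0.
Proof. by move=> x01; rewrite ger0_norm ?b_ge0 ?b_le. Qed.

Let sbdu0 : sqint mu D (fun z => b z.1 * du0 z.1).
Proof.
apply: (@sqintMl _ _ _ _ _ _ _ C0) => //.
  exact: measurable_fst_D (measurable_A01 adm).
by move=> z [z01 _]; exact: b_norm.
Qed.

Let Lbdu0 : L2a n a (fun x => b x * du0 x).
Proof.
apply: (sqint_L2a H) => //; apply: measurable_funM; first exact: (measurable_A01 adm).
by case: Ldu0.
Qed.

Let v0 : 0 < e ^+ n * vol_ball R n.
Proof. by rewrite mulr_gt0 ?exprn_gt0 ?vol_ball_gt0. Qed.

Let iadd1 (g h : R -> R) : leb.-integrable I01 (EFin \o g) -> leb.-integrable I01 (EFin \o h) ->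
  leb.-integrable I01 (EFin \o (fun x => g x + h x)).
Proof. by move=> ig ih; apply: (integrableD _ ig ih); exact: measurable_itv. Qed.

(** The limit equation tested with [Mw] and carried to the thin domain by adjointness; the factor
    e^n |B_1| is common to all terms. *)
Let limit_average : \int[mu]_(z in D) (G z * (b z.1 * du0 z.1)) + \int[mu]_(z in D) (w z * u0 z.1) =
  \int[mu]_(z in D) (f z * Mw z.1).
Proof.
have LMw : L2a n a Mw := M_avg_L2a H sw.
have [i1 E1] := M_avg_adjoint H sG Lbdu0.
have [i2 E2] := M_avg_adjoint H sw Lu0.
have [i3 E3] := M_avg_adjoint H sf LMw.
have [_ lim] := limit_sol.
rewrite E1 E2 E3 -!mulrA -mulrDr; congr (_ * _).
rewrite -(lim _ _ (average_H1a H Hw)) -/G -/Mw -mulrDr -RintegralD// -RintegralZl//; last first.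
  exact: (iadd1 i1 i2).
by apply: eq_Rintegral => x _; rewrite /A_tilde -/G -/Mw; ring.
Qed.

Let M_avg_E (h : R -> R) x : 0 < x < 1 -> M_avg a e (fun z : V => h z.1) x = h x.
Proof.
move=> x01; rewrite /M_avg /= Rintegral_cst; last exact: measurable_eball.
rewrite (congr1 fine (lebesgue_slice n H x01))/= exprMn_comm; last exact: mulrC.
by rewrite [X in _ * X]mulrC mulKf// (slice_volume_neq0 n H).
Qed.

(** The limit equation tested with [u0] itself; averaging undoes extension, so adjointness applies
    here too. *)
Let limit_energy : \int[mu]_(z in D) (b z.1 * du0 z.1 * du0 z.1) + \int[mu]_(z in D) (u0 z.1 * u0 z.1) =
  \int[mu]_(z in D) (f z * u0 z.1).
Proof.
have [[_ _ wu0] lim] := limit_sol.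
have [i1 E1] := M_avg_adjoint H sbdu0 Ldu0.
have [i2 E2] := M_avg_adjoint H su0 Lu0.
have [i3 E3] := M_avg_adjoint H sf Lu0.
rewrite E1 E2 E3 -!mulrA -mulrDr; congr (_ * _).
rewrite -(lim _ _ (And3 Lu0 Ldu0 wu0)) -mulrDr -RintegralD// -RintegralZl//; last first.
  exact: (iadd1 i1 i2).
apply: eq_Rintegral => x /set_mem/I01P x01.
rewrite (M_avg_E (fun x => b x * du0 x) x01) (M_avg_E u0 x01) /A_tilde; ring.
Qed.

Let Rint_nng (h : V -> R) : (forall z, D z -> 0 <= h z) -> 0 <= \int[mu]_(z in D) h z.
Proof. by move=> h0; apply: Rintegral_ge0 => z; exact: h0. Qed.

Let iadd (g h : V -> R) : mu.-integrable D (EFin \o g) -> mu.-integrable D (EFin \o h) ->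
  mu.-integrable D (EFin \o (fun z => g z + h z)).
Proof. by move=> ig ih; have := integrableD mD ig ih. Qed.

Let iscale (k : R) (h : V -> R) : mu.-integrable D (EFin \o h) ->
  mu.-integrable D (EFin \o (fun z => k * h z)).
Proof. by move=> ih; have := integrableZl mD k ih. Qed.

(** From f u0 <= f^2 + u0^2 the zeroth-order terms of the energy identity cancel exactly, leaving
    the derivative. *)
Let du0_le : alpha0 * \int[mu]_(z in D) du0 z.1 ^+ 2 <= \int[mu]_(z in D) f z ^+ 2.
Proof.
have j1 := sqint_mul mD sbdu0 sdu0; have j2 := sqint_mul mD su0 su0.
have j3 := sqint_mul mD sf su0.
have h1 : alpha0 * \int[mu]_(z in D) du0 z.1 ^+ 2 <= \int[mu]_(z in D) (b z.1 * du0 z.1 * du0 z.1).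
  rewrite -RintegralZl//; last exact: sdu0.2.
  apply: le_Rintegral => //; first exact: iscale sdu0.2.
  by move=> z [z01 _]; rewrite -mulrA -expr2 ler_wpM2r ?sqr_ge0// b_ge.
have h2 : \int[mu]_(z in D) (f z * u0 z.1) <=
    \int[mu]_(z in D) f z ^+ 2 + \int[mu]_(z in D) (u0 z.1 * u0 z.1).
  rewrite -RintegralD//; last exact: sf.2.
  apply: le_Rintegral => //; first exact: iadd sf.2 j2.
  move=> z _; have := sqr_ge0 (f z - u0 z.1); have := sqr_ge0 (f z + u0 z.1); nra.
have := limit_energy; lra.
Qed.

Let C0_nonneg : 0 <= C0. Proof. exact: (C0_ge0 H adm). Qed.

Let K_ge0 : 0 <= K. Proof. by rewrite /K divr_ge0// subr_ge0 ltW. Qed.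

Let gw_le z : D z -> forall du : R, `|G z - gw z (lshift n ord0) ord0| * `|du| <= e * M * (`|du| * enorm (gw z)).
Proof.
move=> Dz du; rewrite mulrC [leRHS]mulrCA ler_wpM2l//; apply: le_trans (avg_grad_le H gw Dz) _.
rewrite ler_wpM2l ?mulr_ge0 ?(ltW e_gt0) ?(ltW (prof_M_gt0 H))//.
rewrite /enorm ler_wsqrtr// [leRHS](_ : _ = \sum_i gw z i ord0 ^+ 2); last first.
  by apply: eq_bigr => i _; rewrite big_ord1.
by rewrite big_split_ord/= big_ord1 lerDr sqr_ge0.
Qed.

Let grad_y_le z : grad_y_sq gw z <= enorm (gw z) ^+ 2.
Proof. by rewrite enorm_sqr_col big_split_ord/= big_ord1 lerDr sqr_ge0. Qed.

Let K1_ge0 : 0 <= K1.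
Proof. by rewrite /K1 addr_ge0// mulr_ge0// ltW// (prof_M_gt0 H). Qed.

(** [E] is the coercive energy density of [w]; [Rem] is the mismatch between the thin flux and the
    averaged limit flux of [u0]. On the right only w - M w remains, since the two equations are
    tested with w and with M w. *)
Let energy : exists E Rem : V -> R,
  [/\ mu.-integrable D (EFin \o E), mu.-integrable D (EFin \o Rem),
    \int[mu]_(z in D) E z + \int[mu]_(z in D) Rem z = \int[mu]_(z in D) (f z * (w z - Mw z.1)),
    forall z, D z -> gamma * enorm (gw z) ^+ 2 + w z ^+ 2 <= E z &
    forall z, D z -> `|Rem z| <= e * K1 * (`|du0 z.1| * enorm (gw z))].
Proof.
have [At [mA repl bA cA pA]] := coefficient_ex H adm e_le e0_lt1.
pose q z := edot (At z *m grad_x du0 z) (gw z).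
exists (fun z => edot (At z *m gw z) (gw z) + w z ^+ 2), (fun z => q z - G z * (b z.1 * du0 z.1)).
have sgx i : sqint mu D (fun z : V => (grad_x du0 z : 'cV[R]_(1 + n)) i ord0).
  by have [_ h] := E_H1 H (proj1 limit_sol); apply/(L2P _ mD); exact: (h i).1.
have iq : mu.-integrable D (EFin \o q) by exact: form_integrable mA bA sgx sgw.
have iE1 : mu.-integrable D (EFin \o (fun z => edot (At z *m gw z) (gw z))).
  exact: form_integrable mA bA sgw sgw.
have iE := iadd iE1 sw.2.
have iG := sqint_mul mD sG sbdu0.
have iR : mu.-integrable D (EFin \o (fun z => q z - G z * (b z.1 * du0 z.1))).
  by have := integrableB mD iq iG.
split => //.
- have iwu := sqint_mul mD sw su0.
  have ifw := sqint_mul mD sf sw; have ifM := sqint_mul mD sf sMw.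
  have -> : \int[mu]_(z in D) (f z * (w z - Mw z.1)) =
      \int[mu]_(z in D) (f z * w z) - \int[mu]_(z in D) (f z * Mw z.1).
    by rewrite -RintegralB//; apply: eq_Rintegral => z _; rewrite mulrBr.
  rewrite (RintegralB mD iq iG) -limit_average.
  have [_ /(_ _ _ Hw) thin_eq] := thin_sol.
  rewrite -thin_eq repl.
  (* The thin solution is written as w plus the extension of [u0]. *)
  have -> : \int[mu]_(z in D) (edot (At z *m gu z) (gw z) + u z * w z) =
      \int[mu]_(z in D) (edot (At z *m gw z) (gw z) + w z ^+ 2 + q z + w z * u0 z.1).
    apply: eq_Rintegral => z _.
    have -> : gu z = gw z + grad_x du0 z by rewrite /gw subrK.
    have -> : u z = w z + u0 z.1 by rewrite /w /E_ext subrK.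
    rewrite mulmxDr edotDl /q; ring.
  rewrite (RintegralD mD (iadd iE iq) iwu) (RintegralD mD iE iq); ring.
- by move=> z Dz; rewrite lerD2r; exact: cA.
- move=> z Dz; have z01 := Dz.1.
  (* The first bracket is the defect of the coefficients, the second that of the averaging. *)
  have -> : q z - G z * (b z.1 * du0 z.1) =
      (q z - b z.1 * du0 z.1 * gw z (lshift n ord0) ord0) - b z.1 * ((G z - gw z (lshift n ord0) ord0) * du0 z.1) by ring.
  apply: le_trans (ler_normB _ _) _; rewrite /K1 mulrDr mulrDl addrC; apply: lerD.
    rewrite normrM normrM; apply: (@le_trans _ _ (C0 * (e * M * (`|du0 z.1| * enorm (gw z))))).
      by apply: ler_pM => //; [exact: b_norm|exact: gw_le].
    by rewrite le_eqVlt; apply/orP; left; apply/eqP; ring.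
  by apply: le_trans (pA z Dz du0 (gw z)) _; rewrite [leRHS]mulrA.
Qed.

(** Each of the two error terms is allowed m/4 of the energy [Q], which leaves m/2 on the left;
    dividing by it gives the constant. *)
Lemma energy_estimate :
  \int[mu]_(z in D) (w z ^+ 2 + enorm (gw z) ^+ 2) <=
  2 * e ^+ 2 * (c + K1 ^+ 2 / alpha0) / m ^+ 2 * \int[mu]_(z in D) f z ^+ 2.
Proof.
have a0 := adm_alpha0_gt0 adm.
have m0 : 0 < m by rewrite /m lt_min ltr01 andbT; exact: (adm_small adm).
have c0 : 0 < c by rewrite mulr_gt0 ?exprn_gt0 ?mulr_gt0 ?(prof_M_gt0 H).
have [E [Rem [iE iR EQ lbE ubR]]] := energy.
have ien := enorm_sq_integrable sgw.
set Q := \int[mu]_(z in D) (w z ^+ 2 + enorm (gw z) ^+ 2).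
have iQ := iadd sw.2 ien.
set F := \int[mu]_(z in D) f z ^+ 2; set P := \int[mu]_(z in D) du0 z.1 ^+ 2.
have F0 : 0 <= F by apply: Rint_nng => z _; exact: sqr_ge0.
have P0 : 0 <= P by apply: Rint_nng => z _; exact: sqr_ge0.
have h1 : m * Q <= \int[mu]_(z in D) E z.
  rewrite -RintegralZl//; apply: le_Rintegral => //; first exact: iscale.
  move=> z Dz; apply: le_trans (lbE z Dz); rewrite mulrDr addrC lerD//.
    by rewrite ler_wpM2r ?sqr_ge0// ge_min lexx.
  by rewrite ler_piMl ?sqr_ge0// ge_min lexx orbT.
have h2 : (- \int[mu]_(z in D) Rem z) <= m / 4 * Q + e ^+ 2 * K1 ^+ 2 / m * P.
  rewrite -mulN1r -!RintegralZl//; last exact: sdu0.2.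
  rewrite -RintegralD//; [|exact: iscale|exact: iscale sdu0.2].
  apply: le_Rintegral => //; [exact: iscale|exact: iadd (iscale _ iQ) (iscale _ sdu0.2)|].
  move=> z Dz; rewrite mulN1r; apply: (@le_trans _ _ (e * K1 * (`|du0 z.1| * enorm (gw z)))).
    by apply: le_trans (ubR z Dz); rewrite -normrN ler_norm.
  set x := `|du0 z.1|; set y := enorm (gw z).
  have -> : du0 z.1 ^+ 2 = x ^+ 2 by rewrite /x real_normK// num_real.
  apply: (@le_trans _ _ (m / 4 * y ^+ 2 + e ^+ 2 * K1 ^+ 2 / m * x ^+ 2)); last first.
    by rewrite lerD2r ler_wpM2l ?divr_ge0 ?(ltW m0)// lerDr sqr_ge0.
  (* The difference is the completed square (m/2 y - e K1 x)^2 / m. *)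
  rewrite -subr_ge0; apply: le_trans (_ : 0 <= m^-1 * (m / 2 * y - e * K1 * x) ^+ 2) _.
    by rewrite mulr_ge0 ?sqr_ge0// invr_ge0 ltW.
  by rewrite le_eqVlt; apply/orP; left; apply/eqP; field; rewrite gt_eqF.
have poin := poincare H Hw.
have h3 : \int[mu]_(z in D) (f z * (w z - Mw z.1)) <= c * e ^+ 2 / m * F + m / 4 * Q.
  have sd := sqintB mD sw sMw.
  have hP : \int[mu]_(z in D) (w z - Mw z.1) ^+ 2 <= c * e ^+ 2 * Q.
    apply: le_trans poin _; have -> : 2 ^+ n * (2 * (e * M)) ^+ 2 = c * e ^+ 2 by rewrite /c; ring.
    apply: ler_wpM2l; first by rewrite mulr_ge0 ?sqr_ge0 ?(ltW c0).
    apply: le_Rintegral => //.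
      have [h _] := Rintegral_sum (index_enum 'I_n) mD (fun j => (sgw (rshift 1 j)).2).
      exact: h.
    by move=> z _; apply: le_trans (grad_y_le z) _; rewrite lerDr sqr_ge0.
  have ce : 0 < c * e ^+ 2 by rewrite mulr_gt0// exprn_gt0.
  (* The weights in Young's inequality are chosen so that the Poincare inequality turns the second
     term into m/4 times [Q]. *)
  apply: (@le_trans _ _ (c * e ^+ 2 / m * F + m / (4 * (c * e ^+ 2)) * \int[mu]_(z in D) (w z - Mw z.1) ^+ 2)).
    rewrite -!RintegralZl//; [|exact: sd.2|exact: sf.2].
    rewrite -RintegralD//; [|exact: iscale sf.2|exact: iscale sd.2].
    apply: le_Rintegral => //; [exact: sqint_mul|exact: iadd (iscale _ sf.2) (iscale _ sd.2)|].
    move=> z _; set y := w z - Mw z.1; set x := f z; set k := c * e ^+ 2.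
    rewrite -subr_ge0; apply: le_trans (_ : 0 <= (k * m)^-1 * (k * x - m / 2 * y) ^+ 2) _.
      by rewrite mulr_ge0 ?sqr_ge0// invr_ge0 mulr_ge0 ?(ltW m0)// ltW.
    by rewrite le_eqVlt; apply/orP; left; apply/eqP; field; rewrite !gt_eqF.
  rewrite lerD2l; apply: (@le_trans _ _ (m / (4 * (c * e ^+ 2)) * (c * e ^+ 2 * Q))).
    by rewrite ler_wpM2l// divr_ge0 ?(ltW m0)// mulr_ge0 ?(ltW ce).
  by rewrite le_eqVlt; apply/orP; left; apply/eqP; field; rewrite !gt_eqF.
have hP : P <= F / alpha0 by rewrite ler_pdivlMr// mulrC; exact: du0_le.
have h4 : e ^+ 2 * K1 ^+ 2 / m * P <= e ^+ 2 * K1 ^+ 2 / m * (F / alpha0).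
  by rewrite ler_wpM2l// divr_ge0 ?(ltW m0)// mulr_ge0 ?sqr_ge0.
(* The energy terms of [h2] and [h3] are absorbed into the left side of [h1]. *)
have h5 : m / 2 * Q <= c * e ^+ 2 / m * F + e ^+ 2 * K1 ^+ 2 / m * (F / alpha0) by lra.
have -> : 2 * e ^+ 2 * (c + K1 ^+ 2 / alpha0) / m ^+ 2 * F =
    (m / 2)^-1 * (c * e ^+ 2 / m * F + e ^+ 2 * K1 ^+ 2 / m * (F / alpha0)).
  by field; rewrite !gt_eqF.
by rewrite mulrC ler_pdivlMr ?divr_gt0// mulrC.
Qed.

(** The condition on [C] is put on its square, so that the roots in the two norms are taken only
    once, at the end. *)
Lemma H1_estimate (C : R) : 0 <= C -> 2 * (c + K1 ^+ 2 / alpha0) / m ^+ 2 <= C ^+ 2 ->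
  H1 D w gw /\ (H1norm D w gw <= (C * e)%:E * L2norm D f)%E.
Proof.
move=> Cge0 hC; split; first exact: Hw.
have iQ := iadd sw.2 (enorm_sq_integrable sgw).
have F0 : 0 <= \int[mu]_(z in D) f z ^+ 2 by apply: Rint_nng => z _; exact: sqr_ge0.
have Q0 : 0 <= \int[mu]_(z in D) (w z ^+ 2 + enorm (gw z) ^+ 2).
  by apply: Rint_nng => z _; rewrite addr_ge0 ?sqr_ge0.
rewrite /H1norm (L2normE _ mD).
rewrite -[X in (X `^ _ <= _)%E]fineK; last by have := integrable_fin_num mD iQ.
rewrite -[X in (_ <= _ * X `^ _)%E]fineK; last by have := integrable_fin_num mD sf.2.
rewrite !poweR_EFin -EFinM lee_fin.
rewrite -/(Rintegral mu D (fun z => w z ^+ 2 + enorm (gw z) ^+ 2)) -/(Rintegral mu D (fun z => f z ^+ 2)).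
rewrite !powR12_sqrt//.
have Ce : 0 <= C * e by rewrite mulr_ge0// ltW.
have -> : C * e = Num.sqrt ((C * e) ^+ 2) by rewrite sqrtr_sqr ger0_norm.
rewrite -sqrtrM ?sqr_ge0// ler_wsqrtr//; apply: le_trans energy_estimate _.
rewrite ler_wpM2r//; have -> : 2 * e ^+ 2 * (c + K1 ^+ 2 / alpha0) / m ^+ 2 =
  (2 * (c + K1 ^+ 2 / alpha0) / m ^+ 2) * e ^+ 2 by ring.
have -> : (C * e) ^+ 2 = C ^+ 2 * e ^+ 2 by ring.
by rewrite ler_wpM2r ?sqr_ge0.
Qed.

End energy.

(** * Choice of the constant *)

Unset Implicit Arguments.
Set Strict Implicit.

Theorem theorem4p2 (R : realType) (n : nat) (a : R -> R) (e0 alpha0 C0 : R)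
    (A1 : nat -> R -> R) (A2 : nat -> R * 'rV[R]_n -> 'cV[R]_n)
    (A3 : nat -> R * 'rV[R]_n -> 'M[R]_n)
    (a_C1 : C1_01 a) (a_ge0 : forall x : R, 0 <= x <= 1 -> 0 <= a x)
    (a0 : a 0 = 0) (a_gt0 : forall x : R, 0 < x <= 1 -> 0 < a x)
    (e0_gt0 : 0 < e0) (e0_lt1 : e0 < 1)
    (A_adm : admissible a A1 A2 A3 e0 alpha0 C0) :
  exists2 C : R, 0 < C &
    forall (e : R) (f u : R * 'rV[R]_n -> R) (gu : R * 'rV[R]_n -> 'cV[R]_(1 + n))
      (u0 du0 : R -> R),
    0 < e <= e0 -> L2 (thin a e) f ->
    solves_thin a A1 A2 A3 e f u gu ->
    solves_limit a A1 e f u0 du0 ->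
    exists gw : R * 'rV[R]_n -> 'cV[R]_(1 + n),
      H1 (thin a e) (fun z => u z - E_ext u0 z) gw /\
      (H1norm (thin a e) (fun z => (u z - E_ext u0 z)%R) gw <=
        (C * e)%:E * L2norm (thin a e) f)%E.
Proof.
have [a' [M [M0 da ca' a'M aM]]] := C1_01_data a_C1.
(* The square of the required constant; it is fixed before [e] and [f] are introduced. *)
set k := 2 * (2 ^+ n * (2 * M) ^+ 2 + (C0 * M + C0 / (1 - e0)) ^+ 2 / alpha0) /
  Num.min (alpha0 - e0 * C0 / (1 - e0)) 1 ^+ 2.
(* The added 1 makes the constant positive, and its square still dominates [k]. *)
exists (Num.sqrt k + 1); first by rewrite ltr_wpDl ?sqrtr_ge0.
move=> e f u gu u0 du0 /andP[e_gt0 e_le] Lf hthin hlimit.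
have H : thin_profile a a' M e.
  apply: ThinProfile => //; move=> x /andP[x0 x1]; apply: a_gt0; rewrite x0 ltW//.
have k0 : 0 <= k.
  have p1 : 0 <= 2 ^+ n * (2 * M) ^+ 2 :> R by apply: mulr_ge0; [exact: exprn_ge0|exact: sqr_ge0].
  have p2 : 0 <= (C0 * M + C0 / (1 - e0)) ^+ 2 / alpha0.
    by apply: divr_ge0; [exact: sqr_ge0|exact/ltW/(adm_alpha0_gt0 A_adm)].
  by apply: divr_ge0; [apply: mulr_ge0 => //; exact: addr_ge0|exact: sqr_ge0].
exists (fun z => gu z - grad_x du0 z).
apply: (H1_estimate H A_adm e_le e0_lt1 Lf hthin hlimit).
  by rewrite addr_ge0 ?sqrtr_ge0.
have s := sqr_sqrtr k0; have s0 := sqrtr_ge0 k; rewrite -/k; nra.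
Qed.
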